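(* Let $k\geq 2$ and let $\mathcal{W}$ be an irreducible $k$-web on the complex projective plane $\mathbb{P}^2$. Then the polar curve $P_p^{\mathcal{W}}$ is decomposable (i.e. reducible) for generic $p\in\mathbb{P}^2$ if and only if $\deg\mathcal{W}=0$.
   Context: Webs. A $k$-web $\mathcal{W}$ of degree $d$ on $\mathbb{P}^2=\mathbb{P}^2_{\mathbb{C}}$ is given, up to a nonzero constant factor, by a section $\omega\in H^0(\mathbb{P}^2,\mathrm{Sym}^k\Omega^1_{\mathbb{P}^2}\otimes\mathcal{O}_{\mathbb{P}^2}(d+2k))$ whose zero set $\mathrm{Sing}(\mathcal{W})$ has codimension at least two and whose germ at a generic point $x$ is, as a homogeneous polynomial of degree $k$ in $\mathcal{O}_x[dx_1,dx_2]$, square-free and a product of $k$ germs of (integrable) $1$-forms. The degree $d=\deg\mathcal{W}$ equals the degree of the tangency divisor between $\mathcal{W}$ and a generic line. A point $x\notin \mathrm{Sing}(\mathcal{W})$ is smooth for $\mathcal{W}$ if the germ of $\omega$ at $x$ has these last two properties; the $k$ distinct lines through $x$ tangent to the factors are the tangent lines of $\mathcal{W}$ at $x$. The product $\mathcal{W}_1\boxtimes\mathcal{W}_2$ is the web defined by $\omega_1\omega_2$; a web is decomposable if it is globally a product of two webs (a $k_1$-web and a $k_2$-web with $k_1,k_2\ge1$), and irreducible otherwise. Polar curves. Let $M=\{(x,\ell): x\in\ell\}\subset\mathbb{P}^2\times\check{\mathbb{P}}^2$ be the point-line incidence variety, with projections $\pi:M\to\mathbb{P}^2$, $\check\pi:M\to\check{\mathbb{P}}^2$.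 Let $S_{\mathcal{W}}\subset M$ be the closure of the set of $(x,\ell)$ with $x$ a smooth point of $\mathcal{W}$ and $\ell$ a tangent line of $\mathcal{W}$ at $x$. For $p\in\mathbb{P}^2$ let $\mathcal{L}_p$ be the family of lines through $p$ (a line in $\check{\mathbb{P}}^2$; also the radial foliation with center $p$), and $\mathcal{H}_p=\check\pi^{-1}(\mathcal{L}_p)$. The polar of $\mathcal{W}$ with center $p$ is $P_p^{\mathcal{W}}=\pi(S_{\mathcal{W}}\cap\mathcal{H}_p)$, the tangency locus of $\mathcal{W}$ and $\mathcal{L}_p$. When it is not all of $\mathbb{P}^2$ it is considered as a plane curve (divisor) of degree $d+k$: the zero divisor of the section of $\mathcal{O}_{\mathbb{P}^2}(d+k)$ obtained by evaluating $\omega$ on $k$ copies of the vector field $v_p\in H^0(\mathbb{P}^2,T\mathbb{P}^2\otimes\mathcal{O}_{\mathbb{P}^2}(-1))$ defining $\mathcal{L}_p$. ''Generic $p$'' means $p$ in some nonempty Zariski open subset of $\mathbb{P}^2$. *)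

(* Defs.v *)
(* mpoly has to be imported before the analysis files: in the other order
   their notations clash. *)
From mathcomp Require Import all_boot all_order all_algebra.
From mathcomp Require Import mpoly complex.
From mathcomp Require Import boolp classical_sets reals topology normedtype derive.

Set Implicit Arguments.
Unset Strict Implicit.
Unset Printing Implicit Defensive.

Import Order.TTheory GRing.Theory Num.Theory.
Import numFieldNormedType.Exports.

Local Open Scope ring_scope.

(* Everything is written over an arbitrary numClosedFieldType C (which carries
   the topology of its norm); the intended instance is C = R[i], R : realType.
   Points of P^2 and of the dual plane are given by nonzero vectors of
   homogeneous coordinates 'I_3 -> C; a line is given by the coefficients of an
   equation. *)

Definition nonzero (C : numClosedFieldType) (x : 'I_3 -> C) : Prop :=
  exists i, x i != 0.

Definition incident (C : numClosedFieldType) (x l : 'I_3 -> C) : Prop :=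
  \sum_(i < 3) l i * x i = 0.

(* The complement in P^2 of the common zeros of a family I of homogeneous
   polynomials. *)
Definition zariski_open (C : numClosedFieldType) (U : ('I_3 -> C) -> Prop) :
    Prop :=
  exists I : {mpoly C[3]} -> Prop,
    (forall g, I g -> exists e : nat, g \is e.-homog) /\
    (forall x, nonzero x -> (U x <-> exists g, I g /\ g.@[x] != 0)).

Definition generic (C : numClosedFieldType) (P : ('I_3 -> C) -> Prop) : Prop :=
  exists U : ('I_3 -> C) -> Prop,
    [/\ zariski_open U,
        exists x, nonzero x /\ U x
      & forall x, nonzero x -> U x -> P x].

(* An element of C[X_0, X_1, X_2][Y_0, Y_1, Y_2]; as a symmetric form on C^3,
   the inner variables are the coordinates and the outer ones are
   dX_0, dX_1, dX_2. *)
Notation bipoly C := {mpoly {mpoly C[3]}[3]}.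

Definition at_point (C : numClosedFieldType) (w : bipoly C) (x : 'I_3 -> C) :
    {mpoly C[3]} :=
  map_mpoly (meval x) w.

Definition bihomogeneous (C : numClosedFieldType) (e k : nat) (w : bipoly C) :
    Prop :=
  w \is k.-homog /\ forall m, w@_m \is e.-homog.

(* Contraction with the radial vector field \sum_i X_i d/dX_i. *)
Definition radial_contraction (C : numClosedFieldType) (w : bipoly C) :
    bipoly C :=
  \sum_(i < 3) ('X_i : {mpoly C[3]})%:MP * w^`M(i).

(* H^0(P^2, Sym^k Omega^1 (x) O(d + 2k)). By the Euler sequence, Sym^k Omega^1
   is the kernel of the radial contraction
     Sym^k (O(-1)^3) -> Sym^(k-1) (O(-1)^3),
   where O(-1)^3 has basis dX_0, dX_1, dX_2; twisting by O(d + 2k) leaves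
   coefficients of degree (d + 2k) - k = d + k. *)
Definition twisted_symform (C : numClosedFieldType) (k d : nat) (w : bipoly C) :
    Prop :=
  bihomogeneous (d + k) k w /\ radial_contraction w = 0.

Definition sing (C : numClosedFieldType) (w : bipoly C) (x : 'I_3 -> C) : Prop :=
  at_point w x = 0.

(* Codimension at least two: the closed set sing w contains no plane curve
   (and, taking g = 0, is not the whole plane). *)
Definition sing_codim2 (C : numClosedFieldType) (w : bipoly C) : Prop :=
  forall (e : nat) (g : {mpoly C[3]}), (0 < e)%N -> g \is e.-homog ->
    exists x, [/\ nonzero x, g.@[x] = 0 & ~ sing w x].

(* The affine chart X_i = 1, with the other two coordinates in increasing
   order of their indices. *)
Definition affine_point (C : numClosedFieldType) (i : 'I_3) (z : 'rV[C]_2) :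
    'I_3 -> C :=
  fun j => if unlift i j is Some j' then z 0 j' else 1.

Definition affine_coord (C : numClosedFieldType) (i : 'I_3) (x : 'I_3 -> C) :
    'rV[C]_2 :=
  \row_(j < 2) (x (lift i j) / x i).

(* The form in this chart, at the point z, as a polynomial in the
   differentials 'X_0, 'X_1 of the affine coordinates: X_i := 1, dX_i := 0. *)
Definition local_form (C : numClosedFieldType) (i : 'I_3) (w : bipoly C)
    (z : 'rV[C]_2) : {mpoly C[2]} :=
  at_point w (affine_point i z) \mPo
    [tuple (if unlift i j is Some j' then 'X_j' else 0) | j < 3].

(* Differentials here are C-linear. *)
Definition holomorphic_at (C : numClosedFieldType) (z : 'rV[C]_2)
    (f : 'rV[C]_2 -> C) : Prop :=
  \forall y \near z, differentiable f y.

(* Representatives of elements of O_z[dx_1, dx_2]; two of them have the same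
   germ when they agree near z. *)
Definition germ_poly (C : numClosedFieldType) (z : 'rV[C]_2)
    (b : 'rV[C]_2 -> {mpoly C[2]}) : Prop :=
  (forall m, holomorphic_at z (fun y => (b y)@_m)) /\
  (exists n : nat, \forall y \near z, (msize (b y) <= n)%N).

Definition germ_unit (C : numClosedFieldType) (z : 'rV[C]_2)
    (b : 'rV[C]_2 -> {mpoly C[2]}) : Prop :=
  exists2 c, germ_poly z c & \forall y \near z, b y * c y = 1.

Definition germ_squarefree (C : numClosedFieldType) (z : 'rV[C]_2)
    (f : 'rV[C]_2 -> {mpoly C[2]}) : Prop :=
  forall b c, germ_poly z b -> germ_poly z c ->
    (\forall y \near z, f y = b y ^+ 2 * c y) -> germ_unit z b.

(* The germ of f at z is the product of the k germs of 1-forms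
   a j 0 dx_1 + a j 1 dx_2. (In dimension two every 1-form is integrable.) *)
Definition germ_factorization (C : numClosedFieldType) (k : nat) (z : 'rV[C]_2)
    (f : 'rV[C]_2 -> {mpoly C[2]}) (a : 'I_k -> 'I_2 -> 'rV[C]_2 -> C) : Prop :=
  (forall j m, holomorphic_at z (a j m)) /\
  (\forall y \near z, f y = \prod_(j < k) \sum_(m < 2) a j m y *: 'X_m).

Definition web_germ (C : numClosedFieldType) (k : nat) (w : bipoly C)
    (x : 'I_3 -> C) : Prop :=
  exists2 i, x i != 0 &
    germ_squarefree (affine_coord i x) (local_form i w) /\
    exists a : 'I_k -> 'I_2 -> 'rV[C]_2 -> C,
      germ_factorization (affine_coord i x) (local_form i w) a.

Record web (C : numClosedFieldType) (k d : nat) := Web {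
  web_form :> bipoly C;
  web_formP : twisted_symform k d web_form;
  web_sing : sing_codim2 web_form;
  web_generic_germ : generic (web_germ k web_form) }.

(* W is the product of W1 and W2; webs are given up to a nonzero constant. *)
Definition is_web_product (C : numClosedFieldType) (k d k1 d1 k2 d2 : nat)
    (W : web C k d) (W1 : web C k1 d1) (W2 : web C k2 d2) : Prop :=
  exists2 c : C, c != 0 &
    (W : bipoly C) = c%:MP%:MP * ((W1 : bipoly C) * (W2 : bipoly C)).

Definition web_decomposable (C : numClosedFieldType) (k d : nat)
    (W : web C k d) : Prop :=
  exists (k1 d1 k2 d2 : nat) (W1 : web C k1 d1) (W2 : web C k2 d2),
    [/\ (0 < k1)%N, (0 < k2)%N & is_web_product W W1 W2].

Definition web_irreducible (C : numClosedFieldType) (k d : nat)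
    (W : web C k d) : Prop :=
  ~ web_decomposable W.

Definition smooth_point (C : numClosedFieldType) (k d : nat) (W : web C k d)
    (x : 'I_3 -> C) : Prop :=
  [/\ nonzero x, ~ sing W x & web_germ k W x].

(* l is a line through the smooth point x whose direction is in the kernel of
   the value at x of one of the local factors. In the chart X_i = 1, the
   direction of l is the kernel of \sum_m l_(lift i m) dx_m. *)
Definition tangent_line (C : numClosedFieldType) (k d : nat) (W : web C k d)
    (x l : 'I_3 -> C) : Prop :=
  [/\ smooth_point W x, nonzero l, incident x l &
      exists (i : 'I_3) (a : 'I_k -> 'I_2 -> 'rV[C]_2 -> C) (j : 'I_k),
        [/\ x i != 0,
            germ_factorization (affine_coord i x) (local_form i W) a
          & forall v : 'rV[C]_2,
              \sum_(m < 2) l (lift i m) * v 0 m = 0 ->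
              \sum_(m < 2) a j m (affine_coord i x) * v 0 m = 0]].

(* The surface S_W: Zariski closure, in the incidence variety, of the set of
   pairs (smooth point, tangent line). *)
Definition tangency_surface (C : numClosedFieldType) (k d : nat) (W : web C k d)
    (x l : 'I_3 -> C) : Prop :=
  [/\ nonzero x, nonzero l, incident x l &
      forall (e1 e2 : nat) (G : bipoly C), bihomogeneous e1 e2 G ->
        (forall y t, tangent_line W y t -> (at_point G y).@[t] = 0) ->
        (at_point G x).@[l] = 0].

Definition polar_locus (C : numClosedFieldType) (k d : nat) (W : web C k d)
    (p x : 'I_3 -> C) : Prop :=
  exists2 l, tangency_surface W x l & incident p l.

(* The form evaluated on k copies of the constant vector field p of C^3, which
   represents the section of TP^2(-1) defining the pencil of lines through p. *)
Definition polar_section (C : numClosedFieldType) (k d : nat) (W : web C k d)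
    (p : 'I_3 -> C) : {mpoly C[3]} :=
  (web_form W).@[fun i => (p i)%:MP].

(* The divisor of the homogeneous polynomial s is a sum of two plane curves
   of positive degree. *)
Definition curve_decomposable (C : numClosedFieldType) (s : {mpoly C[3]}) :
    Prop :=
  s != 0 /\
  exists (e1 e2 : nat) (g1 g2 : {mpoly C[3]}),
    [/\ (0 < e1)%N, (0 < e2)%N, g1 \is e1.-homog, g2 \is e2.-homog
      & s = g1 * g2].

Definition polar_decomposable (C : numClosedFieldType) (k d : nat)
    (W : web C k d) (p : 'I_3 -> C) : Prop :=
  (exists2 x, nonzero x & ~ polar_locus W p x) /\
  curve_decomposable (polar_section W p).

(* Main.v *)
(* A web of degree d on P^2 is a form w(x; y), bihomogeneous of degree d + k in x
   and k in y, with w(x; y + t x) = w(x; y); its polar section of center p is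
   w(.; p).

   If d = 0, then w(x + t y; y) = w(x; y), so w(.; p) is a product of lines
   through p.

   If d > 0, factors of w over C[x, y] are webs (locally, they are products of
   some of the given 1-forms), so w is a prime element. By elimination, at a
   general x there is a direction v with w(x; v) = 0 and d/ds w(x + s v; v) <> 0
   at s = 0. Restrict the sections with centers v + t x to an affine plane through
   x with coordinates u, z: this gives f in C[t][u][z], which is prime because
   C(P^2 x P^2 modulo shears) is C(t, u, z), and which has a smooth branch
   z = phi_t(u) at the origin, with phi in C[t][[u]]. If the section splits for
   general t, some polynomial of degree < d + k in z vanishes on this branch to
   high order. This is a linear condition with coefficients in C[t], so it has a
   solution over C[t]; its resultant with f is nonzero, but vanishes to an order
   higher than its degree. *)

Require Import Defs.
From HB Require Import structures.
From mathcomp Require Import all_boot all_order all_algebra.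
From mathcomp Require Import perm mpoly complex ring zify.
From mathcomp Require Import boolp classical_sets reals topology normedtype derive.

Set Implicit Arguments.
Unset Strict Implicit.
Unset Printing Implicit Defensive.

Import Order.TTheory GRing.Theory Num.Theory.
Local Open Scope ring_scope.

(** * Factorial rings and elimination *)

(** Primality of [f] alone is not enough: [z^2 - t] is prime in C[t, u, z], yet it splits for every
    value of [t], because the factors need not depend rationally on [t]. The branch [phi] removes
    this obstacle. It is simple and its coefficients lie in C[t], so for each [t] exactly one factor
    vanishes at the origin, and that factor vanishes on the branch to the same order as the whole
    section. Only finitely many coefficients along the branch are compared, so the conditions on the
    factor form a finite linear system over C[t], and solvability for general [t] passes to C(t).
    The centers [v + t x] make this possible. By shear invariance w(x; v + t x) = w(x; v) = 0, so
    all the sections pass through [x]; their first-order coefficient in the direction [v] does not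
    depend on [t] either, so Newton's iteration divides only by a nonzero complex number. If
    splitting is known for the centers off a curve g = 0, the line of centers leaves this curve as
    soon as g(x) is nonzero, g(x) being the top coefficient of g(v + t x) in [t]. *)

Definition divides (R : comNzRingType) (a b : R) : Prop := exists c, b = c * a.

Definition prime_elt (R : comNzRingType) (p : R) : Prop :=
  [/\ p != 0, ~ divides p 1
    & forall a b, divides p (a * b) -> divides p a \/ divides p b].

(** The factors are prime rather than merely irreducible, so existence of a factorization already
    forces its uniqueness. *)
Definition factorial_ring (R : comNzRingType) : Prop :=
  forall a : R, a != 0 -> exists (u : R) (s : seq R),
    [/\ divides u 1, forall p, p \in s -> prime_elt p
      & a = u * \prod_(p <- s) p].

Section Divides.
Variable R : idomainType.
Implicit Types a b c p : R.

Lemma dividesMl a b c : divides a c -> divides a (b * c).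
Proof. by case=> x ->; exists (b * x); rewrite mulrA. Qed.

Lemma dividesMr a b c : divides a b -> divides a (b * c).
Proof. by rewrite mulrC; exact: dividesMl. Qed.

Lemma divides_mull a b : divides a (b * a).
Proof. by exists b. Qed.

Lemma divides_mulr a b : divides a (a * b).
Proof. by exists b; rewrite mulrC. Qed.

Lemma dividesD a b c : divides a b -> divides a c -> divides a (b + c).
Proof. by case=> x -> [y ->]; exists (x + y); rewrite mulrDl. Qed.

Lemma dividesB a b c : divides a b -> divides a c -> divides a (b - c).
Proof. by case=> x -> [y ->]; exists (x - y); rewrite mulrBl. Qed.

Lemma divides0 a : divides a 0.
Proof. by exists 0; rewrite mul0r. Qed.

Lemma divides_trans b a c : divides a b -> divides b c -> divides a c.
Proof. by case=> x -> [y ->]; exists (y * x); rewrite mulrA. Qed.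

Lemma prime_elt_exp p a n :
  prime_elt p -> divides p (a ^+ n) -> divides p a.
Proof.
move=> [p0 pu pp]; elim: n => [|n IHn]; first by rewrite expr0.
by rewrite exprS => /pp [].
Qed.

Lemma prime_elt_prod p (s : seq R) :
  prime_elt p -> divides p (\prod_(q <- s) q) -> exists2 q, q \in s & divides p q.
Proof.
move=> [p0 pu pp]; elim: s => [|q s IHs]; first by rewrite big_nil.
rewrite big_cons => /pp [pq|/IHs [r rs pr]]; first by exists q; rewrite ?mem_head.
by exists r; rewrite // inE rs orbT.
Qed.

Lemma prime_elt_divisor a :
  factorial_ring R -> a != 0 -> ~ divides a 1 ->
  exists2 p, prime_elt p & divides p a.
Proof.
move=> fR a0 au; have [u [[|p s] [u1 ps e]]] := fR _ a0.
  by case: au; rewrite e big_nil mulr1.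
exists p; first by apply: ps; rewrite mem_head.
by rewrite e big_cons; apply/dividesMl/divides_mulr.
Qed.

End Divides.

(** * Gauss's lemma and factoriality of polynomial rings *)

Section PolyFactorial.
Variable R : idomainType.
Implicit Types (f g h : {poly R}) (c p : R).

Lemma divides_polyC p f : divides p%:P f <-> forall i, divides p f`_i.
Proof.
split=> [[g ->] i|]; first by rewrite coefMC; exact: divides_mull.
elim/poly_ind: f => [|f c IHf] pf; first exact: divides0.
apply: dividesD.
  by apply/dividesMr/IHf => i; have := pf i.+1; rewrite coefD coefMX coefC addr0.
have [x] := pf 0%N; rewrite coefD coefMX coefC add0r /= => ->.
by exists x%:P; rewrite polyCM.
Qed.

(** The prime divides the product of the constant terms, hence one of them; that term can be
    discarded and a factor ['X] cancelled, which lowers the total size. *)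
Lemma prime_elt_polyC p : prime_elt p -> prime_elt p%:P.
Proof.
move=> [p0 pu pp]; split; first by rewrite polyC_eq0.
  by move/divides_polyC/(_ 0%N); rewrite coefC.
move=> f g; have [n] := ubnP (size f + size g).
elim: n f g => // n IHn f g; rewrite ltnS => len pfg.
have [->|f0] := eqVneq f 0; first by left; exact: divides0.
have [->|g0] := eqVneq g 0; first by right; exact: divides0.
have decomp h : h != 0 -> exists h' c, h = h' * 'X + c%:P /\ (size h' < size h)%N.
  elim/poly_ind: h => [|h c _] h0; first by rewrite eqxx in h0.
  exists h, c; split=> //; rewrite size_MXaddC.
  by case: ifP h0 => // /andP[/eqP-> /eqP->]; rewrite mul0r add0r eqxx.
have step f' g' : f' != 0 -> (size f' + size g' <= n)%N ->
    divides p%:P (f' * g') -> divides p f'`_0 ->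
    divides p%:P f' \/ divides p%:P g'.
  move=> f'0; have [f1 [c [-> lt]]] := decomp _ f'0 => len' pfg'.
  rewrite coefD coefMX coefC add0r => /= -[x ec].
  have pc : divides p%:P c%:P by exists x%:P; rewrite ec polyCM.
  have : divides p%:P (f1 * g').
    have : divides p%:P (f1 * g' * 'X).
      have -> : f1 * g' * 'X = (f1 * 'X + c%:P) * g' - c%:P * g'.
        by rewrite mulrDl addrK mulrAC.
      by apply: dividesB => //; exact: dividesMr.
    move/divides_polyC => h; apply/divides_polyC => i.
    by have := h i.+1; rewrite coefMX.
  case/IHn => [|pf1|]; [|left|by right].
    by rewrite (leq_trans _ len') // ltn_add2r.
  by apply: dividesD => //; exact: dividesMr.
have : divides p (f`_0 * g`_0).
  by rewrite -coef0M; move/divides_polyC: pfg.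
case/pp => pc; first exact: (step f g).
have [] := step g f g0 => //; first by rewrite addnC.
- by rewrite mulrC.
- by right.
- by left.
Qed.

Definition primitive_poly f := forall p, prime_elt p -> ~ divides p%:P f.

(** A prime of [R] that divides [h * f] divides [h], as [f] is primitive; so the prime factors of
    [c] are cancelled one at a time. *)
Lemma primitive_cancel f g h c :
  factorial_ring R -> primitive_poly f -> c != 0 ->
  c%:P * g = h * f -> divides f g.
Proof.
move=> fR pf c0; have [u [s [[v uv] ps ->]]] := fR _ c0.
elim: s h ps => [|p s IHs] h ps.
  rewrite big_nil mulr1 => e; exists (v%:P * h).
  by rewrite -mulrA -e mulrA -polyCM -uv mul1r.
rewrite big_cons polyCM polyCM -!mulrA mulrCA => e.
have pp : prime_elt p by apply: ps; rewrite mem_head.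
have [p0 _ _] := pp.
have [_ _ ppoly] := prime_elt_polyC pp.
have [h1 eh] : divides p%:P h.
  have phf : divides p%:P (h * f) by rewrite -e; exact: divides_mulr.
  by have [//|/pf] := ppoly h f phf => /(_ pp).
apply: (IHs h1); first by move=> q qs; apply: ps; rewrite inE qs orbT.
have pP0 : p%:P != 0 :> {poly R} by rewrite polyC_eq0.
by apply: (mulfI pP0); rewrite polyCM -!mulrA e eh mulrAC mulrC.
Qed.

(** A prime dividing [f] divides its leading coefficient, whose number of prime factors therefore
    bounds how often a prime can be taken out. *)
Lemma primitive_part f : factorial_ring R -> f != 0 ->
  exists c f0, [/\ c != 0, primitive_poly f0 & f = c%:P * f0].
Proof.
move=> fR f0; have [u [s [u1 ps e]]] : exists (u : R) (s : seq R),
    [/\ divides u 1, forall p, p \in s -> prime_elt p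
      & lead_coef f = u * \prod_(p <- s) p] by apply: fR; rewrite lead_coef_eq0.
have [n ltn] := ubnP (size s).
elim: n u s f f0 u1 ps e ltn => // n IHn u s f f0 u1 ps e ltn.
have [pf|] := EM (primitive_poly f); first by exists 1, f; rewrite oner_neq0 mul1r.
move=> /existsNP [p /not_implyP [pp /contrapT [f1 ef]]].
have [p0 pu _] := pp.
have f10 : f1 != 0 by apply: contraNneq f0 => f10; rewrite ef f10 mul0r.
have lf : lead_coef f = lead_coef f1 * p by rewrite ef lead_coefM lead_coefC.
have [q qs [v qv]] : exists2 q, q \in s & divides p q.
  apply: prime_elt_prod => //; case: u1 => v uv.
  by exists (v * lead_coef f1); rewrite -mulrA -lf e mulrA -uv mul1r.
have [q0 qu qq] := ps _ qs.
(* Since [q = v * p] is prime and [p] is not a unit, [v] is a unit and [q] can be struck off the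
   list. *)
have v1 : divides v 1.
  case: (qq v p); first by rewrite -qv; exists 1; rewrite mul1r.
    move=> [x ex]; case: pu; exists x; apply: (mulfI (x := v)).
      by apply: contraNneq q0 => v0; rewrite qv v0 mul0r.
    by rewrite mulr1 {1}ex qv mulrCA.
  by move=> [x ex]; exists x; apply: (mulfI p0); rewrite mulr1 {1}ex qv mulrA mulrC.
have e1 : lead_coef f1 = (u * v) * \prod_(r <- rem q s) r.
  apply: (mulIf p0); rewrite -lf e (perm_big _ (perm_to_rem qs)) big_cons /= {1}qv.
  by rewrite -!mulrA; congr (_ * (_ * _)); rewrite mulrC.
have [] := IHn _ _ _ f10 _ _ e1.
- case: u1 => x ex; case: v1 => y ey; exists (y * x).
  by rewrite -mulrA [x * _]mulrA -ex mul1r.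
- by move=> r /mem_rem; exact: ps.
- rewrite size_rem // -ltnS prednK //; first by case: (s) qs.
move=> c [g [c0 pg eg]]; exists (c * p), g; split=> //; first by rewrite mulf_neq0.
by rewrite ef eg polyCM mulrAC.
Qed.

(** The relation [%|] is divisibility up to a nonzero constant, that is, over the fraction field,
    and [primitive_cancel] turns it into divisibility. By minimality, [gcdp f a] is a constant or
    agrees with [f] up to constants. *)
Lemma minimal_prime_elt f : factorial_ring R -> primitive_poly f ->
  (1 < size f)%N ->
  (forall g, (1 < size g)%N -> g %| f -> (size f <= size g)%N) -> prime_elt f.
Proof.
move=> fR pf f1 fmin; have f0 : f != 0 by rewrite -size_poly_gt0 ltnW.
split=> //.
  case=> g e; have g0 : g != 0.
    by apply/eqP => g0; move/eqP: e; rewrite g0 mul0r oner_eq0.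
  have := size_mul g0 f0; rewrite -e size_poly1; move: f1.
  by rewrite -size_poly_gt0 in g0; case: (size g) g0 => // a _; case: (size f) => [|[|b]] //; rewrite !addnS.
have cancel a : f %| a -> divides f a.
  move/Pdiv.Idomain.dvdpP => [[c q] /= c0 e].
  by apply: (primitive_cancel fR pf (c := c) (h := q)); rewrite // mul_polyC.
move=> a b [q e]; have [cop|] := boolP (coprimep f a).
  right; apply: cancel; rewrite -(Pdiv.Idomain.Gauss_dvdpr _ cop) e.
  exact: dvdp_mull.
move=> ncop; left; apply: cancel.
have g1 : (1 < size (gcdp f a))%N.
  rewrite ltn_neqAle eq_sym ncop size_poly_gt0 gcdp_eq0 negb_and f0 //.
have gf := dvdp_gcdl f a.
have : gcdp f a %= f by rewrite -dvdp_size_eqp // eqn_leq dvdp_leq //= fmin.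
by rewrite /eqp => /andP [_ /dvdp_trans]; apply; exact: dvdp_gcdr.
Qed.

Lemma factorial_poly : factorial_ring R -> factorial_ring {poly R}.
Proof.
move=> fR f; have [n] := ubnP (size f); elim: n f => // n IHn f ltn f0.
have fac_const c : c != 0 -> exists (u : {poly R}) (s : seq {poly R}),
    [/\ divides u 1, forall p : {poly R}, p \in s -> prime_elt p
      & c%:P = u * \prod_(p <- s) p].
  move=> /fR [u [s [[v uv] ps ->]]]; exists u%:P, [seq p%:P | p <- s]; split.
  - by exists v%:P; rewrite -polyCM -uv.
  - by move=> p /mapP [q qs ->]; exact/prime_elt_polyC/ps.
  - by rewrite polyCM big_map rmorph_prod.
have [f1|f1] := leqP (size f) 1.
  have ef := size1_polyC f1; rewrite ef; apply: fac_const.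
  by apply: contraNneq f0 => c0; rewrite ef c0.
have [c [f' [c0 pf' ef]]] := primitive_part fR f0.
have sf : size f = size f' by rewrite ef mul_polyC size_scale.
(* A nonconstant divisor of least size over the fraction field; its primitive part is prime by
   [minimal_prime_elt]. *)
have [g [g1 gf gmin]] : exists g, [/\ (1 < size g)%N, g %| f'
    & forall h, (1 < size h)%N -> h %| f' -> (size g <= size h)%N].
  have Pex : exists m, `[< exists g, [/\ (1 < size g)%N, g %| f' & size g = m] >].
    by exists (size f'); apply/asboolP; exists f'; rewrite -sf f1 dvdpp.
  have [m /asboolP [g [g1 gf gm]] mmin] := ex_minnP Pex.
  exists g; split=> // h h1 hf; rewrite gm; apply: mmin.
  by apply/asboolP; exists h.
have g0 : g != 0 by rewrite -size_poly_gt0 ltnW.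
have [b [g' [b0 pg' eg]]] := primitive_part fR g0.
have sg : size g = size g' by rewrite eg mul_polyC size_scale.
have g'f : g' %| f' by rewrite (dvdp_trans _ gf) // eg dvdp_mull.
have prg : prime_elt g'.
  apply: minimal_prime_elt => //; first by rewrite -sg.
  by move=> h h1 hg; rewrite -sg; apply: gmin => //; exact: dvdp_trans g'f.
have [q eq] : divides g' f'.
  have /Pdiv.Idomain.dvdpP [[a q] /= a0 e] := g'f.
  by apply: (primitive_cancel fR pg' (c := a) (h := q)); rewrite // mul_polyC.
have q0 : q != 0 by apply: contraNneq f0 => q0; rewrite ef eq q0 mul0r mulr0.
have g'0 : g' != 0 by case: prg.
have [u [s [u1 ps es]]] : exists (u : {poly R}) (s : seq {poly R}),
    [/\ divides u 1, forall p : {poly R}, p \in s -> prime_elt p & q = u * \prod_(p <- s) p].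
  apply: IHn => //; rewrite ltnS in ltn; rewrite (leq_trans _ ltn) // sf eq size_mul //.
  by rewrite -sg; case: (size g) g1 => [|[|k]] // _; rewrite !addnS /= ltnS leq_addr.
have [v [t [v1 pt et]]] := fac_const _ c0.
exists (v * u), (g' :: s ++ t); split.
- case: u1 => x ex; case: v1 => y ey; exists (x * y).
  by rewrite -mulrA [y * _]mulrA -ey mul1r.
- move=> p; rewrite inE mem_cat => /orP [/eqP ->|/orP[/ps|/pt]] //.
- rewrite ef eq et es big_cons big_cat /=.
  by ring.
Qed.

End PolyFactorial.

Section DividesIso.
Variables (A B : idomainType) (f : {rmorphism A -> B}) (g : B -> A).
Hypotheses (fK : cancel f g) (gK : cancel g f).

Lemma divides_iso a b : divides (f a) (f b) <-> divides a b.
Proof.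
split=> [[c e]|[c ->]]; last by exists (f c); rewrite rmorphM.
by exists (g c); apply: (can_inj fK); rewrite rmorphM gK.
Qed.

Lemma prime_elt_iso a : prime_elt (f a) <-> prime_elt a.
Proof.
have f0 x : (f x != 0) = (x != 0) by rewrite -(rmorph0 f) (inj_eq (can_inj fK)).
split=> -[a0 au ap]; split.
- by rewrite -f0.
- by rewrite -divides_iso rmorph1.
- by move=> x y /divides_iso; rewrite rmorphM => /ap [] /divides_iso; [left|right].
- by rewrite f0.
- by rewrite -(rmorph1 f) divides_iso.
- move=> x y; rewrite -[x]gK -[y]gK -rmorphM !divides_iso; exact: ap.
Qed.

Lemma factorial_iso : factorial_ring B -> factorial_ring A.
Proof.
move=> fB a a0; have [|u [s [u1 ps e]]] := fB (f a).
  by rewrite -(rmorph0 f) (inj_eq (can_inj fK)).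
exists (g u), (map g s); split.
- by apply/divides_iso; rewrite gK rmorph1.
- by move=> p /mapP [q qs ->]; apply/prime_elt_iso; rewrite gK; exact: ps.
- apply: (can_inj fK); rewrite e rmorphM gK big_map rmorph_prod.
  by congr (_ * _); apply: eq_bigr => q _; rewrite gK.
Qed.

End DividesIso.

Section MpolyFactorial.
Variables (n : nat) (R : idomainType).

Lemma muni_mwiden (p : {mpoly R[n]}) : muni (mwiden p) = p%:P.
Proof.
elim/mpolyind: p => [|c m p _ _ IHp]; first by rewrite mwiden0 muni0.
rewrite mwidenD muniD IHp polyCD; congr (_ + _).
rewrite mwidenZ muniZ -mul_polyC -mul_mpolyC polyCM; congr (_ * _).
rewrite mwidenX muniE msuppX big_seq1 mcoeffX eqxx scale1r.
rewrite mnmwiden_ordmax expr0 -alg_polyC; congr (_ *: _).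
by congr 'X_[_]; apply/mnmP => i; rewrite mnmE mnmwiden_widen.
Qed.

Lemma muni_ord_max : muni ('X_ord_max : {mpoly R[n.+1]}) = 'X.
Proof.
rewrite muniE msuppX big_seq1 mcoeffX eqxx scale1r mnm1E eqxx expr1.
rewrite -[RHS]scale1r; congr (_ *: _); rewrite -mpolyX0; congr 'X_[_].
by apply/mnmP => i; rewrite mnmE mnm1E mnm0E -val_eqE /= gtn_eqF.
Qed.

(** The inverse of [muni]; together they carry factoriality and elimination from univariate
    polynomials to [{mpoly R[n.+1]}]. *)
Definition mmulti_horner : {poly {mpoly R[n]}} -> {mpoly R[n.+1]} :=
  horner_eval ('X_ord_max : {mpoly R[n.+1]}) \o map_poly (@mwiden n R).

HB.instance Definition _ := GRing.RMorphism.copy mmulti_horner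
  (horner_eval ('X_ord_max : {mpoly R[n.+1]}) \o map_poly (@mwiden n R)).

Lemma mmulti_hornerC c : mmulti_horner c%:P = mwiden c.
Proof. by rewrite /mmulti_horner /= map_polyC /horner_eval hornerC. Qed.

Lemma mmulti_hornerX : mmulti_horner 'X = 'X_ord_max.
Proof. by rewrite /mmulti_horner /= map_polyX /horner_eval hornerX. Qed.

Lemma mmulti_hornerD : {morph mmulti_horner : p q / p + q}.
Proof. exact: rmorphD. Qed.

Lemma mmulti_hornerM : {morph mmulti_horner : p q / p * q}.
Proof. exact: rmorphM. Qed.

Lemma mmulti_horner_exp i : {morph mmulti_horner : p / p ^+ i}.
Proof. by move=> p; apply: rmorphXn. Qed.

Lemma mmulti_hornerK : cancel mmulti_horner (@muni n R).
Proof.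
elim/poly_ind => [|p c IHp]; first by rewrite rmorph0 muni0.
by rewrite mmulti_hornerD mmulti_hornerM muniD muniM IHp mmulti_hornerC mmulti_hornerX
  muni_mwiden muni_ord_max.
Qed.

Lemma muniK : cancel (@muni n R) mmulti_horner.
Proof.
elim/mpolyind => [|c m p _ _ IHp]; first by rewrite muni0 rmorph0.
rewrite muniD.
rewrite mmulti_hornerD.
rewrite [X in _ + X]IHp.
apply: (congr1 (+%R^~ p)) => {p IHp}.
rewrite muniZ -mul_polyC mmulti_hornerM mmulti_hornerC mwidenC -mul_mpolyC.
congr (_ * _); rewrite mpolyXE_id (big_morph _ (@muniM n R) (@muni1 n R)).
rewrite (big_morph _ mmulti_hornerM (rmorph1 _)); apply: eq_bigr => i _.
have -> k (a : {mpoly R[n.+1]}) : muni (a ^+ k) = muni a ^+ k by apply: rmorphXn.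
rewrite mmulti_horner_exp; congr (_ ^+ _).
have [j ->|->] := unliftP ord_max i; last by rewrite muni_ord_max mmulti_hornerX.
have -> : 'X_(lift ord_max j) = mwiden 'X_j :> {mpoly R[n.+1]}.
  rewrite mwidenX mnmwiden1; congr 'X_[U_(_)].
  by apply: val_inj => /=; rewrite /bump leqNgt ltn_ord.
by rewrite muni_mwiden mmulti_hornerC.
Qed.

End MpolyFactorial.

Lemma factorial_field (F : fieldType) : factorial_ring F.
Proof.
move=> a a0; exists a, [::]; split=> //; last by rewrite big_nil mulr1.
by exists a^-1; rewrite mulVf.
Qed.

Lemma factorial_mpoly (R : idomainType) n :
  factorial_ring R -> factorial_ring {mpoly R[n]}.
Proof.
move=> fR; elim: n => [|n IHn].
  have K : cancel (@mcoeff 0 R 0%MM) (@mpolyC 0 R) by exact: mpolyKC.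
  apply: (@factorial_iso _ _ (@mcoeff 0 R 0%MM) _ K) => // c.
  by rewrite /= mcoeffC eqxx mulr1.
apply: (@factorial_iso _ _ (@muni n R) _ (@muniK n R) (@mmulti_hornerK n R)).
exact: factorial_poly.
Qed.

(** Let [g] be a nonconstant gcd over the fraction field. The prime [q] divides [g] or its cofactor
    in [q]; in the second case [g] would be constant, and in the first [q] would divide [c]. *)
Lemma prime_resultant_neq0 (R : idomainType) (q c : {poly R}) :
  prime_elt q -> ~ divides q c -> (1 < size q)%N -> resultant q c != 0.
Proof.
move=> [q0 qu pq] qc q1.
rewrite resultant_eq0 -leqNgt; set g := gcdp q c.
have cancel x y (z : R) : z != 0 -> z *: x = y * q -> divides q x.
  move=> z0; rewrite -mul_polyC => exy.
  have [|[w ew]|//] := pq z%:P x; first by rewrite exy; exact: divides_mull.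
  have w0 : w != 0 by apply: contraNneq z0 => w0; rewrite -polyC_eq0 ew w0 mul0r.
  have := size_mul w0 q0; rewrite -ew size_polyC z0.
  by move: w0; rewrite -size_poly_gt0; case: (size w) => // m _; case: (size q) q1 => [|[|k]] //; rewrite !addnS.
have /Pdiv.Idomain.dvdpP [[z1 y1] /= z10 e1] := dvdp_gcdl q c.
have /Pdiv.Idomain.dvdpP [[z2 y2] /= z20 e2] := dvdp_gcdr q c.
rewrite -/g in e1 e2.
have [|[x ex]|[x ex]] := pq y1 g.
- by rewrite -e1 -mul_polyC; exact: divides_mull.
- have : (z1%:P : {poly R}) = x * g.
    by apply: (mulIf q0); rewrite mul_polyC e1 ex mulrAC.
  move=> exg.
  have x0 : x != 0 by apply: contraNneq z10 => x0; rewrite -polyC_eq0 exg x0 mul0r.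
  have g0 : g != 0 by apply: contraNneq z10 => g0; rewrite -polyC_eq0 exg g0 mulr0.
  have := size_mul x0 g0; rewrite -exg size_polyC z10.
  by rewrite -size_poly_gt0 in x0; case: (size x) x0 => // m _; case: (size g) => [|[|k]] //; rewrite !addnS.
- case: qc; apply: (cancel _ (y2 * x) z2) => //; by rewrite e2 ex mulrA.
Qed.

Lemma prime_poly_elim (R : idomainType) (q c : {poly R}) :
  prime_elt q -> ~ divides q c ->
  exists a b r, r != 0 /\ r%:P = a * q + b * c.
Proof.
move=> pq qc; have [q0 _ _] := pq.
have c0 : c != 0 by apply/eqP => c0; apply: qc; rewrite c0; exact: divides0.
have [q1|q1] := leqP (size q) 1.
  exists 1, 0, q`_0; rewrite -size1_polyC // mul0r addr0 mul1r; split=> //.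
  by rewrite -polyC_eq0 -size1_polyC.
have [c1|c1] := leqP (size c) 1.
  exists 0, 1, c`_0; rewrite -size1_polyC // mul0r add0r mul1r; split=> //.
  by rewrite -polyC_eq0 -size1_polyC.
have [[a b] _ e] := resultant_in_ideal q1 c1.
exists a, b, (resultant q c); split=> //; exact: prime_resultant_neq0.
Qed.

Lemma prime_mpoly_elim (R : idomainType) n (q c : {mpoly R[n.+1]}) :
  prime_elt q -> ~ divides q c ->
  exists a b r, r != 0 /\ mwiden r = a * q + b * c.
Proof.
move=> pq qc.
have iso := divides_iso (@muniK n R) (@mmulti_hornerK n R).
have [||a [b [r [r0 e]]]] := @prime_poly_elim _ (muni q) (muni c).
- exact/(prime_elt_iso (@muniK n R) (@mmulti_hornerK n R)).
- by move/iso.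
exists (mmulti_horner a), (mmulti_horner b), r; split=> //.
apply: (can_inj (@muniK n R)).
by rewrite muniD !muniM !mmulti_hornerK muni_mwiden.
Qed.

(** * Bihomogeneous forms *)

Lemma mpoly_alg_ind n (R : nzRingType) (P : {mpoly R[n]} -> Prop) :
  (forall c, P c%:MP) -> (forall i, P 'X_i) ->
  (forall p q, P p -> P q -> P (p + q)) ->
  (forall p q, P p -> P q -> P (p * q)) -> forall p, P p.
Proof.
move=> PC PX PD PM; elim/mpolyind => [|c m p _ _ Pp]; first by rewrite -(mpolyC0 n).
apply: (PD) => //; rewrite -mul_mpolyC; apply: (PM) => //.
rewrite mpolyXE_id; elim/big_rec: _ => [|i q _ Pq]; first by rewrite -mpolyC1.
apply: (PM) => //; elim: (m i) => [|k IHk]; first by rewrite expr0 -mpolyC1.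
by rewrite exprS; apply: (PM).
Qed.

Lemma rmorph_mmap n (R : nzRingType) (S T : comNzRingType) (f : {rmorphism R -> S})
    (f' : {rmorphism R -> T}) (h : 'I_n -> S) (h' : 'I_n -> T)
    (g : {rmorphism S -> T}) (p : {mpoly R[n]}) :
  (forall c, g (f c) = f' c) -> (forall i, g (h i) = h' i) ->
  g (mmap f h p) = mmap f' h' p.
Proof.
move=> gf gh; elim/mpoly_alg_ind: p => [c|i|p q IHp IHq|p q IHp IHq].
- by rewrite !mmapC gf.
- by rewrite !mmapX !mmap1U gh.
- by rewrite !mmapD rmorphD IHp IHq.
- by rewrite !rmorphM /= IHp IHq.
Qed.

(** The integers give more roots of [p * q] than its degree allows. *)
Lemma poly_eq0_dense (R : numDomainType) (p q : {poly R}) :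
  q != 0 -> (forall c, q.[c] != 0 -> p.[c] = 0) -> p = 0.
Proof.
move=> q0 pq; apply/eqP; have: p * q == 0.
  apply/eqP; apply: (@roots_geq_poly_eq0 _ _ [seq i%:R | i <- iota 0 (size (p * q))]).
  - apply/allP => c _; rewrite /root hornerM.
    by have [->|/pq ->] := eqVneq q.[c] 0; rewrite ?mulr0 ?mul0r.
  - by rewrite map_inj_uniq ?iota_uniq // => i j /eqP; rewrite eqr_nat => /eqP.
  - by rewrite size_map size_iota.
by rewrite mulf_eq0 (negPf q0) orbF.
Qed.

Lemma poly_eq_horner (R : numDomainType) (p q : {poly R}) :
  (forall c, p.[c] = q.[c]) -> p = q.
Proof.
move=> e; apply/eqP; rewrite -subr_eq0; apply/eqP.
by apply: (@poly_eq0_dense _ _ 1); rewrite ?oner_neq0 // => c _; rewrite !hornerE e subrr.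
Qed.

Lemma poly_nonroot (R : numDomainType) (q : {poly R}) :
  q != 0 -> exists c, q.[c] != 0.
Proof.
move=> q0; apply: contrapT => /forallNP e; move/eqP: q0; apply.
by apply: poly_eq_horner => c; rewrite horner0; apply/eqP; have /negP := e c; rewrite negbK.
Qed.

Lemma meval_muni n (R : idomainType) (p : {mpoly R[n.+1]}) (x : 'I_n.+1 -> R) :
  p.@[x] = (map_poly (meval (fun i : 'I_n => x (lift ord_max i))) (muni p)).[x ord_max].
Proof.
elim/mpoly_alg_ind: p => [c|i|p q IHp IHq|p q IHp IHq].
- by rewrite mevalC muniC map_polyC hornerC /= mevalC.
- have [j ->|->] := unliftP ord_max i; last by rewrite muni_ord_max map_polyX hornerX mevalXU.
  have -> : 'X_(lift ord_max j) = mwiden 'X_j :> {mpoly R[n.+1]}.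
    rewrite mwidenX mnmwiden1; congr 'X_[U_(_)].
    by apply: val_inj => /=; rewrite /bump leqNgt ltn_ord.
  rewrite muni_mwiden map_polyC hornerC /= mevalXU.
  rewrite mwidenX mnmwiden1 mevalXU; congr x.
  by apply: val_inj => /=; rewrite /bump leqNgt ltn_ord.
- by rewrite mevalD IHp IHq muniD rmorphD hornerD.
- by rewrite mevalM IHp IHq muniM rmorphM hornerM.
Qed.

Lemma mpoly_eq0_meval n (R : numDomainType) (p : {mpoly R[n]}) :
  (forall x, p.@[x] = 0) -> p = 0.
Proof.
elim: n p => [|n IHn] p p0.
  rewrite -[p]mpolyKC; have := p0 (fun _ => 0).
  by rewrite -[p in p.@[_]](mpolyKC) mevalC => ->.
apply: (can_inj (@muniK _ _)); rewrite muni0; apply/polyP => i; rewrite coef0.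
apply: IHn => x; rewrite -coef_map; set q := map_poly _ _.
suff -> : q = 0 by rewrite coef0.
apply: poly_eq_horner => c; rewrite horner0.
pose y i := if unlift ord_max i is Some j then x j else c.
have := p0 y; rewrite meval_muni {2}/y unlift_none => <-.
by congr (_.[c]); apply/polyP => k; rewrite !coef_map /=; apply: meval_eq => j; rewrite /y liftK.
Qed.

Lemma mpoly_nonroot n (R : numDomainType) (p : {mpoly R[n]}) :
  p != 0 -> exists x, p.@[x] != 0.
Proof.
move=> p0; apply: contrapT => /forallNP e; move/eqP: p0; apply.
by apply: mpoly_eq0_meval => x; apply/eqP; have /negP := e x; rewrite negbK.
Qed.

Lemma dhomog_meval n (R : comNzRingType) e (p : {mpoly R[n]}) (x : 'I_n -> R) t :
  p \is e.-homog -> p.@[fun i => t * x i] = t ^+ e * p.@[x].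
Proof.
move=> /dhomogP hp; rewrite !mevalE mulr_sumr; apply: eq_big_seq => m mp.
rewrite mulrCA; congr (_ * _).
have -> : e = (\sum_i m i)%N by rewrite -mdegE; exact/esym/hp.
rewrite -prodrXr -big_split /=.
by apply: eq_bigr => i _; rewrite exprMn.
Qed.

Lemma mul_eq0l (R : idomainType) (a b : R) : b != 0 -> a * b = 0 -> a = 0.
Proof. by move=> b0 /eqP; rewrite mulf_eq0 (negPf b0) orbF => /eqP. Qed.

Section Grading.
Variables (n : nat) (R : comNzRingType).
Implicit Types p : {mpoly R[n]}.

(* The coefficient of ['X^j] in [grading p] is the homogeneous component of
   degree [j] of [p]. *)
Definition grading : {mpoly R[n]} -> {poly {mpoly R[n]}} :=
  mmap (polyC \o @mpolyC n R) (fun i => ('X_i)%:P * 'X).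

HB.instance Definition _ := GRing.RMorphism.copy grading
  (mmap (polyC \o @mpolyC n R) (fun i => ('X_i)%:P * 'X)).

Lemma gradingD : {morph grading : p q / p + q}.
Proof. exact: rmorphD. Qed.

Lemma gradingM : {morph grading : p q / p * q}.
Proof. exact: rmorphM. Qed.

Lemma gradingE p : grading p = \sum_(m <- msupp p) (p@_m *: 'X_[m])%:P * 'X^(mdeg m).
Proof.
rewrite /grading /mmap; apply: eq_bigr => m _ /=.
rewrite -mul_mpolyC polyCM -mulrA; congr (_ * _).
rewrite /mmap1 (eq_bigr (fun i => ('X_i ^+ m i)%:P * 'X^(m i))); last first.
  by move=> i _; rewrite exprMn rmorphXn.
by rewrite big_split /= prodrXr -mdegE -rmorph_prod /= -mpolyXE_id.
Qed.

Lemma coef_grading p j : (grading p)`_j = pihomog mdeg j p.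
Proof.
rewrite gradingE coef_sum pihomogE big_mkcond [RHS]big_mkcond.
apply: eq_bigr => m _; rewrite coefCM coefXn eq_sym.
by case: eqP => _; rewrite ?mulr1 ?mulr0.
Qed.

Lemma dhomog_grading e p : p \is e.-homog <-> grading p = p%:P * 'X^e.
Proof.
split=> [hp|/(congr1 (fun q : {poly _} => q`_e))]; last first.
  rewrite coef_grading coefCM coefXn eqxx mulr1 => <-; exact: pihomogP.
apply/polyP => j; rewrite coef_grading coefCM coefXn.
case: eqP => [->|/eqP je]; first by rewrite mulr1 pihomog_dE.
by rewrite mulr0 (pihomog_ne0 _ hp) // eq_sym.
Qed.

End Grading.

Lemma monomial_factor (R : idomainType) (a : R) (e : nat) (p q : {poly R}) :
  a != 0 -> p * q = a%:P * 'X^e -> exists b i, p = b%:P * 'X^i.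
Proof.
move=> a0; elim: e p q => [|e IHe] p q pq.
  exists p`_0, 0%N; rewrite expr0 mulr1; apply: size1_polyC.
  rewrite expr0 mulr1 in pq.
  have : p * q != 0 by rewrite pq polyC_eq0.
  rewrite mulf_eq0 negb_or => /andP[p0 q0].
  have := size_mul p0 q0; rewrite pq size_polyC a0.
  rewrite -!size_poly_gt0 in p0 q0; case: (size q) q0 => // k _.
  by case: (size p) p0 => [|[|l]] //; rewrite addnS.
have X0 : 'X != 0 :> {poly R} by rewrite polyX_eq0.
have := congr1 (fun r : {poly R} => r.[0]) pq.
rewrite !hornerE expr0n mulr0 => /eqP; rewrite mulf_eq0.
case/orP => /factor_theorem [r]; rewrite subr0 => er.
  have [|b [i ei]] := IHe r q.
    by apply: (mulIf X0); rewrite mulrAC -er pq exprSr mulrA.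
  by exists b, i.+1; rewrite er ei exprSr mulrA.
by apply: (IHe p r); apply: (mulIf X0); rewrite -mulrA -er pq exprSr mulrA.
Qed.

(** Here [g] records a grading by powers of ['X], so a factor of a homogeneous element has a
    monomial as image, and the value at 1 identifies its coefficient. The abstract form serves both
    [grading] and [inner_grading]. *)
Lemma graded_factor (A : idomainType) (g : {rmorphism A -> {poly A}}) (a b : A) e :
  (forall x, (g x).[1] = x) -> a * b != 0 -> g (a * b) = (a * b)%:P * 'X^e ->
  exists i, g a = a%:P * 'X^i.
Proof.
move=> g1 ab0; rewrite rmorphM => /(monomial_factor ab0) [c [i ec]].
by exists i; rewrite -[in RHS](g1 a) ec !hornerE expr1n mulr1.
Qed.

Lemma meval_map_mpoly m n (R : comNzRingType) (w : {mpoly {mpoly R[n]}[m]}) x y :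
  (map_mpoly (meval x) w).@[y] = mmap (meval x) y w.
Proof.
elim/mpoly_alg_ind: w => [c|i|p q IHp IHq|p q IHp IHq].
- by rewrite map_mpolyC mevalC mmapC.
- by rewrite map_mpolyX mevalXU mmapX mmap1U.
- by rewrite raddfD mevalD mmapD; exact: congr2 IHp IHq.
- by rewrite !rmorphM; exact: congr2 IHp IHq.
Qed.

(* [biring C] is [bipoly C]; the two named layers keep the unifier from
   comparing nested instances of the polynomial ring structures. *)
Definition xring (C : numClosedFieldType) : idomainType := {mpoly C[3]}.
Definition biring (C : numClosedFieldType) : idomainType := {mpoly (xring C)[3]}.

Section Bieval.
Variable C : numClosedFieldType.
Implicit Types w : biring C.

Definition bC (c : C) : biring C := (c%:MP : xring C)%:MP.
Definition bX (i : 'I_3) : biring C := ('X_i : xring C)%:MP.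
Definition bY (i : 'I_3) : biring C := 'X_i.

HB.instance Definition _ := GRing.RMorphism.copy bC
  (@mpolyC 3 (xring C) \o @mpolyC 3 C).

Section Def.
Variables (T : comNzRingType) (h : {rmorphism C -> T}) (X Y : 'I_3 -> T).

Definition xeval : xring C -> T := mmap h X.

HB.instance Definition _ := GRing.RMorphism.copy xeval (mmap h X).

Definition bieval : biring C -> T := mmap xeval Y.

HB.instance Definition _ := GRing.RMorphism.copy bieval (mmap xeval Y).

Lemma bievalC c : bieval (bC c) = h c.
Proof. by rewrite /bieval mmapC /= /xeval mmapC. Qed.

Lemma bievalX i : bieval (bX i) = X i.
Proof. by rewrite /bieval mmapC /= /xeval mmapX mmap1U. Qed.

Lemma bievalY i : bieval (bY i) = Y i.
Proof. by rewrite /bieval mmapX mmap1U. Qed.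

Lemma bievalM w1 w2 : bieval (w1 * w2) = bieval w1 * bieval w2.
Proof. exact: rmorphM. Qed.

Lemma bievalD w1 w2 : bieval (w1 + w2) = bieval w1 + bieval w2.
Proof. exact: rmorphD. Qed.

Lemma bievalB w1 w2 : bieval (w1 - w2) = bieval w1 - bieval w2.
Proof. exact: rmorphB. Qed.

Lemma bieval0 : bieval 0 = 0.
Proof. exact: rmorph0. Qed.

Lemma bieval1 : bieval 1 = 1.
Proof. exact: rmorph1. Qed.

Lemma bieval_exp w n : bieval (w ^+ n) = bieval w ^+ n.
Proof. exact: rmorphXn. Qed.

End Def.

Lemma bipoly_ind (P : biring C -> Prop) :
  (forall c, P (bC c)) -> (forall i, P (bX i)) -> (forall i, P (bY i)) ->
  (forall p q, P p -> P q -> P (p + q)) ->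
  (forall p q, P p -> P q -> P (p * q)) -> forall p, P p.
Proof.
move=> PC PX PY PD PM; apply: (@mpoly_alg_ind 3 (xring C)) => //.
apply: (@mpoly_alg_ind 3 C) => // p q Pp Pq.
  by rewrite mpolyCD; exact: PD.
by rewrite mpolyCM; exact: PM.
Qed.

Lemma rmorph_bieval (S T : comNzRingType) (g : {rmorphism S -> T})
    (h : {rmorphism C -> S}) (h' : {rmorphism C -> T}) X Y X' Y' w :
  (forall c, g (h c) = h' c) -> (forall i, g (X i) = X' i) ->
  (forall i, g (Y i) = Y' i) ->
  g (bieval h X Y w) = bieval h' X' Y' w.
Proof.
move=> gh gX gY; elim/bipoly_ind: w => [c|i|i|p q IHp IHq|p q IHp IHq].
- by rewrite !bievalC.
- by rewrite !bievalX.
- by rewrite !bievalY.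
- by rewrite !bievalD rmorphD IHp IHq.
- by rewrite !bievalM rmorphM IHp IHq.
Qed.

Definition ev w (x y : 'I_3 -> C) : C := bieval idfun x y w.

Lemma evE w x y : ev w x y = (at_point w x).@[y].
Proof.
exact/esym/(@meval_map_mpoly 3 3 C w).
Qed.

Lemma evM w1 w2 x y : ev (w1 * w2) x y = ev w1 x y * ev w2 x y.
Proof. exact: bievalM. Qed.
Lemma evD w1 w2 x y : ev (w1 + w2) x y = ev w1 x y + ev w2 x y.
Proof. exact: bievalD. Qed.
Lemma evB w1 w2 x y : ev (w1 - w2) x y = ev w1 x y - ev w2 x y.
Proof. exact: bievalB. Qed.
Lemma evX w n x y : ev (w ^+ n) x y = ev w x y ^+ n.
Proof. exact: bieval_exp. Qed.
Lemma evC c x y : ev (bC c) x y = c.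
Proof. exact: bievalC. Qed.

Lemma ev_ext w x y x' y' : x =1 x' -> y =1 y' -> ev w x y = ev w x' y'.
Proof. by move=> /funext -> /funext ->. Qed.

Lemma bipoly_eq0 w : (forall x y, ev w x y = 0) -> w = 0.
Proof.
move=> w0; apply/mpolyP => m; rewrite mcoeff0; apply: mpoly_eq0_meval => x.
have : at_point w x = 0 by apply: mpoly_eq0_meval => y; rewrite -evE.
by move/(congr1 (fun p => p@_m)); rewrite /at_point mcoeff_map_mpoly mcoeff0.
Qed.

Lemma bipoly_eq0_dense w v :
  v != 0 -> (forall x y, ev v x y != 0 -> ev w x y = 0) -> w = 0.
Proof.
move=> v0 h; apply: (mul_eq0l v0); apply: bipoly_eq0 => x y; rewrite evM.
by have [->|/h ->] := eqVneq (ev v x y) 0; rewrite ?mulr0 ?mul0r.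
Qed.

Lemma bipoly_nonroot w : w != 0 -> exists x y, ev w x y != 0.
Proof.
move=> w0; apply: contrapT => e; move/eqP: w0; apply.
apply: bipoly_eq0 => x y; apply/eqP; apply: contrapT => /negP n.
by apply: e; exists x, y.
Qed.

Lemma bihom_evl e k w x y t : bihomogeneous e k w ->
  ev w (fun i => t * x i) y = t ^+ e * ev w x y.
Proof.
move=> [_ hw]; rewrite !evE.
have -> : at_point w (fun i => t * x i) = t ^+ e *: at_point w x.
  apply/mpolyP => m; rewrite mcoeffZ /at_point !mcoeff_map_mpoly.
  exact: dhomog_meval.
by rewrite mevalZ.
Qed.

Lemma bihom_evr e k w x y t : bihomogeneous e k w ->
  ev w x (fun i => t * y i) = t ^+ k * ev w x y.
Proof.
move=> [hw _]; rewrite !evE; apply: dhomog_meval.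
apply/dhomogP => m; rewrite mcoeff_msupp /at_point mcoeff_map_mpoly => mw.
apply: (dhomog_mf hw); rewrite mcoeff_msupp; apply: contraNneq mw => ->.
by rewrite /= meval0.
Qed.

Lemma biring_sum (s : seq 'I_3) (F : 'I_3 -> bipoly C) :
  \sum_(i <- s) F i = \sum_(i <- s) (F i : biring C) :> biring C.
Proof. by elim: s => [|i s IHs]; rewrite ?big_nil // !big_cons IHs. Qed.

Lemma radial_contractionE w : radial_contraction w =
  \sum_(i < 3) bX i * ((w : {mpoly (xring C)[3]})^`M(i) : biring C) :> biring C.
Proof.
have mulE (p q : bipoly C) : p * q = (p : biring C) * (q : biring C) :> biring C by [].
have := biring_sum (index_enum 'I_3)
  (fun i => ('X_i : {mpoly C[3]})%:MP * (w : bipoly C)^`M(i)).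
move=> e; apply: (etrans e) => {e}; apply: eq_bigr => i _; exact: mulE.
Qed.

(** * Invariance under shears *)

Definition shear_invariant w :=
  forall x y t, ev w x (fun i => y i + t * x i) = ev w x y.

Definition shear_poly w x y : {poly C} :=
  bieval polyC (fun i => (x i)%:P) (fun i => (y i)%:P + (x i)%:P * 'X) w.

Lemma shear_polyE w x y t :
  (shear_poly w x y).[t] = ev w x (fun i => y i + t * x i).
Proof.
rewrite -[LHS]/(horner_eval t (shear_poly w x y)); apply: rmorph_bieval => [c|i|i];
  by rewrite /= /horner_eval !hornerE // mulrC.
Qed.

Lemma deriv_shear_poly w x y :
  (shear_poly w x y)^`() = shear_poly (radial_contraction w) x y.
Proof.
rewrite radial_contractionE /shear_poly.
pose rc (v : biring C) := \sum_(i < 3) bX i * ((v : {mpoly (xring C)[3]})^`M(i) : biring C).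
rewrite -/(rc w).
have rcM p q : rc (p * q) = rc p * q + p * rc q.
  rewrite /rc mulr_suml mulr_sumr -big_split /=.
  by apply: eq_bigr => i _; rewrite mderivM; ring.
have rcD p q : rc (p + q) = rc p + rc q.
  rewrite /rc -big_split /=.
  by apply: eq_bigr => i _; rewrite mderivD mulrDr.
elim/bipoly_ind: w => [c|i|i|p q IHp IHq|p q IHp IHq].
- rewrite bievalC derivC /rc big1 ?bieval0 // => i _.
  by rewrite mderivC mulr0.
- rewrite bievalX derivC /rc big1 ?bieval0 // => j _.
  by rewrite mderivC mulr0.
- rewrite bievalY derivD derivM !derivC derivX add0r mul0r add0r mulr1.
  rewrite /rc (bigD1 i) //= big1 => [|j ji].
    rewrite mderivX mnm1E eqxx scale1r.
    have -> : (U_(i) - U_(i))%MM = 0%MM :> 'X_{1..3}.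
      by apply/mnmP => k; rewrite mnmBE mnm0E subnn.
    by rewrite mpolyX0 mulr1 addr0 bievalX.
  by rewrite mderivX mnm1E eq_sym (negPf ji) scale0r mulr0.
- by rewrite rcD !bievalD derivD IHp IHq.
- by rewrite rcM bievalD !bievalM derivM IHp IHq.
Qed.

(** By [deriv_shear_poly], the contraction is the derivative of [w] along the line [y + t x]; in
    characteristic zero it vanishes exactly when [w] is constant on these lines. *)
Lemma radial_contraction_eq0 w : radial_contraction w = 0 <-> shear_invariant w.
Proof.
split=> [w0 x y t|sw].
  have : (shear_poly w x y)^`() = 0 by rewrite deriv_shear_poly w0 /shear_poly bieval0.
  move=> d0; have -> : ev w x y = (shear_poly w x y).[0].
    by rewrite shear_polyE; apply: ev_ext => // i; rewrite mul0r addr0.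
  rewrite -shear_polyE.
  have /size1_polyC -> : (size (shear_poly w x y) <= 1)%N.
    apply/leq_sizeP => -[//|j] _; apply/eqP.
    have := congr1 (fun p : {poly C} => p`_j) d0.
    by rewrite coef_deriv coef0 => /eqP; rewrite mulrn_eq0.
  by rewrite !hornerC.
apply: bipoly_eq0 => x y.
have -> : ev (radial_contraction w) x y = (shear_poly w x y)^`().[0].
  rewrite deriv_shear_poly shear_polyE.
  by apply: ev_ext => // i; rewrite mul0r addr0.
have -> : shear_poly w x y = (ev w x y)%:P.
  by apply: poly_eq_horner => t; rewrite shear_polyE hornerC sw.
by rewrite derivC horner0.
Qed.

(** Along [y + t x] the product of the two restrictions is a constant; where this constant is
    nonzero each restriction has degree 0, and such points are dense. *)
Lemma shear_factor w1 w2 :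
  w1 * w2 != 0 -> shear_invariant (w1 * w2) -> shear_invariant w1.
Proof.
move=> w0 sw x y t.
pose G := bieval bC bX (fun i => bY i + bC t * bX i) w1.
have evG x' y' : ev G x' y' = ev w1 x' (fun i => y' i + t * x' i).
  apply: (rmorph_bieval (g := bieval idfun x' y')) => [c|i|i] /=.
  - by rewrite bievalC.
  - by rewrite bievalX.
  - by rewrite bievalD bievalM bievalC bievalX bievalY.
apply/eqP; rewrite -subr_eq0 -evG -evB; apply/eqP.
suff -> : G - w1 = 0 by rewrite /ev bieval0.
apply: (bipoly_eq0_dense w0) => {}x {}y; rewrite evM => xy0.
rewrite evB evG; set p := shear_poly w1 x y; set q := shear_poly w2 x y.
have e : p * q = (ev w1 x y * ev w2 x y)%:P.
  apply: poly_eq_horner => s.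
  by rewrite hornerM !shear_polyE hornerC -!evM sw.
have p0 : (size p <= 1)%N.
  move: xy0; rewrite -polyC_eq0 -e => pq0.
  move: (pq0); rewrite mulf_eq0 negb_or => /andP[p0 q0].
  have := size_mul p0 q0; rewrite e size_polyC; case: eqP => [z|_].
    by move: pq0; rewrite e z eqxx.
  rewrite -!size_poly_gt0 in p0 q0; case: (size q) q0 => // k _.
  by case: (size p) p0 => [|[|l]] //; rewrite addnS.
rewrite -!shear_polyE -/p.
have -> : ev w1 x y = p.[0].
  by rewrite /p shear_polyE; apply: ev_ext => // j; rewrite mul0r addr0.
by rewrite (size1_polyC p0) !hornerC subrr.
Qed.

(* Since [t y = (x + t y) - x]. *)
Lemma flip e k w x y t : bihomogeneous e k w -> shear_invariant w ->
  t ^+ k * ev w (fun i => x i + t * y i) y =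
  (-1) ^+ k * ev w (fun i => x i + t * y i) x.
Proof.
move=> hw sw; rewrite -!(bihom_evr _ _ _ hw).
rewrite -[RHS](sw _ _ 1); apply: ev_ext => // i; ring.
Qed.

End Bieval.

Lemma expf_inj (R : numDomainType) (c : R) m n :
  c != 0 -> (forall t : R, t ^+ m * c = t ^+ n * c) -> m = n.
Proof.
move=> c0 /(_ 2%:R) /(mulIf c0) /eqP; rewrite -!natrX eqr_nat.
by move=> /eqP /(expnI (isT : (1 < 2)%N)).
Qed.

Lemma grading1 n (R : comNzRingType) (p : {mpoly R[n]}) : (grading p).[1] = p.
Proof.
elim/mpoly_alg_ind: p => [c|i|p q IHp IHq|p q IHp IHq].
- by rewrite /grading mmapC /= hornerC.
- by rewrite /grading mmapX mmap1U hornerM hornerC hornerX mulr1.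
- by rewrite gradingD hornerD; exact: congr2 IHp IHq.
- by rewrite gradingM hornerM; exact: congr2 IHp IHq.
Qed.

Lemma dhomog_factor n (R : idomainType) e (p q : {mpoly R[n]}) :
  p * q != 0 -> p * q \is e.-homog -> exists i, p \is i.-homog.
Proof.
move=> pq0 /dhomog_grading /(graded_factor (@grading1 n R) pq0) [i ei].
by exists i; apply/dhomog_grading.
Qed.

Section BihomFactor.
Variable C : numClosedFieldType.
Implicit Types w : biring C.

Definition xgrading : xring C -> {poly xring C} := @grading 3 C.

HB.instance Definition _ := GRing.RMorphism.copy xgrading (@grading 3 C).

(** The grading by the degree in the coordinates alone: only the inner variables are multiplied by
    ['X]. *)
Definition inner_grading : biring C -> {poly biring C} :=
  mmap (map_poly (@mpolyC 3 (xring C)) \o xgrading) (fun i => ('X_i)%:P).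

HB.instance Definition _ := GRing.RMorphism.copy inner_grading
  (mmap (map_poly (@mpolyC 3 (xring C)) \o xgrading) (fun i => ('X_i)%:P)).

Lemma inner_gradingD : {morph inner_grading : p q / p + q}.
Proof. exact: rmorphD. Qed.

Lemma inner_gradingM : {morph inner_grading : p q / p * q}.
Proof. exact: rmorphM. Qed.

Lemma inner_gradingCX (c : xring C) m :
  inner_grading (c%:MP * 'X_[m]) =
  map_poly (@mpolyC 3 (xring C)) (xgrading c) * ('X_[m] : biring C)%:P.
Proof.
rewrite inner_gradingM /inner_grading mmapC mmapX /=; congr (_ * _).
rewrite /mmap1 mpolyXE_id rmorph_prod; apply: eq_bigr => i _.
by rewrite rmorphXn.
Qed.

Lemma xgrading1 (c : xring C) : (xgrading c).[1] = c.
Proof. exact: (@grading1 3 C c). Qed.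

Lemma inner_grading1 w : (inner_grading w).[1] = w.
Proof.
elim/mpoly_alg_ind: w => [c|i|p q IHp IHq|p q IHp IHq].
- rewrite /inner_grading mmapC /=.
  have -> : (1 : biring C) = (1 : xring C)%:MP by [].
  by rewrite horner_map xgrading1.
- by rewrite /inner_grading mmapX mmap1U hornerC.
- by rewrite inner_gradingD hornerD; exact: congr2 IHp IHq.
- by rewrite inner_gradingM hornerM; exact: congr2 IHp IHq.
Qed.

Lemma coef_inner_grading w j m :
  ((inner_grading w)`_j : {mpoly (xring C)[3]})@_m = pihomog mdeg j (w@_m : {mpoly C[3]}).
Proof.
elim/mpolyind: w => [|c k p _ _ IHp].
  by rewrite /inner_grading mmap0 coef0 !mcoeff0 pihomog0.
rewrite inner_gradingD coefD !mcoeffD pihomogD; apply: congr2 IHp => {p}.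
rewrite -mul_mpolyC inner_gradingCX coefMC coef_map mcoeffCM mcoeffX.
rewrite mcoeffCM mcoeffX [(xgrading c)`_j](@coef_grading 3 C c).
by case: eqP => _; rewrite ?mulr1 // !mulr0 pihomog0.
Qed.

Lemma inner_gradingP e w :
  (forall m, (w@_m : {mpoly C[3]}) \is e.-homog) <-> inner_grading w = w%:P * 'X^e.
Proof.
split=> [hw|ew m].
  apply/polyP => j; apply/mpolyP => m; rewrite coef_inner_grading.
  rewrite coefCM coefXn; case: eqP => [->|/eqP je].
    by rewrite mulr1 pihomog_dE.
  by rewrite mulr0 mcoeff0 (pihomog_ne0 _ (hw m)) // eq_sym.
have := coef_inner_grading w e m.
by rewrite ew coefCM coefXn eqxx mulr1 => ->; exact: pihomogP.
Qed.

Lemma bihom_factor e k w1 w2 : w1 * w2 != 0 ->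
  bihomogeneous e k (w1 * w2) -> exists e1 k1, bihomogeneous e1 k1 w1.
Proof.
move=> w0 [h0 h]; have [k1 h1] := dhomog_factor w0 h0.
have ew := (inner_gradingP e (w1 * w2)).1 h.
have [e1 he1] := graded_factor (g := inner_grading) inner_grading1 w0 ew.
by exists e1, k1; split=> //; exact/inner_gradingP.
Qed.

Lemma bihom_factors e k w1 w2 : w1 * w2 != 0 ->
  bihomogeneous e k (w1 * w2) -> exists e1 k1 e2 k2,
  [/\ bihomogeneous e1 k1 w1, bihomogeneous e2 k2 w2,
      e = (e1 + e2)%N & k = (k1 + k2)%N].
Proof.
move=> w0 hw; have [e1 [k1 h1]] := bihom_factor w0 hw.
rewrite mulrC in w0; have hw' := hw; rewrite mulrC in hw'.
have [e2 [k2 h2]] := bihom_factor w0 hw'.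
exists e1, k1, e2, k2; split=> //.
all: rewrite mulrC in w0; have [x [y xy0]] := bipoly_nonroot w0.
all: apply: (expf_inj xy0) => t.
- rewrite -(bihom_evl _ _ _ hw) !evM (bihom_evl _ _ _ h1) (bihom_evl _ _ _ h2).
  by rewrite exprD mulrACA.
- rewrite -(bihom_evr _ _ _ hw) !evM (bihom_evr _ _ _ h1) (bihom_evr _ _ _ h2).
  by rewrite exprD mulrACA.
Qed.

End BihomFactor.

Section TopCoef.
Variable T : comNzRingType.
Implicit Types (p q : {poly T}) (c : T).

(** A formal leading coefficient, allowed to vanish; unlike [lead_coef] it is compatible with both
    sums and products. *)
Definition has_top (n : nat) p c := (size p <= n.+1)%N /\ p`_n = c.

Lemma has_topM m n p q c d :
  has_top m p c -> has_top n q d -> has_top (m + n) (p * q) (c * d).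
Proof.
move=> [sp <-] [sq <-]; split.
  by apply: (leq_trans (size_polyMleq _ _)); lia.
rewrite coefM.
have lt : (m < (m + n).+1)%N by rewrite ltnS leq_addr.
rewrite (bigD1 (Ordinal lt)) //= addKn big1 ?addr0 // => i.
rewrite -val_eqE /= neq_ltn => /orP[im|im].
  by rewrite [q`__]nth_default ?mulr0 // (leq_trans sq) //; move: (ltn_ord i); lia.
by rewrite [p`__]nth_default ?mul0r // (leq_trans sp).
Qed.

Lemma has_topD n p q c d :
  has_top n p c -> has_top n q d -> has_top n (p + q) (c + d).
Proof.
move=> [sp <-] [sq <-]; split; last by rewrite coefD.
by rewrite (leq_trans (size_polyD _ _)) // geq_max sp.
Qed.

Lemma has_topC c : has_top 0 c%:P c.
Proof. by split; [exact: size_polyC_leq1 | rewrite coefC]. Qed.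

Lemma has_top0 n : has_top n 0 0.
Proof. by split; rewrite ?size_poly0 ?coef0. Qed.

Lemma has_topX n m p c : has_top m p c -> has_top (m * n) (p ^+ n) (c ^+ n).
Proof.
move=> h; elim: n => [|n IHn]; first by rewrite muln0 !expr0; exact: has_topC.
by rewrite !exprS mulnS; exact: has_topM.
Qed.

Lemma has_top_linear (a b : T) : has_top 1 (a%:P + b%:P * 'X) b.
Proof.
split; last by rewrite coefD coefC coefCM coefX mulr1 add0r.
rewrite (leq_trans (size_polyD _ _)) // geq_max (leq_trans (size_polyC_leq1 _)) //=.
by rewrite (leq_trans (size_polyMleq _ _)) // size_polyX addn2 /= ltnS size_polyC_leq1.
Qed.

(** On the line [a + X b], the top coefficient of a form is its value at the direction [b], the
    point at infinity of the line. *)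
Lemma has_top_mmap (R : nzRingType) n e (h : {rmorphism R -> T}) (a b : 'I_n -> T)
    (p : {mpoly R[n]}) : p \is e.-homog ->
  has_top e (mmap (polyC \o h) (fun i => (a i)%:P + (b i)%:P * 'X) p) (mmap h b p).
Proof.
move=> /dhomogP hp; rewrite /mmap big_seq [X in has_top _ _ X]big_seq.
elim/big_rec2: _ => [|m c q mp hq]; first exact: has_top0.
apply: has_topD => //; rewrite -[e]add0n.
apply: has_topM; first exact: has_topC.
have -> : e = (\sum_i m i)%N by rewrite -mdegE; exact/esym/hp.
rewrite /mmap1; elim/big_rec3: _ => [|i u v s _ huv]; first exact: has_topC.
apply: has_topM => //.
by have := has_topX (m i) (has_top_linear (a i) (b i)); rewrite mul1n.
Qed.

Lemma has_top_bieval (C : numClosedFieldType) e (h : {rmorphism C -> T})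
    (a b c : 'I_3 -> T) (w : biring C) : (forall m, (w@_m : {mpoly C[3]}) \is e.-homog) ->
  has_top e (bieval (polyC \o h) (fun i => (a i)%:P + (b i)%:P * 'X)
              (fun i => (c i)%:P) w) (bieval h b c w).
Proof.
move=> hw; rewrite /bieval.
have mmapE' (S : comNzRingType) (f : xring C -> S) g :
  mmap f g w = \sum_(m <- msupp w) f w@_m * mmap1 g m by [].
rewrite !mmapE'.
elim/big_rec2: _ => [|m d q _ hq]; first exact: has_top0.
apply: has_topD => //; rewrite -[e]addn0; apply: has_topM.
  exact: has_top_mmap.
rewrite /mmap1; elim/big_rec2: _ => [|i u v _ huv]; first exact: has_topC.
rewrite -[0%N]/(0 + 0)%N; apply: has_topM => //.
by rewrite -[0%N]/(0 * m i)%N; apply: has_topX; exact: has_topC.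
Qed.

End TopCoef.

Section Line.
Variable C : numClosedFieldType.
Implicit Types (w : biring C) (x y : 'I_3 -> C).

(** The section of center [y], restricted to the line joining [x] to that center. *)
Definition line_poly w x y : {poly C} :=
  bieval (polyC \o idfun) (fun i => (x i)%:P + (y i)%:P * 'X) (fun i => (y i)%:P) w.

Lemma line_polyE w x y t : (line_poly w x y).[t] = ev w (fun i => x i + t * y i) y.
Proof.
rewrite -[LHS]/(horner_eval t (line_poly w x y)); apply: rmorph_bieval => [c|i|i];
  by rewrite /= /horner_eval !hornerE // mulrC.
Qed.

(** By [flip], the product with ['X^k] is up to sign w(x + t y; x), of degree at most [e] in [t].
    Hence a line through the center meets the polar in at most [e - k] points outside the center;
    for a web this number is its degree. *)
Lemma line_poly_size e k w x y : bihomogeneous e k w -> shear_invariant w ->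
  (size ('X^k * line_poly w x y)%R <= e.+1)%N.
Proof.
move=> hw sw; pose q := bieval (polyC \o idfun)
  (fun i => (x i)%:P + (y i)%:P * 'X) (fun i => (x i)%:P) w.
have qE t : q.[t] = ev w (fun i => x i + t * y i) x.
  rewrite -[LHS]/(horner_eval t q); apply: rmorph_bieval => [c|i|i];
    by rewrite /= /horner_eval !hornerE // mulrC.
have -> : 'X^k * line_poly w x y = ((-1) ^+ k)%:P * q.
  apply: poly_eq_horner => t; rewrite !hornerE line_polyE qE.
  exact: (flip _ _ _ hw).
rewrite (leq_trans (size_polyMleq _ _)) //.
have [sq _] : has_top e q (bieval idfun y x w) by apply: has_top_bieval; case: hw.
apply: leq_trans sq; rewrite -subn1 leq_subLR leq_add2r.
exact: size_polyC_leq1.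
Qed.

Lemma line_poly_size_sub e k w x y : bihomogeneous e k w -> shear_invariant w ->
  (size (line_poly w x y) <= (e - k).+1)%N.
Proof.
move=> hw sw; have := line_poly_size x y hw sw.
have [->|p0] := eqVneq (line_poly w x y) 0; first by rewrite size_poly0.
by rewrite mulrC size_mulXn //; lia.
Qed.

(** Ensures that the truncated difference [e - k] is a true degree when the factors of a web are
    turned into webs. *)
Lemma bihom_ge e k w : w != 0 -> bihomogeneous e k w -> shear_invariant w ->
  (k <= e)%N.
Proof.
move=> w0 hw sw; have [x [y xy0]] := bipoly_nonroot w0.
have e0 : (line_poly w x y).[0] = ev w x y.
  by rewrite line_polyE; apply: ev_ext => // i; rewrite mul0r addr0.
have p0 : line_poly w x y != 0.
  by apply: contraNneq xy0 => p0; rewrite -e0 p0 horner0.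
have := line_poly_size x y hw sw; rewrite mulrC size_mulXn //.
by rewrite -size_poly_gt0 in p0; lia.
Qed.

End Line.

Section Generic.
Variable C : numClosedFieldType.
Implicit Types (x : 'I_3 -> C) (P : ('I_3 -> C) -> Prop).

Lemma generic_homog_nonroot P :
  generic P -> exists (g : {mpoly C[3]}) (e : nat),
    [/\ g != 0, g \is e.-homog & forall x, nonzero x -> g.@[x] != 0 -> P x].
Proof.
move=> [U [[I [Ih IU]] [x [x0 Ux]] UP]].
have [g [Ig gx]] := (IU x x0).1 Ux; have [e he] := Ih g Ig.
exists g, e; split=> // [|y y0 gy]; first by apply: contraNneq gx => ->; rewrite meval0.
by apply: UP => //; apply/(IU y y0).2; exists g.
Qed.

Lemma nonzero_nonroot (r : {mpoly C[3]}) :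
  r != 0 -> exists x, nonzero x /\ r.@[x] != 0.
Proof.
move=> r0; have [|x] := @mpoly_nonroot _ _ (r * 'X_ord0).
  by apply: contraNneq r0 => /mul_eq0l -> //; rewrite -msize_poly_eq0 msizeX.
rewrite mevalM mulf_eq0 negb_or mevalXU => /andP[rx x0].
by exists x; split=> //; exists ord0.
Qed.

(** The polynomial [r] need not be homogeneous: the open set is defined by its homogeneous
    components. Where one of them is nonzero, [r] is nonzero at some multiple of the point, and [P]
    is invariant under scaling. *)
Lemma nonroot_generic P (r : {mpoly C[3]}) : r != 0 ->
  (forall x s, s != 0 -> P (fun i => s * x i) -> P x) ->
  (forall x, nonzero x -> r.@[x] != 0 -> P x) -> generic P.
Proof.
move=> r0 Ps rP; pose I g := exists j, g = pihomog mdeg j r.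
exists (fun x => exists g, I g /\ g.@[x] != 0); split.
- exists I; split=> // g [j ->]; exists j; exact: pihomogP.
- have [x [x0 rx]] := nonzero_nonroot r0; exists x; split=> //.
  apply: contrapT => nx; move/eqP: rx; apply.
  rewrite [r](pihomog_partitionE (leqnn (mmeasure mdeg r))) raddf_sum big1 // => j _ /=.
  apply/eqP; apply: contrapT => /negP jx; apply: nx.
  by exists (pihomog mdeg j r); split=> //; exists j.
- move=> x x0 [g [[j ->] jx]].
  pose q := map_poly (meval x) (grading r).
  (* The factor ['X] forces the scalar [s] found below to be nonzero. *)
  have q0 : q * 'X != 0.
    rewrite mulf_neq0 ?polyX_eq0 //; apply: contraNneq jx => q0.
    have := congr1 (fun p : {poly C} => p`_j) q0.
    by rewrite coef_map coef_grading coef0 => ->.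
  have [s] := poly_nonroot q0; rewrite hornerM hornerX mulf_eq0 negb_or.
  move=> /andP[qs s0]; apply: (Ps _ s s0); apply: rP.
    by have [i xi] := x0; exists i; rewrite mulf_neq0.
  suff <- : q.[s] = r.@[fun i => s * x i] by [].
  apply: (rmorph_mmap (g := horner_eval s \o map_poly (meval x))) => [c|i] /=.
    by rewrite map_polyC /horner_eval hornerC /= mevalC.
  by rewrite rmorphM /= map_polyC map_polyX /horner_eval hornerM hornerC hornerX /= mevalXU mulrC.
Qed.

End Generic.

(** * Eliminating the direction *)

Lemma ord3_third (i j : 'I_3) : i != j ->
  exists l, [/\ l != i, l != j & forall k, [|| k == i, k == j | k == l]].
Proof.
move=> ij; pose l : 'I_3 := inord (3 - i - j); exists l.
have lE : l = (3 - i - j)%N :> nat.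
  by rewrite inordK //; move: ij {l}; case: i => -[|[|[|//]]] ?; case: j => -[|[|[|//]]] ?.
rewrite -!val_eqE /= lE; split.
- by move: ij; case: i {l lE} => -[|[|[|//]]] ?; case: j => -[|[|[|//]]] ?.
- by move: ij; case: i {l lE} => -[|[|[|//]]] ?; case: j => -[|[|[|//]]] ?.
- move=> k; rewrite -!val_eqE /= lE.
  by move: ij; case: i {l lE} => -[|[|[|//]]] ?; case: j => -[|[|[|//]]] ?; case: k => -[|[|[|//]]] ?.
Qed.

Lemma sum_ord3 (V : nmodType) (i j l : 'I_3) (F : 'I_3 -> V) :
  j != i -> l != i -> l != j -> \sum_k F k = F i + F j + F l.
Proof.
move=> ji li lj; rewrite (bigD1 i) //= (bigD1 j) //= (bigD1 l) /= ?li //.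
rewrite big1 ?addr0 ?addrA // => k /andP[/andP[ki kj] kl].
have [l' [_ _ /(_ k)]] := ord3_third ji.
move: ki kj kl; have [m [mi mj h]] := ord3_third ji.
have := h l; have := h k; rewrite (negPf li) (negPf lj) /= => hk /eqP ->.
by move=> ki kj; move: hk; rewrite (negPf ki) (negPf kj) /= => ->.
Qed.

Section Minors.
Variable C : fieldType.
Implicit Types x y X : 'I_3 -> C.

Definition minor x y i j : C := x i * y j - x j * y i.

Definition collinear x y := exists c, forall i, y i = c * x i.

Lemma collinear_minor x y :
  (exists i, x i != 0) -> (forall i j, minor x y i j = 0) -> collinear x y.
Proof.
move=> [i xi] h; exists (y i / x i) => j.
have /eqP := h i j; rewrite subr_eq0 => /eqP e.
by apply: (mulfI xi); rewrite e; field.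
Qed.

Lemma not_collinear_minor x y : (exists i, x i != 0) -> ~ collinear x y ->
  exists i j, minor x y i j != 0.
Proof.
move=> x0 nc; apply: contrapT => h; apply: nc; apply: collinear_minor => // i j.
by apply/eqP/negPn/negP => m; apply: h; exists i, j.
Qed.

Definition unit_vec (l : 'I_3) : 'I_3 -> C := fun k => (k == l)%:R.

Section Frame.
Variables (x v : 'I_3 -> C) (i j l : 'I_3).
Hypotheses (m0 : minor x v i j != 0) (li : l != i) (lj : l != j)
  (ijl : forall k, [|| k == i, k == j | k == l]).

(** Coordinates in the basis formed by [x], [v] and [unit_vec l]. The last vector has zero entries
    at [i] and [j], so the first two coordinates come from Cramer's rule on these entries. *)
Definition frame0 X := (X i * v j - X j * v i) / minor x v i j.
Definition frame1 X := (x i * X j - x j * X i) / minor x v i j.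
Definition frame2 X := X l - frame0 X * x l - frame1 X * v l.

Lemma frame_ij : j != i.
Proof. by apply: contraNneq m0 => ->; rewrite /minor subrr. Qed.

Lemma frameE X k : X k = frame0 X * x k + frame1 X * v k + frame2 X * unit_vec l k.
Proof.
rewrite /unit_vec; move: m0; rewrite /frame2 /frame0 /frame1 /minor => h.
case/or3P: (ijl k) => /eqP ->.
- by rewrite eq_sym (negPf li) mulr0n; field.
- by rewrite eq_sym (negPf lj) mulr0n; field.
- by rewrite eqxx mulr1n; field.
Qed.

Lemma frame_eval a b c :
  let X k := a * x k + b * v k + c * unit_vec l k in
  [/\ frame0 X = a, frame1 X = b & frame2 X = c].
Proof.
have e0 : frame0 (fun k => a * x k + b * v k + c * unit_vec l k) = a.
  rewrite /frame0 /unit_vec ![_ == l]eq_sym (negPf li) (negPf lj) !mulr0n.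
  by move: m0; rewrite /minor => h; field.
have e1 : frame1 (fun k => a * x k + b * v k + c * unit_vec l k) = b.
  rewrite /frame1 /unit_vec ![_ == l]eq_sym (negPf li) (negPf lj) !mulr0n.
  by move: m0; rewrite /minor => h; field.
split=> //; rewrite /frame2 e0 e1 /unit_vec eqxx mulr1n; ring.
Qed.

Definition frame2_coef k : C := frame2 (unit_vec k).

Lemma frame2_sum X : \sum_k frame2_coef k * X k = frame2 X.
Proof.
rewrite (sum_ord3 _ frame_ij li lj) /frame2_coef /frame2 /frame0 /frame1 /unit_vec.
rewrite !eqxx (negPf frame_ij) (negPf li) (negPf lj).
rewrite ![_ == l]eq_sym [i == j]eq_sym (negPf li) (negPf lj) (negPf frame_ij).
rewrite !mulr0n !mulr1n; by move: m0; rewrite /minor => h; field.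
Qed.

End Frame.
End Minors.

Section LinearForms.
Variables (n : nat) (F : numFieldType) (a b : 'I_n -> F).
Hypothesis ab : \sum_i a i * b i = 1.
Implicit Types f g : {mpoly F[n]}.

Definition linear_form : {mpoly F[n]} := \sum_i a i *: 'X_i.

(* Projection onto the hyperplane [linear_form = 0] along [b]. *)
Definition project f : {mpoly F[n]} :=
  mmap (@mpolyC n F) (fun i => 'X_i - b i *: linear_form) f.

Lemma linear_formE x : linear_form.@[x] = \sum_i a i * x i.
Proof. by rewrite raddf_sum /=; apply: eq_bigr => i _; rewrite mevalZ mevalXU. Qed.

Lemma projectE f x :
  (project f).@[x] = f.@[fun i => x i - b i * \sum_k a k * x k].
Proof.
apply: (rmorph_mmap (g := meval x)) => [c|i] /=; first by rewrite mevalC.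
by rewrite mevalB mevalZ mevalXU linear_formE.
Qed.

Lemma divides_sub_project f : divides linear_form (f - project f).
Proof.
elim/mpoly_alg_ind: f => [c|i|p q IHp IHq|p q IHp IHq].
- by rewrite /project mmapC subrr; exact: divides0.
- rewrite /project mmapX mmap1U opprB addrC subrK -mul_mpolyC.
  exact: divides_mull.
- rewrite /project mmapD opprD addrACA; exact: dividesD.
- have -> : p * q - project (p * q) = (p - project p) * q + project p * (q - project q).
    by rewrite /project rmorphM /=; ring.
  by apply: dividesD; [exact: dividesMr | exact: dividesMl].
Qed.

Lemma project_linear_form f : divides linear_form f -> project f = 0.
Proof.
move=> [g ->]; apply: mpoly_eq0_meval => x; rewrite projectE mevalM linear_formE.
rewrite [X in _ * X](_ : _ = 0) ?mulr0 //.
under eq_bigr do rewrite mulrBr mulrA.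
by rewrite sumrB -mulr_suml ab mul1r subrr.
Qed.

Lemma linear_form_divides f : (forall x, \sum_i a i * x i = 0 -> f.@[x] = 0) ->
  divides linear_form f.
Proof.
move=> h; have := divides_sub_project f.
suff -> : project f = 0 by rewrite subr0.
apply: mpoly_eq0_meval => x; rewrite projectE; apply: h.
under eq_bigr do rewrite mulrBr mulrA.
by rewrite sumrB -mulr_suml ab mul1r subrr.
Qed.

(** The multiples of the linear form are the kernel of [project], a ring endomorphism of a
    domain. *)
Lemma prime_linear_form : prime_elt linear_form.
Proof.
split.
- have : linear_form.@[b] != 0 by rewrite linear_formE ab oner_neq0.
  by apply: contraNneq => ->; rewrite meval0.
- move/project_linear_form; rewrite /project rmorph1 => /eqP.
  by rewrite oner_eq0.
- move=> f g /project_linear_form; rewrite /project rmorphM -!/(project _).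
  move=> /eqP; rewrite mulf_eq0 => /orP[] /eqP e; [left|right];
    [have := divides_sub_project f|have := divides_sub_project g];
    by rewrite /project /= in e *; rewrite e subr0.
Qed.

Lemma linear_form_homog : linear_form \is 1.-homog.
Proof.
by apply: rpred_sum => i _; apply: rpredZ; rewrite dhomogX /= mdeg1.
Qed.

End LinearForms.

Section Coprime.
Variable C : numClosedFieldType.
Implicit Types (q c w : biring C) (x y : 'I_3 -> C).

Lemma biring_ext (w1 w2 : biring C) : (forall x y, ev w1 x y = ev w2 x y) -> w1 = w2.
Proof.
by move=> e; apply/eqP; rewrite -subr_eq0; apply/eqP/bipoly_eq0 => x y; rewrite evB e subrr.
Qed.

(** [prime_mpoly_elim] eliminates the last variable only; exchanging it with another one gives
    [elimY] for every direction coordinate. *)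
Definition permY (s : {perm 'I_3}) : biring C -> biring C :=
  bieval (@bC C) (@bX C) (fun i => bY C (s i)).

HB.instance Definition _ s := GRing.RMorphism.copy (permY s)
  (bieval (@bC C) (@bX C) (fun i => bY C (s i))).

Lemma permYD s : {morph permY s : p q / p + q}.
Proof. exact: rmorphD. Qed.

Lemma permYM s : {morph permY s : p q / p * q}.
Proof. exact: rmorphM. Qed.

Lemma permYE s w x y : ev (permY s w) x y = ev w x (y \o s).
Proof.
by apply: (rmorph_bieval (g := bieval idfun x y)) => [c|i|i] /=;
  rewrite ?bievalC ?bievalX ?bievalY.
Qed.

Lemma permYK i j : cancel (permY (tperm i j)) (permY (tperm i j)).
Proof.
move=> w; apply: biring_ext => x y; rewrite !permYE.
by apply: ev_ext => // k /=; rewrite tpermK.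
Qed.

Lemma permY_comb i j (a b q c r : biring C) (s := tperm i j) :
  r = a * permY s q + b * permY s c -> permY s r = permY s a * q + permY s b * c.
Proof.
move=> ->; rewrite permYD.
by apply: congr2; rewrite permYM; apply: congr2 => //; exact: permYK.
Qed.

Lemma evD_congr w1 w2 x y x' y' : ev w1 x y = ev w1 x' y' ->
  ev w2 x y = ev w2 x' y' -> ev (w1 + w2) x y = ev (w1 + w2) x' y'.
Proof. by move=> e1 e2; rewrite evD e1 e2 evD. Qed.

Lemma evM_congr w1 w2 x y x' y' : ev w1 x y = ev w1 x' y' ->
  ev w2 x y = ev w2 x' y' -> ev (w1 * w2) x y = ev (w1 * w2) x' y'.
Proof. by move=> e1 e2; rewrite evM e1 e2 evM. Qed.

Lemma elimY (l : 'I_3) q c : prime_elt q -> ~ divides q c ->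
  exists a b r : biring C, [/\ r != 0, r = a * q + b * c
  & forall x y y', (forall k, k != l -> y k = y' k) -> ev r x y = ev r x y'].
Proof.
move=> pq qc; pose s := tperm l ord_max.
have iso := divides_iso (@permYK l ord_max) (@permYK l ord_max).
have [||a [b [r [r0 e]]]] := @prime_mpoly_elim (xring C) 2 (permY s q) (permY s c).
- exact/(prime_elt_iso (@permYK l ord_max) (@permYK l ord_max)).
- by move/iso.
pose r' : biring C := mwiden r.
have er : r' = a * permY s q + b * permY s c by [].
exists (permY s a), (permY s b), (permY s r'); split.
- have r'0 : r' != 0.
    by apply: contraNneq r0 => r'0; apply/eqP/inj_mwiden; rewrite mwiden0.
  apply: contraNneq r'0 => pr0; rewrite -[r'](@permYK l ord_max) -/s pr0.
  by rewrite rmorph0.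
- exact: permY_comb er.
- move=> x y y' yy'; rewrite !permYE.
  have : forall k, k != ord_max -> (y \o s) k = (y' \o s) k.
    move=> k kl; apply: yy'; apply: contraNneq kl => kl.
    by rewrite -[k](tpermK l ord_max) -/s kl tpermL.
  move: (y \o s) (y' \o s) => {yy'}y {}y' yy'; clear er r0 e; rewrite /r'; clear r'.
  elim/mpoly_alg_ind: r => [g|k|g h IHg IHh|g h IHg IHh].
  + by rewrite mwidenC /ev /bieval !mmapC.
  + rewrite mwidenX mnmwiden1 /ev /bieval !mmapX !mmap1U; apply: yy'.
    by rewrite -val_eqE /= ltn_eqF.
  + by rewrite mwidenD; exact: (evD_congr IHg IHh).
  + by rewrite mwidenM; exact: (evM_congr IHg IHh).
Qed.

(* Eliminating [y_l] from [q = c = 0] leaves a nonzero equation [r]; a common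
   zero [y] spans with [x] a plane of common zeros, on which [r (x, _)] must
   vanish: so [r (x, _) = 0] unless [y] is a multiple of [x]. *)
Lemma coprime_generic q c : prime_elt q -> ~ divides q c ->
  (forall x y s t, ev q x y = 0 -> ev c x y = 0 ->
     ev q x (fun i => s * y i + t * x i) = 0 /\
     ev c x (fun i => s * y i + t * x i) = 0) ->
  exists r : {mpoly C[3]}, r != 0 /\ forall x y, nonzero x -> r.@[x] != 0 ->
    ev q x y = 0 -> ev c x y = 0 -> collinear x y.
Proof.
move=> pq qc inv.
have step l : exists g : {mpoly C[3]}, g != 0 /\ forall x y i j, i != l -> j != l ->
    g.@[x] != 0 -> ev q x y = 0 -> ev c x y = 0 -> minor x y i j = 0.
  have [a [b [r [r0 er ry]]]] := elimY l pq qc.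
  have [m rm] : exists m, (r : {mpoly (xring C)[3]})@_m != 0.
    apply: contrapT => h; move/eqP: r0; apply; apply/mpolyP => m.
    by rewrite mcoeff0; apply/eqP/negPn/negP => rm; apply: h; exists m.
  exists ((r : {mpoly (xring C)[3]})@_m); split=> // x y i j il jl gx qxy cxy.
  apply/eqP/negPn/negP => m0.
  have [y' ry'] : exists y', ev r x y' != 0.
    apply: contrapT => h; move/eqP: gx; apply.
    have : at_point r x = 0.
      apply: mpoly_eq0_meval => z; rewrite -evE.
      by apply/eqP/negPn/negP => rz; apply: h; exists z.
    move/(congr1 (fun p => p@_m)); rewrite mcoeff0 => <-.
    by rewrite /at_point mcoeff_map_mpoly.
  (* By Cramer's rule, [s y + t x] agrees with [y'] at the entries [i] and [j], and [r] does not
     depend on the remaining entry [l]. *)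
  pose s := (x i * y' j - x j * y' i) / minor x y i j.
  pose t := (y j * y' i - y i * y' j) / minor x y i j.
  have [q0 c0] := inv x y s t qxy cxy.
  move/eqP: ry'; apply; rewrite (ry _ _ (fun i => s * y i + t * x i)).
    by rewrite er evD !evM q0 c0 !mulr0 addr0.
  have ij : i != j by apply: contraNneq m0 => ->; rewrite /minor subrr.
  have [l' [_ _ h]] := ord3_third ij.
  have := h l; rewrite ![l == _]eq_sym (negPf il) (negPf jl) /= => /eqP ell.
  move=> k kl; have := h k; rewrite ell (negPf kl) orbF.
  by move: m0; rewrite /s /t /minor => m0; case/orP => /eqP ->; field.
have /choice [g hg] := step.
exists (\prod_l g l); split.
  by apply/prodf_neq0 => l _; case: (hg l).
move=> x y x0 gx qxy cxy; apply: collinear_minor => // i j.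
have [->|ij] := eqVneq i j; first by rewrite /minor subrr.
have [l [li lj _]] := ord3_third ij.
have [_ h] := hg l; rewrite eq_sym in li; rewrite eq_sym in lj.
apply: h qxy cxy => //.
by move: gx; rewrite rmorph_prod => /prodf_neq0 /(_ l isT).
Qed.

(** Choose [b] with g(b) nonzero and restrict [g] to a line of direction [b] that misses [p]. The
    restriction has top coefficient g(b) in degree [k > 0], so it has a root. *)
Lemma off_center_zero (g : {mpoly C[3]}) k p : (0 < k)%N -> g \is k.-homog ->
  (forall y, collinear p y -> g.@[y] = 0) -> g != 0 -> nonzero p ->
  exists v, g.@[v] = 0 /\ ~ collinear p v.
Proof.
move=> k0 hg gp g0 p0; have [b gb] := mpoly_nonroot g0.
have [|i [j m0]] := @not_collinear_minor _ p b p0; first by move/gp/eqP; rewrite (negPf gb).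
have ij : i != j by apply: contraNneq m0 => ->; rewrite /minor subrr.
have [l [li lj _]] := ord3_third ij.
pose P := mmap (polyC \o idfun) (fun i => (unit_vec C l i)%:P + (b i)%:P * 'X) g.
have [_ tP] : has_top k P g.@[b] by exact: (@has_top_mmap C C 3 k idfun).
have [s /rootP Ps] : exists s, root P s.
  apply/closed_rootP; apply: contraNneq gb => P1; rewrite -tP.
  by rewrite nth_default // P1.
have PE : P.[s] = g.@[fun i => unit_vec C l i + s * b i].
  rewrite -[LHS]/(horner_eval s P); apply: rmorph_mmap => [c|h];
    by rewrite /= /horner_eval !hornerE // mulrC.
exists (fun i => unit_vec C l i + s * b i); split; first by rewrite -PE.
move=> [c h]; move: (h i) (h j) (h l); rewrite /unit_vec eqxx.
rewrite ![_ == l]eq_sym (negPf li) (negPf lj) !mulr0n !mulr1n !add0r => hi hj hl.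
have s0 : s = 0.
  apply: (mulIf m0); rewrite mul0r /minor mulrBr.
  by rewrite [s * (p i * _)]mulrCA [s * (p j * _)]mulrCA hi hj; ring.
have c0 : c = 0.
  have [pi|pi] := eqVneq (p i) 0; last first.
    by apply: (mulIf pi); rewrite -hi s0 !mul0r.
  have pj : p j != 0.
    by apply: contraNneq m0 => pj; rewrite /minor pi pj; apply/eqP; ring.
  by apply: (mulIf pj); rewrite -hj s0 !mul0r.
by move/eqP: hl; rewrite s0 c0 !mul0r addr0 oner_eq0.
Qed.

End Coprime.

(** * Polynomials in two or three variables *)

Lemma pred_addn_le a b c d :
  (a <= b.+1)%N -> (c <= d.+1)%N -> ((a + c).-1 <= (b + d).+1)%N.
Proof. lia. Qed.

Lemma size_prod_bound (R : nzRingType) (I : Type) (r : seq I) (F : I -> {poly R}) b :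
  (forall i, (size (F i) <= b.+1)%N) ->
  (size (\prod_(i <- r) F i)%R <= (size r * b).+1)%N.
Proof.
move=> hF; elim: r => [|i r IHr]; first by rewrite big_nil size_poly1.
rewrite big_cons (leq_trans (size_polyMleq _ _)) //=.
by rewrite mulSn; exact: pred_addn_le.
Qed.

Lemma size_det_bound (R : comNzRingType) m (A : 'M[{poly R}]_m) b :
  (forall i j, (size (A i j) <= b.+1)%N) -> (size (\det A)%R <= (m * b).+1)%N.
Proof.
move=> hA; rewrite /determinant; apply: (leq_trans (size_sum _ _ _)).
apply/bigmax_leqP => s _; rewrite -signr_odd.
have := @size_prod_bound _ _ (index_enum 'I_m) (fun i => A i (s i)) b
  (fun i => hA i (s i)).
rewrite /index_enum -enumT size_enum_ord => h.
by case: (odd _); rewrite ?expr1 ?expr0 ?mulN1r ?mul1r ?size_polyN.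
Qed.

(** The Sylvester matrix has at most [m + m] rows, and its entries have degree at most [b]. *)
Lemma size_resultant_bound (R : comNzRingType) (p q : {poly {poly R}}) m b :
  (size p <= m.+1)%N -> (size q <= m.+1)%N ->
  (forall i, (size (p`_i)%R <= b.+1)%N) -> (forall i, (size (q`_i)%R <= b.+1)%N) ->
  (size (resultant p q) <= ((m + m) * b).+1)%N.
Proof.
move=> sp sq hp hq; rewrite /resultant.
apply: (leq_trans (size_det_bound (b := b) _)) => [i j|].
  rewrite Sylvester_mxE; case: (split i) => a; case: (a <= j)%N;
    by rewrite ?mulr1n ?mulr0n ?size_poly0.
rewrite ltnS; apply: leq_mul => //; apply: leq_add;
  by rewrite -subn1 leq_subLR add1n.
Qed.

Lemma poly_mulXn_small (R : idomainType) (p : {poly R}) N :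
  divides 'X^N p -> (size p <= N)%N -> p = 0.
Proof.
move=> [r ->]; have [->|r0] := eqVneq r 0; first by rewrite mul0r.
by rewrite size_mulXn // -[X in (_ <= X)%N]addn0 leq_add2l leqn0 size_poly_eq0 (negPf r0).
Qed.

Lemma divides_Xn (R : idomainType) (p : {poly R}) N :
  (forall s, (s < N)%N -> p`_s = 0) -> divides 'X^N p.
Proof.
move=> h; exists (drop_poly N p); rewrite -[LHS](poly_take_drop N).
rewrite [X in X + _](_ : _ = 0) ?add0r //.
by apply/polyP => s; rewrite coef_take_poly coef0; case: ifP => // /h.
Qed.

Lemma divides_Xn_coef (R : idomainType) (p : {poly R}) N s :
  divides 'X^N p -> (s < N)%N -> p`_s = 0.
Proof. by move=> [r ->] sN; rewrite coefMXn sN. Qed.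

(* Newton's iteration for the branch through [(0, 0)] of [f (u, z) = 0]; as the
   linear coefficient [delta] is a unit, no denominators appear. *)
Lemma hensel_branch (R : idomainType) (f : {poly {poly R}}) (delta : R) N :
  f.[0].[0] = 0 -> f^`().[0].[0] = delta -> divides delta 1 ->
  exists phi : {poly R}, phi.[0] = 0 /\ divides 'X^N f.[phi].
Proof.
move=> f0 f1 [di ddi]; elim: N => [|N [phi [phi0 [r er]]]].
  by exists 0; rewrite horner0; split=> //; exists f.[0]; rewrite mulr1.
(* Order 1 is reached by [phi = 0]; a correction by a multiple of ['X^0] would destroy [phi.[0] =
   0]. *)
case: N er => [|N] er.
  exists 0; rewrite horner0; split=> //; apply: divides_Xn => -[_|//].
  by rewrite -horner_coef0.
have d1 : f^`().[phi].[0] = delta.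
  rewrite -f1 -![_.[0]]/(horner_eval 0 _).
  rewrite -!(horner_map (horner_eval (0 : R))) /= /horner_eval phi0.
  by rewrite !hornerE.
pose c := r.[0] * di.
exists (phi - c%:P * 'X^(N.+1)); split.
  by rewrite !hornerE phi0 expr0n mulr0 subr0.
have ->: f.[phi - c%:P * 'X^(N.+1)] =
   f.[phi] + f^`().[phi] * (- (c%:P * 'X^(N.+1))) +
   \sum_(i < (size f)) f^`N(i.+2).[phi] * (- (c%:P * 'X^(N.+1))) ^+ i.+2.
  rewrite (@nderiv_taylor_wide _ (size f).+2); last 2 first.
  - exact: mulrC.
  - by rewrite ltnW // ltnW.
  rewrite 2!big_ord_recl addrA; congr (_ + _ + _).
    by rewrite nderivn0 expr0 mulr1.
  by rewrite /= poly.nderivn1 expr1.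
(* The Taylor terms of order at least 2 are multiples of a power of ['X] with exponent at least
   [2 * N.+1], which is at least [N.+2]. *)
apply: dividesD; last first.
  elim/big_ind: _ => [|a b|i _]; [exact: divides0|exact: dividesD|].
  apply: dividesMl; rewrite exprNn; apply: dividesMl; rewrite exprMn; apply: dividesMl.
  rewrite -exprM; exists ('X^(N.+1 * i.+2 - N.+2)); rewrite -exprD subnK //; nia.
have -> : f.[phi] + f^`().[phi] * - (c%:P * 'X^(N.+1)) = (r - f^`().[phi] * c%:P) * 'X^(N.+1).
  rewrite er; ring.
have : root (r - f^`().[phi] * c%:P) 0.
  rewrite /root hornerD hornerN hornerM hornerC d1 /c [delta * _]mulrCA [delta * _]mulrC -ddi.
  by rewrite mulr1 subrr.
move=> /factor_theorem [s]; rewrite subr0 => ->; exists s.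
by rewrite -mulrA -exprS.
Qed.

Lemma clear_denominators (R : idomainType) m n (A : 'M[{fraction R}]_(m, n)) :
  exists (d : R) (B : 'M[R]_(m, n)), d != 0 /\
    forall i j, A i j * tofrac d = tofrac (B i j).
Proof.
have fracE (a : {fraction R}) : exists nd : R * R,
    nd.2 != 0 /\ a * tofrac nd.2 = tofrac nd.1.
  elim/quotW: a => r; exists (\n_r, \d_r); have d0 := denom_ratioP r; split=> //=.
  unlock FracField.tofrac; rewrite -[LHS]FracField.pi_mul; apply/eqmodP => /=.
  rewrite FracField.equivfE /FracField.mulf !numden_Ratio ?oner_neq0 ?mulr1 ?mul1r //.
  by rewrite mulrC.
have /choice [nd hnd] : forall ij : 'I_m * 'I_n, exists nd : R * R,
    nd.2 != 0 /\ A ij.1 ij.2 * tofrac nd.2 = tofrac nd.1 by move=> ij; exact: fracE.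
exists (\prod_ij (nd ij).2),
  (\matrix_(i, j) ((nd (i, j)).1 * \prod_(ij | ij != (i, j)) (nd ij).2)).
split; first by apply/prodf_neq0 => ij _; case: (hnd ij).
move=> i j; rewrite mxE (bigD1 (i, j)) //= !tofracM mulrA.
by have [_ ->] := hnd (i, j).
Qed.

(** If the rows were independent over the field of fractions, a right inverse with cleared
    denominators would keep them independent at almost every [t]. *)
Lemma kernel_specialization (F : numFieldType) (I : finType) N
    (M : I -> 'I_N -> {poly F}) (bad : {poly F}) : bad != 0 ->
  (forall t, bad.[t] != 0 -> exists a : I -> F,
     (exists i, a i != 0) /\ forall s, \sum_i a i * (M i s).[t] = 0) ->
  exists A : I -> {poly F},
     (exists i, A i != 0) /\ forall s, \sum_i A i * M i s = 0.
Proof.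
move=> bad0 h; pose MK := \matrix_(r < #|I|, s < N) tofrac (M (enum_val r) s).
have reI (V : nmodType) (f : I -> V) : \sum_i f i = \sum_(r < #|I|) f (enum_val r).
  by rewrite (reindex _ (onW_bij _ (enum_val_bij I))).
have [/row_freeP [B MB]|nfree] := boolP (row_free MK).
  have [d [B' [d0 dB]]] := clear_denominators B.
  have MB' r r' : \sum_s M (enum_val r) s * B' s r' = d *+ (r == r').
    apply/eqP; rewrite -tofrac_eq rmorph_sum tofracMn; apply/eqP.
    have := congr1 (fun X : 'M_ _ => X r r' * tofrac d) MB.
    rewrite !mxE mulr_suml mulrnAl mul1r => <-.
    by apply: eq_bigr => s _; rewrite mxE /= tofracM -dB mulrA.
  (* At such a [t], [MB'] says that the specialized matrix times that of [B'] is a nonzero multiple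
     of the identity, so the relation [a] must be zero. *)
  have [t] : exists t, (bad * d).[t] != 0.
    have bd0 : bad * d != 0 by rewrite mulf_neq0.
    apply: contrapT => n; move/eqP: bd0; apply.
    apply: (@roots_geq_poly_eq0 _ _ [seq i%:R | i <- iota 0 (size (bad * d))]).
    - apply/allP => c _; rewrite /root; apply/negPn/negP => c0; apply: n; by exists c.
    - by rewrite map_inj_uniq ?iota_uniq // => i j /eqP; rewrite eqr_nat => /eqP.
    - by rewrite size_map size_iota.
  rewrite hornerM mulf_eq0 negb_or => /andP[bt dt].
  have [a [[i ai] ha]] := h t bt; case/negP: ai; apply/eqP.
  pose r' := enum_rank i.
  have : \sum_s (\sum_i a i * (M i s).[t]) * (B' s r').[t] = 0.
    by rewrite big1 // => s _; rewrite ha mul0r.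
  under eq_bigr => s _ do rewrite reI mulr_suml.
  rewrite exchange_big /=.
  under eq_bigr => r _.
    under eq_bigr do rewrite -mulrA -hornerM.
    rewrite -mulr_sumr -horner_sum MB' hornerMn.
  over.
  rewrite (bigD1 r') //= eqxx mulr1n big1 => [|r /negPf ->]; last by rewrite mulr0n mulr0.
  rewrite addr0 /r' enum_rankK => /eqP.
  by rewrite mulf_eq0 (negPf dt) orbF => /eqP.
(* The rows are dependent: a nonzero relation with cleared denominators is the required [A]. *)
have [r vr] : exists r, row r (kermx MK) != 0.
  apply: contrapT => n; move: nfree; rewrite -kermx_eq0 => /negP; apply.
  by apply/eqP/row_matrixP => r; rewrite row0; apply/eqP/negPn/negP => vr; apply: n; exists r.
have [d [B [d0 dB]]] := clear_denominators (row r (kermx MK)).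
exists (fun i => B 0 (enum_rank i)); split.
  have /rV0Pn [r' vr'] := vr.
  exists (enum_val r'); rewrite enum_valK -tofrac_eq0 -dB.
  by apply: (mulf_neq0 vr'); rewrite tofrac_eq0; exact: d0.
move=> s; apply/eqP; rewrite -tofrac_eq0 reI rmorph_sum.
have E r' : tofrac (B 0 (enum_rank (enum_val r')) * M (enum_val r') s) =
    kermx MK r r' * MK r' s * tofrac d.
  by rewrite enum_valK tofracM -dB !mxE mulrAC.
rewrite (eq_bigr _ (fun r' _ => E r')) -mulr_suml.
have := congr1 (fun X : 'M_ _ => X r s) (mulmx_ker MK).
by rewrite mxE => ->; rewrite mxE mul0r.
Qed.

Section USize.
Variable R : comNzRingType.
Implicit Types p q : {poly {poly R}}.

(** A bound on the degree in the inner variable, which is [u] in the application to pencils. *)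
Definition coef_size_le e p := forall j, (size (p`_j)%R <= e.+1)%N.

Lemma coef_size_leM a b p q : coef_size_le a p -> coef_size_le b q ->
  coef_size_le (a + b) (p * q).
Proof.
move=> hp hq j; rewrite coefM; apply: (leq_trans (size_sum _ _ _)).
apply/bigmax_leqP => i _; apply: (leq_trans (size_polyMleq _ _)).
by have := hp i; have := hq (j - i)%N; lia.
Qed.

Lemma coef_size_leD e p q : coef_size_le e p -> coef_size_le e q ->
  coef_size_le e (p + q).
Proof.
move=> hp hq j; rewrite coefD (leq_trans (size_polyD _ _)) // geq_max.
by rewrite hp hq.
Qed.

Lemma coef_size_le0 e : coef_size_le e 0.
Proof. by move=> j; rewrite coef0 size_poly0. Qed.

Lemma coef_size_leC (c : R) : coef_size_le 0 c%:P%:P.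
Proof.
move=> j; rewrite coefC; case: ifP => _; last by rewrite size_poly0.
exact: size_polyC_leq1.
Qed.

Lemma coef_size_leX e n p : coef_size_le e p -> coef_size_le (n * e) (p ^+ n).
Proof.
move=> h; elim: n => [|n IHn]; first by rewrite expr0; exact: coef_size_leC.
by rewrite exprS mulSn; exact: coef_size_leM.
Qed.

Lemma coef_size_le_mmap (S : nzRingType) n e (h : {rmorphism S -> {poly {poly R}}})
    (L : 'I_n -> {poly {poly R}}) (p : {mpoly S[n]}) :
  (forall c, coef_size_le 0 (h c)) -> (forall k, coef_size_le 1 (L k)) ->
  p \is e.-homog -> coef_size_le e (mmap h L p).
Proof.
move=> hh hL /dhomogP hp; rewrite /mmap big_seq.
elim/big_ind: _ => [|a b|m mp]; [exact: coef_size_le0|exact: coef_size_leD|].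
rewrite -[e]add0n; apply: coef_size_leM => //.
have -> : e = (\sum_i m i)%N by rewrite -mdegE; exact/esym/hp.
rewrite /mmap1; elim/big_rec2: _ => [|i u v _ huv]; first exact: coef_size_leC.
apply: coef_size_leM => //.
by have := coef_size_leX (m i) (hL i); rewrite muln1.
Qed.

End USize.

(** * The pencil of sections centered on a line *)

Section Rings.
Variable C : numClosedFieldType.

(** C[t], C[t][u] and C[t][u][z]. With [z] outermost and [t] innermost, a resultant in [z] is a
    polynomial in [u] over C[t], and its order at [u = 0] can be compared with its degree in [u]. *)
Definition ring1 : idomainType := {poly C}.
Definition ring2 : idomainType := {poly ring1}.
Definition ring3 : idomainType := {poly ring2}.

Definition cst1 : C -> ring1 := polyC.
HB.instance Definition _ := GRing.RMorphism.copy cst1 (@polyC C).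
Definition cst2 : C -> ring2 := fun c => (cst1 c)%:P.
HB.instance Definition _ := GRing.RMorphism.copy cst2 (@polyC ring1 \o cst1).
Definition cst3 : C -> ring3 := fun c => (cst2 c)%:P.
HB.instance Definition _ := GRing.RMorphism.copy cst3 (@polyC ring2 \o cst2).

Definition varT1 : ring1 := 'X.
Definition varU2 : ring2 := 'X.
Definition varT : ring3 := (varT1%:P : ring2)%:P.
Definition varU : ring3 := varU2%:P.
Definition varZ : ring3 := 'X.

Definition ev1 (t : C) : ring1 -> C := horner_eval t.
HB.instance Definition _ t := GRing.RMorphism.copy (ev1 t) (horner_eval t).
Definition ev2 (t u : C) : ring2 -> C := fun p => ev1 t (horner_eval (cst1 u) p).
HB.instance Definition _ t u :=
  GRing.RMorphism.copy (ev2 t u) (ev1 t \o horner_eval (cst1 u)).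
Definition ev3 (t u z : C) : ring3 -> C := fun p => ev2 t u (horner_eval (cst2 z) p).
HB.instance Definition _ t u z :=
  GRing.RMorphism.copy (ev3 t u z) (ev2 t u \o horner_eval (cst2 z)).

Lemma ev1_cst t c : ev1 t (cst1 c) = c.
Proof. by rewrite /ev1 /horner_eval hornerC. Qed.
Lemma ev2_cst t u c : ev2 t u (cst2 c) = c.
Proof. by rewrite /ev2 /cst2 /horner_eval hornerC ev1_cst. Qed.
Lemma ev3C t u z p : ev3 t u z p%:P = ev2 t u p.
Proof. by rewrite /ev3 /horner_eval hornerC. Qed.
Lemma ev2C t u p : ev2 t u p%:P = ev1 t p.
Proof. by rewrite /ev2 /horner_eval hornerC. Qed.
Lemma ev3_cst t u z c : ev3 t u z (cst3 c) = c.
Proof. by rewrite /cst3 ev3C ev2_cst. Qed.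
Lemma ev1T t : ev1 t varT1 = t.
Proof. by rewrite /ev1 /horner_eval hornerX. Qed.
Lemma ev2U t u : ev2 t u varU2 = u.
Proof. by rewrite /ev2 /horner_eval hornerX ev1_cst. Qed.
Lemma ev3Z t u z : ev3 t u z varZ = z.
Proof. by rewrite /ev3 /horner_eval hornerX ev2_cst. Qed.
Lemma ev3U t u z : ev3 t u z varU = u.
Proof. by rewrite ev3C ev2U. Qed.
Lemma ev3T t u z : ev3 t u z varT = t.
Proof. by rewrite ev3C ev2C ev1T. Qed.

Lemma ev3D t u z p q : ev3 t u z (p + q) = ev3 t u z p + ev3 t u z q.
Proof. exact: rmorphD. Qed.
Lemma ev3M t u z p q : ev3 t u z (p * q) = ev3 t u z p * ev3 t u z q.
Proof. exact: rmorphM. Qed.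
Lemma ev3X t u z p n : ev3 t u z (p ^+ n) = ev3 t u z p ^+ n.
Proof. exact: rmorphXn. Qed.

Lemma ev2D t u p q : ev2 t u (p + q) = ev2 t u p + ev2 t u q.
Proof. exact: rmorphD. Qed.
Lemma ev2M t u p q : ev2 t u (p * q) = ev2 t u p * ev2 t u q.
Proof. exact: rmorphM. Qed.
Lemma ev1D t p q : ev1 t (p + q) = ev1 t p + ev1 t q.
Proof. exact: rmorphD. Qed.
Lemma ev1M t p q : ev1 t (p * q) = ev1 t p * ev1 t q.
Proof. exact: rmorphM. Qed.

Lemma ev3_linear t u z (a b : ring2) :
  ev3 t u z (a%:P + b%:P * 'X) = ev2 t u a + z * ev2 t u b.
Proof.
by rewrite /ev3 /horner_eval hornerD hornerM !hornerC hornerX ev2D ev2M ev2_cst mulrC.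
Qed.

Lemma ev2_at0 t p : ev2 t 0 p = p.[0].[t].
Proof. by rewrite /ev2 /horner_eval rmorph0. Qed.

Lemma ev3_map t u z p : (map_poly (ev2 t u) p).[z] = ev3 t u z p.
Proof. by rewrite -[z in LHS](ev2_cst t u) horner_map. Qed.

Lemma ev2_map t u p : (map_poly (ev1 t) p).[u] = ev2 t u p.
Proof. by rewrite -[u in LHS](ev1_cst t) horner_map. Qed.

Lemma ring2_ext (p q : ring2) : (forall t u, ev2 t u p = ev2 t u q) -> p = q.
Proof.
move=> h; apply/polyP => i; apply: poly_eq_horner => t.
have E : map_poly (ev1 t) p = map_poly (ev1 t) q.
  by apply: poly_eq_horner => u; rewrite !ev2_map.
by have := congr1 (fun r : {poly C} => r`_i) E; rewrite !coef_map.
Qed.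

Lemma ring3_ext (p q : ring3) : (forall t u z, ev3 t u z p = ev3 t u z q) -> p = q.
Proof.
move=> h; apply/polyP => i; apply: ring2_ext => t u.
have E : map_poly (ev2 t u) p = map_poly (ev2 t u) q.
  by apply: poly_eq_horner => z; rewrite !ev3_map.
by have := congr1 (fun r : {poly C} => r`_i) E; rewrite !coef_map.
Qed.

Lemma varU_neq0 : varU != 0.
Proof. by rewrite /varU /varU2 polyC_eq0 polyX_eq0. Qed.

Lemma ring3_ext_dense (p q : ring3) :
  (forall t u z, u != 0 -> ev3 t u z p = ev3 t u z q) -> p = q.
Proof.
move=> h; apply: (mulIf varU_neq0); apply: ring3_ext => t u z.
rewrite !ev3M ev3U; have [->|u0] := eqVneq u 0; first by rewrite !mulr0.
by rewrite h.
Qed.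

Lemma ring3_ind (P : ring3 -> Prop) : (forall c, P (cst3 c)) ->
  P varT -> P varU -> P varZ -> (forall p q, P p -> P q -> P (p + q)) ->
  (forall p q, P p -> P q -> P (p * q)) -> forall p, P p.
Proof.
move=> Pc PT PU PZ PD PM; have P1 (p : ring1) : P ((p%:P : ring2)%:P).
  elim/poly_ind: p => [|p c IHp]; first by have := Pc 0; rewrite !rmorph0.
  have -> : (((p * 'X + c%:P : ring1)%:P : ring2)%:P : ring3) =
      ((p%:P : ring2)%:P : ring3) * varT + cst3 c.
    by rewrite polyCD polyCD polyCM polyCM.
  by apply: (PD) => //; exact: PM.
have P2 (p : ring2) : P (p%:P).
  elim/poly_ind: p => [|p c IHp]; first by have := Pc 0; rewrite !rmorph0.
  have -> : ((p * 'X + c%:P : ring2)%:P : ring3) =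
      (p%:P : ring3) * varU + ((c%:P : ring2)%:P : ring3).
    by rewrite polyCD polyCM.
  by apply: (PD) => //; exact: PM.
elim/poly_ind => [|p c IHp]; first by have := Pc 0; rewrite !rmorph0.
by apply: (PD) => //; exact: PM.
Qed.

End Rings.

Section Pencil.
Variables (C : numClosedFieldType) (w : biring C) (n k : nat).
Variables (x v : 'I_3 -> C) (i j l : 'I_3) (delta : C).
Hypotheses (pw : prime_elt w) (hw : bihomogeneous n k w) (sw : shear_invariant w).
Hypotheses (k0 : (0 < k)%N) (kn : (k <= n)%N).
Hypotheses (m0 : minor x v i j != 0) (li : l != i) (lj : l != j)
  (ijl : forall h, [|| h == i, h == j | h == l]).
Hypotheses (xv0 : ev w x v = 0) (xv1 : (line_poly w x v)`_1 = delta)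
  (delta0 : delta != 0) (vx0 : ev w v x != 0).

Let e := unit_vec C l.
Let xi0 := frame0 x v i j.
Let xi1 := frame1 x v i j.
Let xi2 := frame2 x v i j l.

(** The point [x + u e + z v] of an affine plane through [x]; [pencilY] is the center [v + t x].
    Taking [v] as the direction of [z] controls both the slope of the branch and the top coefficient
    in [z]. *)
Definition pencilX (h : 'I_3) : ring3 C :=
  (cst2 (x h) + cst2 (e h) * varU2 C)%:P + (cst2 (v h))%:P * 'X.
Definition pencilY (h : 'I_3) : ring3 C :=
  ((cst1 (v h) + cst1 (x h) * varT1 C)%:P : ring2 C)%:P.

Definition pencil : biring C -> ring3 C :=
  bieval (polyC \o @cst2 C) pencilX pencilY.

HB.instance Definition _ := GRing.RMorphism.copy pencil
  (bieval (polyC \o @cst2 C) pencilX pencilY).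

Lemma pencilE t u z (q : biring C) : ev3 t u z (pencil q) =
  ev q (fun h => x h + u * e h + z * v h) (fun h => v h + t * x h).
Proof.
apply: (rmorph_bieval (g := ev3 t u z)) => [c|h|h].
- exact: ev3_cst.
- apply: (etrans (ev3_linear t u z (cst2 (x h) + cst2 (e h) * varU2 C) (cst2 (v h)))).
  by rewrite ev2D ev2M !ev2_cst ev2U [_ * u]mulrC.
- apply: (etrans (ev3C t u z ((cst1 (v h) + cst1 (x h) * varT1 C)%:P : ring2 C))).
  apply: (etrans (ev2C t u (cst1 (v h) + cst1 (x h) * varT1 C))).
  by rewrite ev1D ev1M !ev1_cst ev1T [_ * t]mulrC.
Qed.

Let f := pencil w.

(** On [u = 0] the center is [v + t x = (1 - t z) v + t (x + z v)], and a shear removes the second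
    term. *)
Lemma pencil_line t (q := map_poly (ev2 t 0) f) :
  q = (1 - t *: 'X) ^+ k * line_poly w x v.
Proof.
apply: poly_eq_horner => z; rewrite /q ev3_map /f pencilE.
rewrite hornerM line_polyE horner_exp hornerD hornerN hornerZ hornerX hornerC.
rewrite -(bihom_evr _ _ _ hw) -[RHS](sw _ _ t).
by apply: ev_ext => h; ring.
Qed.

Lemma coef_pencil t m :
  (f`_m).[0].[t] = ((1 - t *: 'X) ^+ k * line_poly w x v)`_m.
Proof. by rewrite -pencil_line coef_map /= ev2_at0. Qed.

Lemma line_coef0 : (line_poly w x v)`_0 = 0.
Proof.
rewrite -horner_coef0 line_polyE -[RHS]xv0.
by apply: ev_ext => // h; rewrite mul0r addr0.
Qed.

Lemma pencil_f0 : f.[0].[0] = 0.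
Proof.
rewrite [f.[0]]horner_coef0; apply: poly_eq_horner => t.
by rewrite coef_pencil horner0 coef0M line_coef0 mulr0.
Qed.

(** The factor [(1 - t z)^k] has constant term 1, so the coefficient does not involve [t] and is a
    unit of C[t], as [hensel_branch] requires. *)
Lemma pencil_f1 : (f`_1).[0] = cst1 delta.
Proof.
apply: poly_eq_horner => t.
rewrite coef_pencil hornerC coefM !big_ord_recl big_ord0 /= addr0.
rewrite line_coef0 mulr0 addr0 xv1.
by rewrite -horner_coef0 horner_exp hornerD hornerN hornerZ hornerX hornerC mulr0
  subr0 expr1n mul1r.
Qed.

Lemma pencil_df : f^`().[0].[0] = cst1 delta.
Proof. by rewrite [f^`().[0]]horner_coef0 coef_deriv mulr1n pencil_f1. Qed.

Lemma pencil_has_top : has_top n f (bieval (@cst2 C) (fun h => cst2 (v h))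
  (fun h => (cst1 (v h) + cst1 (x h) * varT1 C)%:P : ring2 C) w).
Proof. by apply: has_top_bieval; case: hw. Qed.

(** The top coefficient is the value w(v; v + t x) at the direction [v], which at [t = 1] equals
    w(v; x) by shear invariance. *)
Lemma pencil_coefn : f`_n != 0.
Proof.
have [_ ->] := pencil_has_top; apply/eqP => /(congr1 (@ev2 C 1 0)).
rewrite rmorph0 (rmorph_bieval (g := ev2 1 0) (h' := idfun) (X' := v)
   (Y' := fun h => x h + 1 * v h)) => [|c|h|h]; last 3 first.
- exact: ev2_cst.
- exact: ev2_cst.
- by rewrite /= ev2C ev1D ev1M !ev1_cst ev1T mulr1 mul1r addrC.
rewrite -/(ev w v _) sw => e0; by move: vx0; rewrite e0 eqxx.
Qed.

Lemma size_pencil : size f = n.+1.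
Proof.
have [s _] := pencil_has_top; apply/eqP; rewrite eqn_leq s /= ltnNge.
by apply: contra pencil_coefn => h; rewrite nth_default.
Qed.

Lemma pencil_coef_size : coef_size_le n (f : {poly {poly ring1 C}}).
Proof.
have cC (c : ring1 C) : coef_size_le 0 (c%:P%:P : {poly {poly ring1 C}}).
  exact: coef_size_leC.
rewrite /f /pencil /bieval /mmap.
elim/big_ind: _ => [|a b|m _]; [exact: coef_size_le0|exact: coef_size_leD|].
rewrite -[n]addn0; apply: coef_size_leM.
  apply: (@coef_size_le_mmap (ring1 C) C 3 n (polyC \o @cst2 C) pencilX) => [c|h|].
  - exact: cC.
  - apply: coef_size_leD.
      move=> s; rewrite coefC; case: ifP => _; last by rewrite size_poly0.
      rewrite (leq_trans (size_polyD _ _)) // geq_max.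
      rewrite (leq_trans (size_polyC_leq1 _)) //= (leq_trans (size_polyMleq _ _)) //.
      by rewrite size_polyX addn2 /= ltnS size_polyC_leq1.
    rewrite -[1%N]addn0 addnC; apply: coef_size_leM; first exact: cC.
    by move=> s; rewrite coefX; case: (s == 1%N); rewrite ?size_poly1 ?size_poly0.
  - by case: hw.
rewrite /mmap1; elim/big_ind: _ => [|a b ha hb|h _].
- have := cC 1; exact.
- by rewrite -[0%N]/(0 + 0)%N; exact: coef_size_leM.
- by have := coef_size_leX (m h) (cC (cst1 (v h) + cst1 (x h) * varT1 C)); rewrite muln0.
Qed.

Definition coordX (B : 'I_3 -> biring C) : biring C * biring C * biring C :=
  let a := bC (v j / minor x v i j) * B i - bC (v i / minor x v i j) * B j in
  let b := bC (x i / minor x v i j) * B j - bC (x j / minor x v i j) * B i in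
  (a, b, B l - a * bC (x l) - b * bC (v l)).

Let X0 := (coordX (@bX C)).1.1.
Let X1 := (coordX (@bX C)).1.2.
Let X2 := (coordX (@bX C)).2.
Let Y0 := X2 * (coordX (@bY C)).1.1 - (coordX (@bY C)).2 * X0.
Let Y1 := X2 * (coordX (@bY C)).1.2 - (coordX (@bY C)).2 * X1.

Lemma coordE (g : biring C -> C) (B : 'I_3 -> biring C) (b : 'I_3 -> C) :
  (forall p q, g (p * q) = g p * g q) -> (forall p q, g (p - q) = g p - g q) ->
  (forall c, g (bC c) = c) -> (forall h, g (B h) = b h) ->
  [/\ g (coordX B).1.1 = xi0 b, g (coordX B).1.2 = xi1 b & g (coordX B).2 = xi2 b].
Proof.
move=> gM gB gC gb.
have e0 : g (coordX B).1.1 = xi0 b.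
  by rewrite /coordX /= gB !gM !gC !gb /xi0 /frame0; ring.
have e1 : g (coordX B).1.2 = xi1 b.
  by rewrite /coordX /= gB !gM !gC !gb /xi1 /frame1; ring.
split=> //; rewrite /xi2 /frame2 -/xi0 -/xi1 -e0 -e1 /coordX /=.
by rewrite gB [X in X - _]gB gb ![g (_ * bC _)]gM !gC.
Qed.

Lemma coordXE a b : [/\ ev X0 a b = xi0 a, ev X1 a b = xi1 a & ev X2 a b = xi2 a].
Proof.
apply: (coordE (g := fun p => ev p a b)) => [p q|p q|c|h].
- exact: evM.
- exact: evB.
- exact: evC.
- exact: bievalX.
Qed.

Lemma coordYE a b : ev Y0 a b = xi2 a * xi0 b - xi2 b * xi0 a /\
  ev Y1 a b = xi2 a * xi1 b - xi2 b * xi1 a.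
Proof.
have [e0 e1 e2] := coordXE a b.
have [f0 f1 f2] : [/\ ev (coordX (@bY C)).1.1 a b = xi0 b,
    ev (coordX (@bY C)).1.2 a b = xi1 b & ev (coordX (@bY C)).2 a b = xi2 b].
  apply: (coordE (g := fun p => ev p a b)) => [p q|p q|c|h].
  - exact: evM.
  - exact: evB.
  - exact: evC.
  - exact: bievalY.
have evBM (p q r s : biring C) :
    ev (p * q - r * s) a b = ev p a b * ev q a b - ev r a b * ev s a b.
  by rewrite evB !evM.
split; apply: (etrans (evBM _ _ _ _)); first by rewrite e2 f0 f2 e0.
by rewrite e2 f1 f2 e1.
Qed.

(* In the frame [x, v, e] the line through [X] and [Y] meets the line through
   [x] and [v] at [X2 Y - Y2 X], of coordinates [(Y0, Y1, 0)]: this recovers the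
   parameters [t], [u], [z] of the pencil from a pair [(X, Y)]. *)
Lemma pencil_lift (h : ring3 C) : exists (r s : nat) (H : biring C), forall a b,
  ev X0 a b != 0 -> ev Y1 a b != 0 ->
  ev H a b = ev X0 a b ^+ r * ev Y1 a b ^+ s *
    ev3 (ev Y0 a b / ev Y1 a b) (ev X2 a b / ev X0 a b) (ev X1 a b / ev X0 a b) h.
Proof.
elim/ring3_ind: h => [c||||p q|p q].
- exists 0%N, 0%N, (bC c) => a b _ _.
  by rewrite evC ev3_cst !expr0 !mul1r.
- exists 0%N, 1%N, Y0 => a b _ y1; rewrite ev3T expr0 expr1 mul1r mulrC.
  by rewrite divfK.
- exists 1%N, 0%N, X2 => a b x0 _; rewrite ev3U expr0 expr1 mulr1 mulrC.
  by rewrite divfK.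
- exists 1%N, 0%N, X1 => a b x0 _; rewrite ev3Z expr0 expr1 mulr1 mulrC.
  by rewrite divfK.
- move=> [r1 [s1 [H1 h1]]] [r2 [s2 [H2 h2]]].
  exists (r1 + r2)%N, (s1 + s2)%N,
    (H1 * (X0 ^+ r2 * Y1 ^+ s2) + H2 * (X0 ^+ r1 * Y1 ^+ s1)) => a b x0 y1.
  by rewrite evD !evM !evX ev3D h1 // h2 // !exprD; ring.
- move=> [r1 [s1 [H1 h1]]] [r2 [s2 [H2 h2]]].
  exists (r1 + r2)%N, (s1 + s2)%N, (H1 * H2) => a b x0 y1.
  by rewrite !evM ev3M h1 // h2 // !exprD; ring.
Qed.

(** A shear gives w(X; X2 Y - Y2 X) = X2^k w(X; Y). Moreover X = X0 (x + u e + z v) and X2 Y - Y2 X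
    = Y1 (v + t x) for the parameters displayed. *)
Lemma ev_pencil_param a b : ev X0 a b != 0 -> ev Y1 a b != 0 ->
  ev X2 a b ^+ k * ev w a b = ev X0 a b ^+ n * ev Y1 a b ^+ k *
    ev3 (ev Y0 a b / ev Y1 a b) (ev X2 a b / ev X0 a b) (ev X1 a b / ev X0 a b) f.
Proof.
move=> x0 y1; rewrite /f pencilE -mulrA -!(bihom_evr _ _ _ hw) -(bihom_evl _ _ _ hw).
rewrite -[LHS](sw _ _ (- xi2 b)).
have [e0 e1 e2] := coordXE a b; have [f0 f1] := coordYE a b.
have x0' : xi0 a != 0 by rewrite -e0.
have y1' : xi2 a * xi1 b - xi2 b * xi1 a != 0 by rewrite -f1.
rewrite e0 e1 e2 f0 f1.
apply: ev_ext => h.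
  rewrite {1}(frameE m0 li lj ijl a h) -/(xi0 a) -/(xi1 a) -/(xi2 a) -/(e h).
  by field.
rewrite {1}(frameE m0 li lj ijl a h) {1}(frameE m0 li lj ijl b h).
rewrite -/(xi0 a) -/(xi1 a) -/(xi2 a) -/(xi0 b) -/(xi1 b) -/(xi2 b).
by field.
Qed.

Lemma pencil_coord : [/\ pencil X0 = 1, pencil Y1 = varU C & pencil Y0 = varU C * varT C].
Proof.
have E t u z : [/\ xi0 (fun h => x h + u * e h + z * v h) = 1,
    xi1 (fun h => x h + u * e h + z * v h) = z &
    xi2 (fun h => x h + u * e h + z * v h) = u] /\
    [/\ xi0 (fun h => v h + t * x h) = t, xi1 (fun h => v h + t * x h) = 1 &
    xi2 (fun h => v h + t * x h) = 0].
  have -> : (fun h => x h + u * e h + z * v h) =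
      (fun h => 1 * x h + z * v h + u * unit_vec C l h).
    by apply: funext => h; rewrite /e mul1r addrAC.
  have -> : (fun h => v h + t * x h) =
      (fun h => t * x h + 1 * v h + 0 * unit_vec C l h).
    by apply: funext => h; rewrite mul1r mul0r addr0 addrC.
  by split; exact: frame_eval.
split; apply: ring3_ext => t u z; rewrite pencilE.
- by have [-> _ _] := coordXE (fun h => x h + u * e h + z * v h) (fun h => v h + t * x h);
    have [[-> _ _] _] := E t u z; rewrite [RHS]rmorph1.
- have [_ ->] := coordYE (fun h => x h + u * e h + z * v h) (fun h => v h + t * x h).
  have [[_ _ ->] [_ -> ->]] := E t u z.
  by rewrite mulr1 mul0r subr0 ev3U.
- have [-> _] := coordYE (fun h => x h + u * e h + z * v h) (fun h => v h + t * x h).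
  have [[_ _ ->] [-> _ ->]] := E t u z.
  by rewrite mul0r subr0 ev3M ev3U ev3T.
Qed.

(** [pencil] sends [X0] to 1 and [Y1] to [u], so clearing denominators has cost only a power of
    [u]. *)
Lemma pencil_lift_back h r s H : (forall a b,
  ev X0 a b != 0 -> ev Y1 a b != 0 ->
  ev H a b = ev X0 a b ^+ r * ev Y1 a b ^+ s *
    ev3 (ev Y0 a b / ev Y1 a b) (ev X2 a b / ev X0 a b) (ev X1 a b / ev X0 a b) h) ->
  pencil H = varU C ^+ s * h.
Proof.
move=> hH; apply: ring3_ext_dense => t u z u0.
have [pX0 pY1 pY0] := pencil_coord.
have x0 := pencilE t u z X0; rewrite pX0 [LHS]rmorph1 in x0.
have y1 := pencilE t u z Y1; rewrite pY1 ev3U in y1.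
have y0 := pencilE t u z Y0; rewrite pY0 ev3M ev3U ev3T in y0.
rewrite pencilE hH -?x0 -?y1 ?oner_neq0 // -y0 !divr1 expr1n mul1r ev3M ev3X ev3U.
rewrite [u * t]mulrC mulfK //; congr (_ * _).
have [_ x1 x2] := coordXE (fun h => x h + u * e h + z * v h) (fun h => v h + t * x h).
have [_ e1 e2] : [/\ xi0 (fun h => x h + u * e h + z * v h) = 1,
    xi1 (fun h => x h + u * e h + z * v h) = z &
    xi2 (fun h => x h + u * e h + z * v h) = u].
  have -> : (fun h => x h + u * e h + z * v h) =
      (fun h => 1 * x h + z * v h + u * unit_vec C l h).
    by apply: funext => h'; rewrite /e mul1r addrAC.
  exact: frame_eval.
by rewrite x1 x2 e1 e2.
Qed.

(** At [u = 0] the polynomial [f] remains nonzero, its coefficient of [z] being [delta]; so a factor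
    [u] of [r * f] must come from [r]. *)
Lemma divides_varU_cancel s h : divides f (varU C ^+ s * h) -> divides f h.
Proof.
elim: s => [|s IHs]; first by rewrite expr0 mul1r.
rewrite exprS -mulrA => -[r er]; apply: IHs.
have fx0 : map_poly (horner_eval (0 : ring1 C)) f != 0.
  apply/eqP => /(congr1 (fun p : {poly ring1 C} => p`_1)).
  rewrite coef_map coef0 /= /horner_eval pencil_f1 => /eqP.
  by rewrite polyC_eq0 (negPf delta0).
have r0 : map_poly (horner_eval (0 : ring1 C)) r = 0.
  apply: (mul_eq0l fx0); rewrite -rmorphM -er rmorphM /= map_polyC /= /horner_eval.
  by rewrite hornerX mul0r.
have [r' er'] : divides (varU C) r.
  apply/divides_polyC => m.
  have := congr1 (fun p : {poly ring1 C} => p`_m) r0.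
  rewrite coef_map coef0 /= => rm0.
  have /factor_theorem [c] : root r`_m 0 by apply/eqP.
  by rewrite subr0 => ->; exact: divides_mull.
exists r'; apply: (mulfI (varU_neq0 C)).
by rewrite er er' mulrCA mulrA.
Qed.

Lemma not_divides_pencil (p : ring3 C) : p != 0 -> (size p <= 1)%N -> ~ divides f p.
Proof.
move=> p0 sp [r er].
have r0 : r != 0 by apply: contraNneq p0 => r0; rewrite er r0 mul0r.
have f0 : f != 0 by rewrite -size_poly_gt0 size_pencil.
have := size_mul r0 f0; rewrite -er size_pencil.
rewrite -size_poly_gt0 in r0.
by move: sp r0 k0 kn; lia.
Qed.

(** A relation [h1 * h2 = g * f] lifts to the ring of [w], where primality is known, and the result
    is restricted to the pencil again. *)
Lemma prime_pencil : prime_elt f.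
Proof.
have [pw0 pwu pwp] := pw; have [pX0 pY1 pY0] := pencil_coord.
split.
- by rewrite -size_poly_gt0 size_pencil.
- by apply: not_divides_pencil; rewrite ?oner_neq0 ?size_poly1.
move=> h1 h2 [g eg].
have [r1 [s1 [H1 l1]]] := pencil_lift h1.
have [r2 [s2 [H2 l2]]] := pencil_lift h2.
have [r3 [s3 [G l3]]] := pencil_lift g.
have X0n : X0 != 0.
  by apply/eqP => X00; move: pX0; rewrite X00 rmorph0 => /eqP; rewrite eq_sym oner_eq0.
have Y1n : Y1 != 0.
  apply/eqP => Y10; move: pY1; rewrite Y10 rmorph0 => /eqP.
  by rewrite eq_sym (negPf (varU_neq0 C)).
(* This is [h1 * h2 = g * f] with denominators cleared; the factor [X2 ^+ k] comes from
   [ev_pencil_param]. *)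
have E : H1 * H2 * (X0 ^+ (n + r3) * Y1 ^+ (k + s3)) =
         (G * X2 ^+ k * (X0 ^+ (r1 + r2) * Y1 ^+ (s1 + s2))) * w.
  apply/eqP; rewrite -subr_eq0; apply/eqP.
  have XY : X0 * Y1 != 0 by rewrite mulf_neq0.
  apply: (bipoly_eq0_dense XY) => a b.
  rewrite evM mulf_eq0 negb_or => /andP[x0 y1].
  apply/eqP; rewrite evB subr_eq0; apply/eqP.
  rewrite !evM !evX l1 // l2 // l3 //.
  have eg' := congr1 (ev3 (ev Y0 a b / ev Y1 a b) (ev X2 a b / ev X0 a b)
     (ev X1 a b / ev X0 a b)) eg.
  rewrite !ev3M in eg'.
  have ef := ev_pencil_param x0 y1.
  transitivity (ev X0 a b ^+ r1 * ev Y1 a b ^+ s1 * (ev X0 a b ^+ r2 * ev Y1 a b ^+ s2) *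
    (ev X0 a b ^+ (n + r3) * ev Y1 a b ^+ (k + s3)) *
    (ev3 (ev Y0 a b / ev Y1 a b) (ev X2 a b / ev X0 a b) (ev X1 a b / ev X0 a b) h1 *
     ev3 (ev Y0 a b / ev Y1 a b) (ev X2 a b / ev X0 a b) (ev X1 a b / ev X0 a b) h2)).
    ring.
  rewrite eg'.
  transitivity (ev X0 a b ^+ r3 * ev Y1 a b ^+ s3 *
    ev3 (ev Y0 a b / ev Y1 a b) (ev X2 a b / ev X0 a b) (ev X1 a b / ev X0 a b) g *
    (ev X0 a b ^+ (r1 + r2) * ev Y1 a b ^+ (s1 + s2)) *
    (ev X2 a b ^+ k * ev w a b)); last by ring.
  rewrite ef !exprD; ring.
have wdiv H h s : pencil H = varU C ^+ s * h -> divides w H -> divides f h.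
  move=> eH [c ec]; apply: (@divides_varU_cancel s); rewrite -eH ec.
  by exists (pencil c); rewrite [LHS]rmorphM.
have [|hd] : divides w (H1 * H2) \/ divides w (X0 ^+ (n + r3) * Y1 ^+ (k + s3)).
- by apply: (pwp); rewrite E; exact: divides_mull.
- case/(pwp) => hw'; [left|right].
    exact: wdiv (pencil_lift_back l1) hw'.
  exact: wdiv (pencil_lift_back l2) hw'.
(* The powers of [X0] and [Y1] are harmless: [X0] and [Y1] restrict to 1 and [u], of degree 0 in
   [z], whereas [f] has degree [n > 0]. *)
- have no p : (size (pencil p) <= 1)%N -> pencil p != 0 -> ~ divides w p.
    move=> sp p0 [c ec]; apply: (not_divides_pencil p0 sp).
    by exists (pencil c); rewrite ec [LHS]rmorphM.
  case: (pwp _ _ hd) => /(prime_elt_exp pw) hd'; exfalso; move: hd'; apply: no.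
  + by rewrite pX0 size_poly1.
  + by rewrite pX0 oner_neq0.
  + by rewrite pY1 /varU size_polyC_leq1.
  + by rewrite pY1 varU_neq0.
Qed.

End Pencil.

(** * Transversal points *)

Section Slope.
Variable C : numClosedFieldType.
Implicit Types (w : biring C) (x y v : 'I_3 -> C).

Lemma ev_collinear e k w x y : bihomogeneous e k w ->
  shear_invariant w -> (0 < k)%N -> collinear x y -> ev w x y = 0.
Proof.
move=> hw sw k0 [c hc].
have -> : ev w x y = ev w x (fun i => 0 * y i + c * x i).
  by apply: ev_ext => // i; rewrite hc mul0r add0r.
by rewrite sw (bihom_evr _ _ _ hw) expr0n eqn0Ngt k0 mul0r.
Qed.

Lemma coef1_deriv (R : nzRingType) (p : {poly R}) : p`_1 = p^`().[0].
Proof. by rewrite horner_coef0 coef_deriv mulr1n. Qed.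

Lemma coef1_comp_scale (p : {poly C}) c : (p \Po (c *: 'X))`_1 = c * p`_1.
Proof.
rewrite !coef1_deriv deriv_comp hornerM horner_comp derivZ derivX alg_polyC hornerC.
by rewrite hornerZ hornerX mulr0 mulrC.
Qed.

Definition line_ring w : {poly biring C} :=
  bieval (polyC \o @bC C) (fun i => (bX C i)%:P + (bY C i)%:P * 'X)
    (fun i => (bY C i)%:P) w.

(* The derivative of [w] along [\sum_i Y_i d/dX_i]. *)
Definition slope w : biring C := (line_ring w)`_1.

Lemma slopeE w x y : ev (slope w) x y = (line_poly w x y)`_1.
Proof.
suff -> : line_poly w x y = map_poly (bieval idfun x y) (line_ring w) by rewrite coef_map.
apply/esym; apply: (rmorph_bieval (g := map_poly (bieval idfun x y))
  (h := polyC \o @bC C) (h' := polyC \o idfun)) => [c|h|h].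
- by rewrite /= map_polyC /= [X in X%:P](evC c x y).
- rewrite /= rmorphD rmorphM /= !map_polyC /= map_polyX.
  congr (_%:P + _%:P * 'X); [exact: bievalX|exact: bievalY].
- by rewrite /= map_polyC /= [X in X%:P](bievalY _ _ _ h).
Qed.

Variables (w : biring C) (n k : nat).
Hypotheses (hw : bihomogeneous n k w) (sw : shear_invariant w).

Lemma slope_scaler x y s : ev (slope w) x (fun i => s * y i) = s ^+ k.+1 * ev (slope w) x y.
Proof.
rewrite !slopeE; have -> : line_poly w x (fun i => s * y i) =
    s ^+ k *: (line_poly w x y \Po (s *: 'X)).
  apply: poly_eq_horner => t; rewrite hornerZ horner_comp !hornerE !line_polyE.
  rewrite (bihom_evr _ _ _ hw); congr (_ * _); apply: ev_ext => // i; ring.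
by rewrite coefZ coef1_comp_scale mulrA exprSr.
Qed.

Lemma slope_scalel x y s : s != 0 ->
  s * ev (slope w) (fun i => s * x i) y = s ^+ n * ev (slope w) x y.
Proof.
move=> s0; rewrite !slopeE; have -> : line_poly w (fun i => s * x i) y =
    s ^+ n *: (line_poly w x y \Po (s^-1 *: 'X)).
  apply: poly_eq_horner => t; rewrite hornerZ horner_comp !hornerE !line_polyE.
  rewrite -(bihom_evl _ _ _ hw); apply: ev_ext => // i; by field.
by rewrite coefZ coef1_comp_scale mulrCA mulVKf.
Qed.

(** Moving the center from [v] to [v + t x] replaces the parameter [s] of the line by
    [s / (1 + t s)] and multiplies the value by [(1 + t s)^(n - k)], which clears the
    denominators. *)
Lemma line_poly_shear x v t : (k <= n)%N ->
  line_poly w x (fun i => v i + t * x i) =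
  \sum_(j < (n - k).+1) (line_poly w x v)`_j *: ('X^j * (1 + t *: 'X) ^+ (n - k - j)).
Proof.
move=> kn; pose q : {poly C} := 1 + t *: 'X.
have q0 : q != 0.
  apply/eqP => /(congr1 (fun p : {poly C} => p.[0])).
  rewrite /q hornerD hornerZ hornerX mulr0 -polyC1 !hornerC addr0 => /eqP.
  by rewrite oner_eq0.
apply/eqP; rewrite -subr_eq0; apply/eqP; apply: (poly_eq0_dense q0) => s.
have -> : q.[s] = 1 + t * s by rewrite /q hornerD hornerZ hornerX -polyC1 hornerC.
move=> a0; set a := 1 + t * s in a0 *.
rewrite hornerD hornerN line_polyE horner_sum; apply/eqP; rewrite subr_eq0; apply/eqP.
transitivity (a ^+ (n - k) * (line_poly w x v).[s / a]).
  rewrite line_polyE -[(n - k)%N]/((n - k)%N); apply: (mulfI (expf_neq0 k a0)).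
  rewrite mulrA -exprD subnKC // -(bihom_evl _ _ _ hw) -(bihom_evr _ _ _ hw).
  rewrite -[RHS](sw _ _ t); apply: ev_ext => i; rewrite /a; first by field.
  by field.
rewrite (horner_coef_wide _ (line_poly_size_sub x v hw sw)) mulr_sumr.
apply: eq_bigr => j _; rewrite hornerZ hornerM !horner_exp hornerX hornerD hornerZ hornerX -polyC1 hornerC -/a.
have jn : (j <= n - k)%N by rewrite -ltnS.
rewrite exprMn exprVn -{1}(subnK jn) exprD.
by have := expf_neq0 j a0; move: (a ^+ j) (a ^+ (n - k - j)) => A B A0; field.
Qed.

(** Vanishing to order two at parameter 0 survives the change of parameter in [line_poly_shear].
    This is the invariance that [coprime_generic] demands. *)
Lemma slope_shear x v t : (k <= n)%N -> ev w x v = 0 -> ev (slope w) x v = 0 ->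
  ev (slope w) x (fun i => v i + t * x i) = 0.
Proof.
move=> kn w0; rewrite !slopeE => s0.
have c0 : (line_poly w x v)`_0 = 0.
  rewrite -horner_coef0 line_polyE -[RHS]w0.
  by apply: ev_ext => // i; rewrite mul0r addr0.
rewrite line_poly_shear // coef_sum big1 // => -[[|[|j]] jn] _ /=.
- by rewrite c0 scale0r coef0.
- by rewrite s0 scale0r coef0.
- by rewrite coefZ coefXnM mulr0.
Qed.

Lemma line_poly_translate x y s :
  line_poly w (fun i => x i + s * y i) y = line_poly w x y \Po ('X + s%:P).
Proof.
apply: poly_eq_horner => t; rewrite horner_comp !hornerE !line_polyE.
by apply: ev_ext => // i; ring.
Qed.

(** If the slope vanishes, w(x + t y; y) does not depend on [t], and [flip] gives t^k w(x; y) =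
    (-1)^k t^n w(y; x) for nonzero [t]. The values 1 and 2 of [t] then contradict [k < n] unless [w]
    is zero. *)
Lemma slope_neq0 : w != 0 -> (k < n)%N -> slope w != 0.
Proof.
move=> w0 kn; apply: contraNneq w0 => s0; apply/eqP.
have lc x y t : (line_poly w x y).[t] = ev w x y.
  have -> : line_poly w x y = ((line_poly w x y)`_0)%:P.
    have d0 : (line_poly w x y)^`() = 0.
      apply: poly_eq_horner => s; rewrite horner0.
      have := slopeE w (fun i => x i + s * y i) y.
      rewrite s0 [X in X = _]rmorph0 line_poly_translate coef1_deriv.
      rewrite deriv_comp derivD derivX derivC addr0 mulr1 horner_comp.
      by rewrite hornerD hornerX hornerC add0r.
    apply/polyP => -[|m]; rewrite coefC //=.
    have := congr1 (fun p : {poly C} => p`_m) d0; rewrite coef_deriv coef0.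
    by move/eqP; rewrite mulrn_eq0 /= => /eqP.
  rewrite hornerC -horner_coef0 line_polyE.
  by apply: ev_ext => // i; rewrite mul0r addr0.
apply: bipoly_eq0 => x y.
have key t : t != 0 -> t ^+ k * ev w x y = t ^+ n * ((-1) ^+ k * ev w y x).
  move=> t0; rewrite -[ev w x y](lc x y t) line_polyE (flip _ _ _ hw sw).
  rewrite [RHS]mulrCA; congr (_ * _).
  rewrite -[ev w y x](lc y x t^-1) line_polyE -(bihom_evl _ _ _ hw).
  by apply: ev_ext => // i; field.
have k1 := key 1 (oner_neq0 _); rewrite !expr1n !mul1r in k1.
have := key 2 _; rewrite -k1 => /(_ _) k2.
have {}k2 : 2 ^+ k * ev w x y = 2 ^+ n * ev w x y :> C by apply: k2; rewrite pnatr_eq0.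
have /eqP : (2 ^+ n - 2 ^+ k) * ev w x y = 0 :> C by rewrite mulrBl k2 subrr.
rewrite mulf_eq0 => /orP[|/eqP //].
by rewrite subr_eq0 -!natrX eqr_nat eqn_exp2l // gtn_eqF.
Qed.

(** The slope is nonzero of degree [n - 1] in [x], too small for a multiple of [w]. *)
Lemma slope_ndivides : w != 0 -> (k < n)%N -> ~ divides w (slope w).
Proof.
move=> w0 kn [c ec]; have /eqP[] := slope_neq0 w0 kn.
apply: bipoly_eq0 => x y.
pose q : {poly C} := bieval polyC (fun i => (x i)%:P * 'X) (fun i => (y i)%:P) c.
have qE s : q.[s] = ev c (fun i => s * x i) y.
  rewrite /q -[LHS]/(horner_eval s _).
  apply: (rmorph_bieval (g := horner_eval s)) => [a|h|h]; rewrite /= /horner_eval ?hornerC //.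
  by rewrite hornerM hornerC hornerX mulrC.
have : 'X * q * (ev w x y)%:P - (ev (slope w) x y)%:P = 0.
  apply: (poly_eq0_dense (q := 'X)); first by rewrite polyX_eq0.
  move=> s; rewrite hornerX => s0; rewrite !hornerE qE.
  apply/eqP; rewrite subr_eq0; apply/eqP; apply: (mulfI (expf_neq0 n s0)).
  rewrite -(slope_scalel _ _ s0) ec evM (bihom_evl _ _ _ hw); ring.
move/(congr1 (fun p : {poly C} => p.[0])); rewrite !hornerE => /eqP.
by rewrite oppr_eq0 => /eqP.
Qed.

(** At a general [x], a zero [u] of w(x; .) other than [x] has nonzero slope, because [w] and its
    slope have no further common zero there. Adding a multiple of [x] to [u] preserves this and
    makes w(v; x) nonzero. *)
Lemma transversal_point (g : {mpoly C[3]}) : prime_elt w -> (0 < k < n)%N -> g != 0 ->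
  exists x v (i j l : 'I_3), [/\ g.@[x] != 0, ev w x v = 0,
    (line_poly w x v)`_1 != 0 & ev w v x != 0] /\
    [/\ minor x v i j != 0, l != i, l != j & forall h, [|| h == i, h == j | h == l]].
Proof.
move=> pw /andP[k0 kn] g0; have kn' := ltnW kn.
have w0 : w != 0 by case: pw.
have [r [r0 hr]] : exists r : {mpoly C[3]}, r != 0 /\ forall x y, nonzero x ->
    r.@[x] != 0 -> ev w x y = 0 -> ev (slope w) x y = 0 -> collinear x y.
  apply: (coprime_generic pw (slope_ndivides w0 kn)) => x y s t wxy sxy.
  have sw0 : ev w x (fun i => s * y i) = 0 by rewrite (bihom_evr _ _ _ hw) wxy mulr0.
  rewrite sw; split=> //; apply: slope_shear => //.
  by rewrite slope_scaler sxy mulr0.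
have [m hm] : exists m, w@_m != 0.
  apply: contrapT => nm; move/eqP: w0; apply; apply/mpolyP => m; rewrite mcoeff0.
  by apply: contrapT => hm; apply: nm; exists m; apply/eqP.
have [x [x0]] := nonzero_nonroot (mulf_neq0 (mulf_neq0 g0 r0) hm).
rewrite !mevalM !mulf_eq0 !negb_or -andbA => /and3P[gx rx mx].
have ax : at_point w x != 0.
  apply: contraNneq mx => ax; have := congr1 (fun p => p@_m) ax.
  by rewrite /at_point mcoeff_map_mpoly mcoeff0 => ->.
have ah : at_point w x \is k.-homog.
  apply/dhomogP => m'; rewrite mcoeff_msupp /at_point mcoeff_map_mpoly => mw.
  case: hw => /dhomogP wk _; apply: wk; rewrite mcoeff_msupp.
  by apply: contraNneq mw => -> /=; rewrite meval0.
have [y cy|u [u0 cu]] := off_center_zero k0 ah _ ax x0.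
  by rewrite -evE (ev_collinear hw sw k0 cy).
rewrite -evE in u0.
have d0 : (line_poly w x u)`_1 != 0.
  by apply/eqP => h; apply: cu; apply: hr => //; rewrite slopeE.
(* With [v = s^-1 (x + s u)], [flip] expresses w(v; x) through w(x + s u; u), which is nonzero for
   this [s]. *)
have [s] : exists s, ('X * line_poly w x u).[s] != 0.
  apply: poly_nonroot; rewrite mulf_neq0 ?polyX_eq0 //.
  by apply: contraNneq d0 => ->; rewrite coef0.
rewrite hornerM hornerX mulf_eq0 negb_or line_polyE => /andP[s0 ls].
pose v i := u i + s^-1 * x i.
have cv : ~ collinear x v.
  move=> [c hc]; apply: cu; exists (c - s^-1) => i.
  by rewrite mulrBl -hc /v addrK.
have [i [j mij]] := not_collinear_minor x0 cv.
have ij : i != j.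
  by apply: contraNneq mij => ->; rewrite /minor mulrC subrr.
have [l [li lj ijl]] := ord3_third ij.
exists x, v, i, j, l; split=> //; split=> //.
- by rewrite /v sw.
- rewrite -slopeE; apply: contraNneq d0 => sv; rewrite -slopeE.
  have -> : ev (slope w) x u = ev (slope w) x (fun i => v i + (- s^-1) * x i).
    by apply: ev_ext => // h; rewrite /v mulNr addrK.
  by apply/eqP/slope_shear; rewrite /v // sw.
- have -> : ev w v x = s^-1 ^+ n * ev w (fun i => x i + s * u i) x.
    by rewrite -(bihom_evl _ _ _ hw); apply: ev_ext => // h; rewrite /v; field.
  rewrite mulf_neq0 ?expf_neq0 ?invr_eq0 //.
  have := flip x u s hw sw; apply: contra_eqN => /eqP ->.
  by rewrite mulr0 mulf_neq0 ?expf_neq0.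
Qed.

End Slope.

(** * Irreducibility of a generic section *)

Section Box.
Variables (R : comNzRingType) (n : nat).
Implicit Types (p : {poly {poly R}}) (A : 'I_n * 'I_n -> R) (phi : {poly R}).

(** Polynomials of degree less than [n] in each variable, as coefficient vectors: vanishing on a
    branch becomes a linear system. *)
Definition box_poly A : {poly {poly R}} :=
  \sum_p (A p *: 'X^(p.1))%:P * 'X^(p.2).

Lemma coef_box_poly A a b :
  ((box_poly A)`_b)`_a = \sum_p A p * ((a == p.1) && (b == p.2))%:R.
Proof.
rewrite /box_poly !coef_sum; apply: eq_bigr => p _.
rewrite coefCM coefXn mulr_natr coefMn coefZ coefXn -mulnb natrM mulrA.
by rewrite !mulr_natr.
Qed.

Lemma coef_box_polyE A (a b : 'I_n) : ((box_poly A)`_b)`_a = A (a, b).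
Proof.
rewrite coef_box_poly (bigD1 (a, b)) //= !eqxx mulr1 big1 ?addr0 // => p pab.
case: p pab => i j; rewrite xpair_eqE -!val_eqE /= => pab.
by rewrite [a == _ :> nat]eq_sym [b == _ :> nat]eq_sym (negPf pab) mulr0.
Qed.

Lemma size_box_poly A : (size (box_poly A) <= n)%N.
Proof.
apply/leq_sizeP => b nb; apply/polyP => a; rewrite coef_box_poly coef0 big1 // => p _.
by rewrite [b == _]gtn_eqF ?andbF ?mulr0 // (leq_trans _ nb).
Qed.

Lemma coef_size_box_poly A b : (size ((box_poly A)`_b)%R <= n)%N.
Proof.
apply/leq_sizeP => a na; rewrite coef_box_poly big1 // => p _.
by rewrite [a == _]gtn_eqF ?mulr0 // (leq_trans _ na).
Qed.

Lemma horner_box_poly A phi :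
  (box_poly A).[phi] = \sum_p A p *: ('X^(p.1) * phi ^+ p.2).
Proof.
rewrite /box_poly horner_sum; apply: eq_bigr => p _.
by rewrite hornerM hornerC hornerXn scalerAl.
Qed.

Lemma box_polyK p : (size p <= n)%N -> (forall b, (size (p`_b)%R <= n)%N) ->
  p = box_poly (fun ab => (p`_ab.2)`_ab.1).
Proof.
move=> sp scp; apply/polyP => b; apply/polyP => a.
have [an|an] := ltnP a n; last first.
  rewrite (nth_default _ (leq_trans (scp b) an)).
  by rewrite (nth_default _ (leq_trans (coef_size_box_poly _ _) an)).
have [bn|bn] := ltnP b n; last first.
  rewrite [p`_b](nth_default _ (leq_trans sp bn)).
  by rewrite [(box_poly _)`_b](nth_default _ (leq_trans (size_box_poly _) bn)).
exact/esym/(coef_box_polyE _ (Ordinal an) (Ordinal bn)).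
Qed.

End Box.

Lemma divides_Xn_mul_unit (F : fieldType) (a b : {poly F}) N :
  divides 'X^N (a * b) -> b.[0] != 0 -> divides 'X^N a.
Proof.
move=> [c ec] b0; apply/Pdiv.Field.dvdpP.
have co : Pdiv.Idomain.coprimep ('X^N) b.
  apply: Pdiv.Field.coprimep_expl; rewrite Pdiv.Field.coprimep_sym.
  by rewrite -['X]subr0 -polyC0 Pdiv.Field.coprimep_XsubC.
by rewrite -(Pdiv.Field.Gauss_dvdpl a co); apply/Pdiv.Field.dvdpP; exists c.
Qed.

Lemma branch_factor (F : fieldType) (p q : {poly {poly F}}) (phi : {poly F}) N :
  divides 'X^N (p * q).[phi] -> phi.[0] = 0 ->
  q.[0].[0] != 0 -> divides 'X^N p.[phi].
Proof.
rewrite hornerM => h phi0 q0; apply: (divides_Xn_mul_unit h).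
have e (a : {poly F}) : q.[a].[0] = (map_poly (horner_eval 0) q).[a.[0]].
  by have := horner_map (horner_eval 0) q a; rewrite /= /horner_eval => ->.
by rewrite e phi0 -[X in _.[X]](horner0 0) -e.
Qed.

Section Bertini.
Variables (C : numClosedFieldType) (w : biring C) (n k : nat).
Variables (x v : 'I_3 -> C) (i j l : 'I_3).
Hypotheses (pw : prime_elt w) (hw : bihomogeneous n k w) (sw : shear_invariant w).
Hypotheses (k0 : (0 < k)%N) (kn : (k <= n)%N).
Hypotheses (m0 : minor x v i j != 0) (li : l != i) (lj : l != j)
  (ijl : forall h, [|| h == i, h == j | h == l]).
Hypotheses (xv0 : ev w x v = 0) (delta0 : (line_poly w x v)`_1 != 0)
  (vx0 : ev w v x != 0).

Let delta := (line_poly w x v)`_1.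
Let e := unit_vec C l.
Let f := pencil x v l w.

Let sp1 (t : C) : {poly {poly C}} -> {poly C} := map_poly (horner_eval t).
Let sp2 (t : C) : {poly {poly {poly C}}} -> {poly {poly C}} := map_poly (sp1 t).

Let plane (h : 'I_3) : {poly {poly C}} :=
  ((x h)%:P + (e h)%:P * 'X)%:P + ((v h)%:P)%:P * 'X.

Let on_plane : {mpoly C[3]} -> {poly {poly C}} := mmap (polyC \o polyC) plane.

Lemma on_planeE z u (g : {mpoly C[3]}) :
  (on_plane g).[z%:P].[u] = g.@[fun h => x h + u * e h + z * v h].
Proof.
rewrite -[LHS]/((horner_eval u \o horner_eval z%:P) (on_plane g)).
apply: (rmorph_mmap (g := horner_eval u \o horner_eval z%:P)) => [c|h].
  by rewrite /= /horner_eval !hornerC.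
rewrite /= /horner_eval /plane !(hornerD, hornerM, hornerC, hornerX).
by rewrite [e h * u]mulrC [v h * z]mulrC.
Qed.

Lemma sp1_horner t u (p : ring2 C) : (sp1 t p).[u] = ev2 t u p.
Proof.
rewrite /sp1 -[u in LHS](hornerC u t).
exact: (horner_map (horner_eval t) p (u%:P)).
Qed.

Lemma sp2_horner t (a : ring2 C) (p : ring3 C) : (sp2 t p).[sp1 t a] = sp1 t p.[a].
Proof. exact: (horner_map (map_poly (horner_eval t)) p a). Qed.

Lemma sp1C t (c : ring1 C) : sp1 t c%:P = c.[t]%:P.
Proof. exact: map_polyC. Qed.

Lemma sp2E t z u (p : ring3 C) : (sp2 t p).[z%:P].[u] = ev3 t u z p.
Proof.
have -> : z%:P = sp1 t ((z%:P)%:P) by rewrite sp1C hornerC.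
by rewrite sp2_horner sp1_horner.
Qed.

Lemma poly2_ext (p q : {poly {poly C}}) :
  (forall z u, p.[z%:P].[u] = q.[z%:P].[u]) -> p = q.
Proof.
move=> h; apply/polyP => m; apply: poly_eq_horner => u.
have E : map_poly (horner_eval u) p = map_poly (horner_eval u) q.
  apply: poly_eq_horner => z; rewrite -[z in LHS](hornerC z u) -[z in RHS](hornerC z u).
  have hm (r : {poly {poly C}}) : (map_poly (horner_eval u) r).[(z%:P).[u]] = r.[z%:P].[u].
    exact: (horner_map (horner_eval u) r (z%:P)).
  by rewrite !hm.
by have := congr1 (fun r : {poly C} => r`_m) E; rewrite !coef_map.
Qed.

Lemma sp2_factor t (g1 g2 : {mpoly C[3]}) :
  (forall X, ev w X (fun h => v h + t * x h) = g1.@[X] * g2.@[X]) ->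
  sp2 t f = on_plane g1 * on_plane g2.
Proof.
move=> hg; apply: poly2_ext => z u.
by rewrite !hornerM !on_planeE -hg sp2E /f pencilE.
Qed.

Lemma sp2_f0 t : (sp2 t f).[0].[0] = 0.
Proof.
have -> : (0 : {poly C}) = sp1 t 0 by rewrite /sp1 raddf0.
rewrite sp2_horner sp1_horner.
rewrite /ev2 /horner_eval raddf0 (pencil_f0 l hw sw xv0); exact: rmorph0.
Qed.

Lemma sp2_df t : (sp2 t f)^`().[0].[0] = delta.
Proof.
rewrite /sp2 deriv_map -/(sp2 t).
have -> : (0 : {poly C}) = sp1 t 0 by rewrite /sp1 raddf0.
rewrite sp2_horner sp1_horner.
rewrite /ev2 /horner_eval raddf0 (pencil_df l hw sw xv0 erefl).
exact: ev1_cst.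
Qed.

Lemma on_plane_size m g : g \is m.-homog ->
  (size (on_plane g) <= m.+1)%N /\ coef_size_le m (on_plane g).
Proof.
move=> hg; split.
  have [] := has_top_mmap (T := {poly C}) (R := C) polyC
    (fun h => (x h)%:P + (e h)%:P * 'X) (fun h => (v h)%:P) hg; by [].
apply: (@coef_size_le_mmap C C 3 m (polyC \o polyC)) hg => [c|h].
  exact: coef_size_leC.
apply: coef_size_leD.
  move=> s; rewrite coefC; case: (s == 0%N); last by rewrite size_poly0.
  rewrite (leq_trans (size_polyD _ _)) // geq_max.
  rewrite (leq_trans (size_polyC_leq1 _)) //= (leq_trans (size_polyMleq _ _)) //.
  by rewrite size_polyX addn2 /= ltnS size_polyC_leq1.
rewrite -[1%N]addn0 addnC; apply: coef_size_leM; first exact: coef_size_leC.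
by move=> s; rewrite coefX; case: (s == 1%N); rewrite ?size_poly1 ?size_poly0.
Qed.

(* If the section of center [v + t x] splits, the factor through the point [x]
   of the plane vanishes on the branch [phi] to high order. *)
Lemma split_kernel t (phi : ring2 C) N e1 e2 (g1 g2 : {mpoly C[3]}) :
  phi.[0] = 0 -> divides 'X^N f.[phi] ->
  (0 < e1)%N -> (0 < e2)%N -> (e1 + e2)%N = n -> g1 \is e1.-homog -> g2 \is e2.-homog ->
  (forall X, ev w X (fun h => v h + t * x h) = g1.@[X] * g2.@[X]) ->
  exists a : 'I_n * 'I_n -> C, (exists p, a p != 0) /\
    divides 'X^N (box_poly a).[sp1 t phi].
Proof.
move=> phi0 [b hb] e10 e20 en h1 h2 hg.
have ef := sp2_factor hg.
have tphi0 : (sp1 t phi).[0] = 0.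
  rewrite sp1_horner /ev2 /horner_eval raddf0 phi0; exact: rmorph0.
have dphi : divides 'X^N (sp2 t f).[sp1 t phi].
  exists (sp1 t b); rewrite sp2_horner hb /sp1 rmorphM rmorphXn /=.
  by rewrite map_polyX.
have f00 := sp2_f0 t; have fd := sp2_df t.
rewrite ef in f00 fd dphi.
(* The cofactor of [g1'] is a unit near the origin, so [g1'] inherits the vanishing on the branch;
   its degree is below [n], so it fits in the box. *)
have step (e1' e2' : nat) (g1' g2' : {mpoly C[3]}) : (0 < e2')%N -> (e1' + e2')%N = n ->
    g1' \is e1'.-homog -> on_plane g1' != 0 ->
    divides 'X^N (on_plane g1' * on_plane g2').[sp1 t phi] ->
    (on_plane g2').[0].[0] != 0 ->
    exists a : 'I_n * 'I_n -> C, (exists p, a p != 0) /\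
      divides 'X^N (box_poly a).[sp1 t phi].
  move=> e20' en' h1' p10 dv g20.
  have [s1 s2] := on_plane_size h1'.
  have e1n : (e1'.+1 <= n)%N by rewrite -en' -addn1 leq_add2l.
  have bK := box_polyK (leq_trans s1 e1n) (fun b' => leq_trans (s2 b') e1n).
  exists (fun ab : 'I_n * 'I_n => ((on_plane g1')`_ab.2)`_ab.1); split; last first.
    by rewrite -bK; exact: branch_factor dv tphi0 g20.
  apply: contrapT => na; move/eqP: p10; apply; rewrite bK /box_poly big1 // => p _.
  have -> : ((on_plane g1')`_p.2)`_p.1 = 0.
    by apply/eqP; apply: contrapT => h; apply: na; exists p; apply/negP.
  by rewrite scale0r polyC0 mul0r.
(* By the product rule the two factors cannot both vanish at the origin, as [delta] is nonzero. *)
have dsum : (on_plane g1)^`().[0].[0] * (on_plane g2).[0].[0] +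
    (on_plane g1).[0].[0] * (on_plane g2)^`().[0].[0] = delta.
  by rewrite -fd derivM !hornerE.
have p10 : on_plane g1 != 0.
  apply: contraNneq delta0 => p0; rewrite -/delta -dsum p0.
  by rewrite linear0 !horner0 !mul0r addr0.
have p20 : on_plane g2 != 0.
  apply: contraNneq delta0 => p0; rewrite -/delta -dsum p0.
  by rewrite linear0 !horner0 !mulr0 addr0.
have [g20|g20] := eqVneq (on_plane g2).[0].[0] 0.
- apply: (step e2 e1 g2 g1) => //; first by rewrite addnC.
    by rewrite mulrC.
  apply: contraNneq delta0 => g10.
  by rewrite -/delta -dsum g20 g10 mulr0 mul0r addr0.
- exact: (step e1 e2 g1 g2).
Qed.

Lemma split_center_vanish (g : {mpoly C[3]}) m : g \is m.-homog ->
  (forall y, nonzero y -> g.@[y] != 0 -> exists (e1 e2 : nat) (g1 g2 : {mpoly C[3]}),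
     [/\ (0 < e1)%N, (0 < e2)%N, (e1 + e2)%N = n & [/\ g1 \is e1.-homog,
      g2 \is e2.-homog & forall X, ev w X y = g1.@[X] * g2.@[X]]]) ->
  g.@[x] = 0.
Proof.
move=> hg hred; apply/eqP; apply: contrapT => /negP gx.
(* One more than the bound of [size_resultant_bound] on the degree in [u] of the resultant of [f]
   and [G]. *)
pose N := ((n + n) * n).+1.
have du : divides (cst1 delta) 1.
  have dd : delta^-1 * delta = 1 by rewrite mulVf.
  by exists (cst1 delta^-1); rewrite -[RHS](rmorphM (@cst1 C)) dd [RHS](rmorph1 (@cst1 C)).
have [phi [phi0 hphi]] := hensel_branch N (pencil_f0 l hw sw xv0)
  (pencil_df l hw sw xv0 erefl) du.
pose M (p : 'I_n * 'I_n) (s : 'I_N) : {poly C} := ('X^(p.1) * phi ^+ p.2)`_s.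
(* The values of [t] whose center lies on [g = 0]; the top coefficient of [bad] is g(x), nonzero by
   assumption. *)
pose bad : {poly C} := mmap (polyC \o idfun) (fun h => (v h)%:P + (x h)%:P * 'X) g.
have badE t : bad.[t] = g.@[fun h => v h + t * x h].
  rewrite -[LHS]/(horner_eval t bad).
  apply: (rmorph_mmap (g := horner_eval t)) => [c|h]; rewrite /= /horner_eval.
    by rewrite hornerC.
  by rewrite hornerD hornerM !hornerC hornerX [t * _]mulrC.
have bad0 : bad != 0.
  have [_ bt] := has_top_mmap (T := C) (R := C) idfun v x hg.
  apply: contraNneq gx => b0; move: bt; rewrite -/bad b0 coef0 => e0.
  by apply/eqP; rewrite [RHS]e0.
have hM t : bad.[t] != 0 -> exists b : 'I_n * 'I_n -> C,
    (exists p, b p != 0) /\ forall s : 'I_N, \sum_p b p * (M p s).[t] = 0.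
  rewrite badE => gt.
  have y0 : nonzero (fun h => v h + t * x h).
    apply: contrapT => ny; move/eqP: m0; apply.
    have yh h : v h = - (t * x h).
      apply/eqP; rewrite -addr_eq0; apply/negPn/negP => h0; apply: ny; by exists h.
    by rewrite /minor !yh; ring.
  have [e1 [e2 [g1 [g2 [e10 e20 en [h1 h2 hE]]]]]] := hred _ y0 gt.
  have [b [b0 hb]] := split_kernel phi0 hphi e10 e20 en h1 h2 hE.
  exists b; split=> // s.
  have := divides_Xn_coef hb (ltn_ord s).
  rewrite horner_box_poly coef_sum => hs; rewrite -[RHS]hs; apply: eq_bigr => p _.
  rewrite coefZ; congr (_ * _); rewrite /M.
  have -> : 'X^(p.1) * sp1 t phi ^+ p.2 = sp1 t ('X^(p.1) * phi ^+ p.2).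
    by rewrite /sp1 rmorphM !rmorphXn /= map_polyX.
  by rewrite /sp1 coef_map.
have [A [[p0 Ap0] hA]] := kernel_specialization bad0 hM.
pose G : ring3 C := box_poly A.
have G0 : G != 0.
  apply: contraNneq Ap0 => G0.
  by rewrite [p0]surjective_pairing -coef_box_polyE -/G G0 !coef0.
have sG : (size G <= n)%N := size_box_poly A.
have scG b : (size (G`_b)%R <= n)%N := coef_size_box_poly A b.
have dG : divides 'X^N G.[phi].
  apply: divides_Xn => s sN; rewrite /G horner_box_poly coef_sum.
  rewrite -[RHS](hA (Ordinal sN)); apply: eq_bigr => p _.
  by rewrite coefZ.
have sf : size f = n.+1 := size_pencil l hw sw vx0.
have n0 : (0 < n)%N := leq_trans k0 kn.
have pf : prime_elt f := prime_pencil pw hw sw k0 kn m0 li lj ijl xv0 erefl delta0 vx0.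
have nfG : ~ divides f G.
  move=> [r er]; have f0 : f != 0 by rewrite -size_poly_gt0 sf.
  have r0 : r != 0 by apply: contraNneq G0 => r0; rewrite er r0 mul0r.
  have := size_mul r0 f0; rewrite -er sf.
  by rewrite -size_poly_gt0 in r0; move: sG r0; lia.
(* If [G] does not involve [z] there is no resultant to take, but [G] itself is divisible by [u^N]
   and has degree less than [n] in [u]. *)
have [sG1|sG1] := leqP (size G) 1.
  have eG := size1_polyC sG1.
  have c0 : G`_0 = 0.
    apply: (@poly_mulXn_small _ _ N); first by move: dG; rewrite {1}eG hornerC.
    by apply: (leq_trans (scG 0%N)); rewrite /N; nia.
  by move/eqP: G0; apply; rewrite eG c0.
have sf1 : (1 < size f)%N by rewrite sf.
have /eqP[] := prime_resultant_neq0 pf nfG sf1.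
apply: (@poly_mulXn_small _ _ N).
  (* The resultant lies in the ideal of [f] and [G], both of order at least [N] on the branch, and
     is unchanged by substituting [phi] for [z]. *)
  have [[r s] _ /= ers] := resultant_in_ideal sf1 sG1.
  have := congr1 (horner^~ phi) ers; rewrite hornerC => ->.
  rewrite hornerD !hornerM.
  by apply: dividesD; apply: dividesMl.
apply: (@size_resultant_bound (ring1 C)).
- by rewrite sf.
- exact: leqW.
- exact: (pencil_coef_size x v l hw).
- by move=> b; apply: leqW.
Qed.

End Bertini.

(** * Webs *)

Lemma meval_constants m n (R : comNzRingType) (w : {mpoly {mpoly R[n]}[m]}) p x :
  (w.@[fun i => (p i)%:MP]).@[x] = mmap (meval x) p w.
Proof.
elim/mpoly_alg_ind: w => [c|i|u v IHu IHv|u v IHu IHv].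
- by rewrite mevalC mmapC.
- by rewrite mevalXU mevalC mmapX mmap1U.
- by rewrite mevalD mevalD mmapD; exact: congr2 IHu IHv.
- by rewrite mevalM mevalM rmorphM; exact: congr2 IHu IHv.
Qed.

Lemma bihom_ev_scale (C : numClosedFieldType) (w : biring C) e k :
  (forall x y t, ev w (fun i => t * x i) y = t ^+ e * ev w x y) ->
  (forall x y t, ev w x (fun i => t * y i) = t ^+ k * ev w x y) ->
  bihomogeneous e k w.
Proof.
have ext (p q : {poly biring C}) :
    (forall x y t, (map_poly (bieval idfun x y) p).[t] = (map_poly (bieval idfun x y) q).[t]) ->
    p = q.
  move=> h; apply/polyP => i; apply: biring_ext => x y.
  have E := poly_eq_horner (h x y).
  by have := congr1 (fun r : {poly C} => r`_i) E; rewrite !coef_map.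
move=> hx hy; split.
  apply/(@dhomog_grading 3 (xring C) k w); apply: ext => x y t.
  rewrite rmorphM /= map_polyC map_polyXn hornerM hornerC hornerXn mulrC.
  rewrite -[X in _ * X]/(ev w x y) -hy.
  rewrite -[LHS]/((horner_eval t \o map_poly (bieval idfun x y)) (grading w)).
  apply: (rmorph_mmap (g := horner_eval t \o map_poly (bieval idfun x y))) => [c|i] /=.
    rewrite map_polyC /horner_eval hornerC /= /bieval mmapC; done.
  rewrite rmorphM /= map_polyC map_polyX /horner_eval hornerM hornerC hornerX /=.
  by rewrite mulrC; congr (_ * _); exact: bievalY.
apply/inner_gradingP; apply: ext => x y t.
rewrite rmorphM /= map_polyC map_polyXn hornerM hornerC hornerXn mulrC.
rewrite -[X in _ * X]/(ev w x y) -hx.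
rewrite -[LHS]/((horner_eval t \o map_poly (bieval idfun x y)) (inner_grading w)).
apply: (rmorph_mmap (g := horner_eval t \o map_poly (bieval idfun x y))) => [c|i] /=.
  rewrite -[RHS]/((xeval idfun (fun i => t * x i)) c).
  rewrite -[LHS]/((horner_eval t \o map_poly (bieval idfun x y)
     \o map_poly (@mpolyC 3 (xring C))) (grading c)).
  apply: (rmorph_mmap (g := (horner_eval t \o map_poly (bieval idfun x y)
     \o map_poly (@mpolyC 3 (xring C))))) => [b|i] /=.
    by rewrite !map_polyC /horner_eval hornerC /=; exact: bievalC.
  rewrite !rmorphM /= !map_polyC !map_polyX /horner_eval hornerC hornerX /=.
  by rewrite mulrC; congr (_ * _); exact: bievalX.
by rewrite map_polyC /horner_eval hornerC /=; exact: bievalY.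
Qed.

Import numFieldNormedType.Exports.

Section Web.
Variable C : numClosedFieldType.
Implicit Types (x y p : 'I_3 -> C).

Definition embed (i : 'I_3) (u : 'I_2 -> C) : 'I_3 -> C :=
  fun j => if unlift i j is Some j' then u j' else 0.

Lemma local_formE i (w : biring C) z u :
  (local_form i w z).@[u] = ev w (affine_point i z) (embed i u).
Proof.
rewrite /local_form comp_mpoly_meval evE; apply: meval_eq => j.
by rewrite tnth_mktuple /embed; case: unliftP => [j' _|_]; rewrite ?mevalXU ?meval0.
Qed.

Lemma affine_pointE i x j : x i != 0 ->
  x i * affine_point i (affine_coord i x) j = x j.
Proof.
move=> xi; rewrite /affine_point; case: unliftP => [j' ->|->]; last by rewrite mulr1.
by rewrite mxE mulrC divfK.
Qed.

(* The chart [X_i = 1] kills the [i]-th component of [v] by subtracting a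
   multiple of [x]. *)
Lemma ev_chart e k (w : biring C) i x v : bihomogeneous e k w ->
  shear_invariant w -> x i != 0 ->
  ev w x v = x i ^+ e *
    (local_form i w (affine_coord i x)).@[fun m => v (lift i m) - v i / x i * x (lift i m)].
Proof.
move=> hw sw xi; rewrite local_formE -(bihom_evl _ _ _ hw).
rewrite -[LHS](sw _ _ (- (v i / x i))); apply: ev_ext => j.
  by rewrite affine_pointE.
rewrite /embed; case: unliftP => [j' ->|->]; first by rewrite mulNr.
by rewrite mulNr divfK // subrr.
Qed.

Variables (k d : nat) (W : web C k d).

Lemma web_bihom : bihomogeneous (d + k) k (W : biring C).
Proof. by case: (web_formP W). Qed.

Lemma web_shear : shear_invariant (W : biring C).
Proof. by apply/radial_contraction_eq0; case: (web_formP W). Qed.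

Lemma web_neq0 : (W : biring C) != 0.
Proof.
have h0 : (0 : {mpoly C[3]}) \is 1.-homog by exact: rpred0.
have [x [_ _]] := web_sing W (isT : (0 < 1)%N) h0.
by move/eqP; apply: contraNneq => W0; rewrite /sing /at_point W0 raddf0.
Qed.

Lemma polar_sectionE p x : (polar_section W p).@[x] = ev W x p.
Proof. exact: (@meval_constants 3 3 C W). Qed.

Lemma polar_section_homog p : polar_section W p \is (d + k).-homog.
Proof.
rewrite /polar_section mevalE; apply: rpred_sum => m _.
rewrite -(addn0 (d + k)%N); apply: dhomogM; first by case: web_bihom.
elim/big_ind: _ => [|a b ha hb|i _]; first exact: dhomog1.
  by rewrite -[0%N]/(0 + 0)%N; apply: dhomogM.
by rewrite -rmorphXn /= -alg_mpolyC; apply: rpredZ; exact: dhomog1.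
Qed.

(** For [v] on the tangent line [t], the direction from [y] to [v] in the chart is annihilated by
    the corresponding local factor, hence by the product. *)
Lemma tangent_ev y t v : tangent_line W y t -> \sum_i t i * v i = 0 ->
  ev W y v = 0.
Proof.
move=> [_ _ yt [i [a [j [yi [_ fact] ker]]]]] tv.
rewrite (ev_chart v web_bihom web_shear yi).
set u := fun m : 'I_2 => _.
rewrite (nbhs_singleton fact) rmorph_prod (bigD1 j) //= raddf_sum /=.
rewrite [X in _ * (X * _)](_ : _ = 0) ?mul0r ?mulr0 //.
under eq_bigr do rewrite mevalZ mevalXU.
have row_u (c : 'I_2 -> C) : \sum_(m < 2) c m * (\row_m u m) 0 m = \sum_(m < 2) c m * u m.
  by apply: eq_bigr => m _; rewrite mxE.
rewrite -row_u; apply: ker; rewrite row_u /u.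
have := tv; rewrite (bigD1_ord i) //=.
have := yt; rewrite /incident (bigD1_ord i) //=.
set s1 := \sum_(_ < 2) _; set s2 := \sum_(_ < 2) _ => e1 e2.
have -> : \sum_(m < 2) t (lift i m) * (v (lift i m) - v i / y i * y (lift i m)) =
   s2 - v i / y i * s1.
  rewrite /s1 /s2 mulr_sumr -sumrB; apply: eq_bigr => m _; ring.
have -> : s1 = - (t i * y i) by apply/eqP; rewrite -addr_eq0 addrC e1.
have -> : s2 = - (t i * v i) by apply/eqP; rewrite -addr_eq0 addrC e2.
by field.
Qed.

Lemma polar_locus_ev p x : polar_locus W p x -> ev W x p = 0.
Proof.
move=> [l [x0 [i li] xl S] pl].
(* The vector [t_i p - (t . p) e_i] always lies on the line [t] and equals [t_i p] when [p] does. So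
   [G] vanishes on all tangent pairs, and its value at (x, l) is w(x; p) times a nonzero
   constant. *)
pose V t j := t i * p j - (if j == i then \sum_m t m * p m else 0).
pose G : biring C := bieval (@bC C) (@bX C) (fun j => bY C i * bC (p j) -
  (if j == i then \sum_m bY C m * bC (p m) else 0)) W.
have GE y t : ev G y t = ev W y (V t).
  apply: (rmorph_bieval (g := bieval idfun y t)) => [c|j|j] /=.
  - by rewrite bievalC.
  - by rewrite bievalX.
  - rewrite bievalB bievalM bievalY bievalC; congr (_ - _).
    case: ifP => _; last by rewrite bieval0.
    by rewrite raddf_sum; apply: eq_bigr => m _ /=; rewrite bievalM bievalY bievalC.
have hG : bihomogeneous (d + k) k G.
  apply: bihom_ev_scale => y t s; rewrite !GE; first exact: (bihom_evl _ _ _ web_bihom).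
  rewrite -(bihom_evr _ _ _ web_bihom); apply: ev_ext => // j; rewrite /V.
  rewrite mulrBr mulrA; congr (_ - _); case: ifP => _; last by rewrite mulr0.
  by rewrite mulr_sumr; apply: eq_bigr => m _; rewrite mulrA.
have := S _ _ _ hG; rewrite -evE GE => GS.
have : ev W x (V l) = 0.
  apply: GS => y t yt; rewrite -evE GE; apply: (tangent_ev yt).
  under eq_bigr do rewrite mulrBr mulrCA.
  rewrite sumrB -mulr_sumr [X in _ - X](bigD1 i) //= [X in _ - (_ + X)]big1 => [|j ji].
    by rewrite eqxx addr0 subrr.
  by rewrite (negPf ji) mulr0.
have -> : ev W x (V l) = l i ^+ k * ev W x p.
  rewrite -(bihom_evr _ _ _ web_bihom); apply: ev_ext => // j.
  rewrite /V; move: pl; rewrite /incident => ->.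
  by rewrite if_same subr0.
by move/eqP; rewrite mulf_eq0 expf_eq0 (negPf li) andbF /= => /eqP.
Qed.

End Web.

(** One line is enough: it is split off through [p] and a further zero [v], and the cofactor has
    degree [k - 1 > 0]. *)
Lemma degree_zero_generic (C : numClosedFieldType) (k : nat) (W : web C k 0) :
  (2 <= k)%N -> generic (fun p => polar_decomposable W p).
Proof.
move=> k2; have hW := web_bihom W; have sW := web_shear W.
have k0 : (0 < k)%N by rewrite ltnW.
have [x1 [y1 xy1]] := bipoly_nonroot (web_neq0 W).
(* For a center with w(x1; p) nonzero, [x1] shows both that the polar is not the whole plane and
   that the section is nonzero. *)
pose r : {mpoly C[3]} := at_point W x1.
have rE p : r.@[p] = ev W x1 p by rewrite evE.
have x10 : nonzero x1.
  apply: contrapT => nx; move/eqP: xy1; apply.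
  have x10 i : x1 i = 0 * x1 i.
    by rewrite mul0r; apply/eqP/negPn/negP => h; apply: nx; exists i.
  by rewrite (ev_ext W (x' := fun i => 0 * x1 i) (y' := y1) x10) // (bihom_evl _ _ _ hW)
    expr0n eqn0Ngt k0 mul0r.
have homr : r \is k.-homog.
  apply/dhomogP => m; rewrite mcoeff_msupp /r /at_point mcoeff_map_mpoly => mw.
  apply: (dhomog_mf hW.1); rewrite mcoeff_msupp; apply: contraNneq mw => ->.
  by rewrite /= meval0.
exists (fun p => r.@[p] != 0); split.
- exists (fun g => g = r); split=> [g ->|p _]; first by exists k.
  by split=> [rp|[g [-> //]]]; exists r.
- exists y1; rewrite rE; split=> //.
  apply: contrapT => ny; move/eqP: xy1; apply.
  apply: (ev_collinear hW sW k0); exists 0 => i; rewrite mul0r.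
  by apply/eqP/negPn/negP => h; apply: ny; exists i.
move=> p p0; rewrite rE => x1p.
split; first by exists x1 => //; move/polar_locus_ev/eqP; rewrite (negPf x1p).
set s := polar_section W p.
have sE x : s.@[x] = ev W x p by exact: polar_sectionE.
have s0 : s != 0 by apply: contraNneq x1p => s0; rewrite -sE s0 meval0.
split=> //.
have hs : s \is k.-homog by exact: (polar_section_homog W p).
(* On a line through the center the section has degree at most the degree of the web, here 0. *)
have shift x t : s.@[fun i => x i + t * p i] = s.@[x].
  rewrite !sE -line_polyE.
  have /size1_polyC -> : (size (line_poly W x p) <= 1)%N.
    by have := line_poly_size_sub x p hW sW; rewrite add0n subnn.
  rewrite hornerC.
  have -> : ev W x p = (line_poly W x p).[0].
    by rewrite line_polyE; apply: ev_ext => // i; rewrite mul0r addr0.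
  by rewrite horner_coef0.
have [v [sv nc]] : exists v, s.@[v] = 0 /\ ~ collinear p v.
  apply: (off_center_zero k0 hs) => // y [c py].
  have -> : s.@[y] = s.@[fun i => c * p i] by apply: meval_eq.
  rewrite (dhomog_meval _ _ hs) sE (ev_collinear hW sW k0) ?mulr0 //.
  by exists 1 => i; rewrite mul1r.
have [i [j m0]] := not_collinear_minor p0 nc.
have ij : i != j by apply: contraNneq m0 => ->; rewrite /minor subrr.
have [l [li lj ijl]] := ord3_third ij.
pose a := frame2_coef p v i j l.
have aE := frame2_sum m0 li lj.
have ab : \sum_k a k * unit_vec C l k = 1.
  rewrite aE; have [_ _ <-] := frame_eval m0 li lj 0 0 1.
  by congr frame2; apply: funext => h; rewrite !mul0r !add0r mul1r.
have [g2 es] : divides (linear_form a) s.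
  apply: (linear_form_divides ab) => x; rewrite aE => x2.
  have -> : s.@[x] = s.@[fun h => frame1 p v i j x * v h + frame0 p v i j x * p h].
    by apply: meval_eq => h; rewrite {1}(frameE m0 li lj ijl x h) x2 mul0r addr0 addrC.
  by rewrite shift (dhomog_meval _ _ hs) sv mulr0.
rewrite mulrC in es.
have h1 := linear_form_homog a.
have [j2 h2] : exists j2, g2 \is j2.-homog.
  by apply: (@dhomog_factor _ _ k g2 (linear_form a)); rewrite mulrC -es.
have ek : k = (1 + j2)%N.
  by apply: (dhomog_uniq s0 hs); rewrite es; exact: dhomogM.
exists 1%N, j2, (linear_form a), g2; split=> //.
by move: k2; rewrite ek add1n ltnS.
Qed.

(** * Factors of a web are webs *)

Section Holomorphic.
Variable C : numClosedFieldType.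
Implicit Types (z : 'rV[C]_2) (f g : 'rV[C]_2 -> C).

Lemma near_all z (P : 'rV[C]_2 -> Prop) : (forall y, P y) -> \forall y \near z, P y.
Proof. by move=> h; near=> y; exact: h. Unshelve. all: by end_near. Qed.

Lemma near_forall_ord z k (P : 'I_k -> 'rV[C]_2 -> Prop) :
  (forall j, \forall y \near z, P j y) -> \forall y \near z, forall j, P j y.
Proof.
move=> h; suff : \forall y \near z, forall j, j \in enum 'I_k -> P j y.
  by apply: filterS => y hy j; apply: hy; rewrite mem_enum.
elim: (enum 'I_k) => [|j s IHs]; first exact: near_all.
move: (h j) IHs; apply: filterS2 => y pj ps i.
by rewrite inE => /orP[/eqP ->//|]; exact: ps.
Qed.

Lemma holomorphic_cst z (c : C) : holomorphic_at z (fun=> c).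
Proof. by apply: near_all => y; exact: differentiable_cst. Qed.

Lemma holomorphic_coord z (m : 'I_2) : holomorphic_at z (fun y => y 0 m).
Proof. by apply: near_all => y; exact: differentiable_coord. Qed.

Lemma holomorphicD z f g : holomorphic_at z f -> holomorphic_at z g ->
  holomorphic_at z (fun y => f y + g y).
Proof. by apply: filterS2 => y df dg; exact: differentiableD. Qed.

Lemma holomorphicM z f g : holomorphic_at z f -> holomorphic_at z g ->
  holomorphic_at z (fun y => f y * g y).
Proof. by apply: filterS2 => y df dg; exact: differentiableM. Qed.

Lemma holomorphicN z f : holomorphic_at z f -> holomorphic_at z (fun y => - f y).
Proof. by apply: filterS => y df; exact: differentiableN. Qed.

Lemma holomorphic_sum z (I : Type) (r : seq I) (P : pred I) (F : I -> 'rV[C]_2 -> C) :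
  (forall i, P i -> holomorphic_at z (F i)) ->
  holomorphic_at z (fun y => \sum_(i <- r | P i) F i y).
Proof.
move=> hF; elim: r => [|i r IHr].
  by under eq_fun do rewrite big_nil; exact: holomorphic_cst.
under eq_fun do rewrite big_cons; case Pi: (P i) => //.
by apply: holomorphicD => //; exact: hF.
Qed.

Lemma holomorphic_prod z (I : Type) (r : seq I) (P : pred I) (F : I -> 'rV[C]_2 -> C) :
  (forall i, P i -> holomorphic_at z (F i)) ->
  holomorphic_at z (fun y => \prod_(i <- r | P i) F i y).
Proof.
move=> hF; elim: r => [|i r IHr].
  by under eq_fun do rewrite big_nil; exact: holomorphic_cst.
under eq_fun do rewrite big_cons; case Pi: (P i) => //.
by apply: holomorphicM => //; exact: hF.
Qed.

Lemma holomorphic_near_neq0 z f : holomorphic_at z f -> f z != 0 ->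
  \forall y \near z, f y != 0.
Proof.
move=> /nbhs_singleton /differentiable_continuous cf fz.
exact: (cvgr_neq0 _ cf fz).
Qed.

Lemma holomorphicV z f : holomorphic_at z f -> f z != 0 ->
  holomorphic_at z (fun y => (f y)^-1).
Proof.
move=> hf fz; have := holomorphic_near_neq0 hf fz; move: hf.
by apply: filterS2 => y df fy; exact: differentiableV.
Qed.

Lemma holomorphic_ev z (w : biring C) (X Y : 'I_3 -> 'rV[C]_2 -> C) :
  (forall i, holomorphic_at z (X i)) -> (forall i, holomorphic_at z (Y i)) ->
  holomorphic_at z (fun y => ev w (X^~ y) (Y^~ y)).
Proof.
move=> hX hY; elim/bipoly_ind: w => [c|i|i|p q IHp IHq|p q IHp IHq].
- by under eq_fun do rewrite evC; exact: holomorphic_cst.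
- by under eq_fun do rewrite /ev bievalX.
- by under eq_fun do rewrite /ev bievalY.
- by under eq_fun do rewrite evD; exact: holomorphicD.
- by under eq_fun do rewrite evM; exact: holomorphicM.
Qed.

Lemma holomorphic_affine_point z i j : holomorphic_at z (fun y => affine_point i y j).
Proof.
rewrite /affine_point; case: unliftP => [j' _|_]; last exact: holomorphic_cst.
exact: holomorphic_coord.
Qed.

Lemma germ_polyC z f : holomorphic_at z f -> germ_poly z (fun y => (f y)%:MP).
Proof.
move=> hf; split=> [m|].
  under eq_fun do rewrite mcoeffC; apply: holomorphicM => //; exact: holomorphic_cst.
exists 1%N; apply: near_all => y; rewrite msizeC; exact: leq_b1.
Qed.

Lemma germ_poly_cst z (b : {mpoly C[2]}) : germ_poly z (fun=> b).
Proof.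
split=> [m|]; first exact: holomorphic_cst.
by exists (msize b); apply: near_all.
Qed.

Lemma germ_polyD z b c : germ_poly z b -> germ_poly z c ->
  germ_poly z (fun y => b y + c y).
Proof.
move=> [hb [m sb]] [hc [n sc]]; split=> [k|].
  by under eq_fun do rewrite mcoeffD; exact: holomorphicD.
exists (maxn m n); move: sb sc; apply: filterS2 => y sb sc.
rewrite (leq_trans (msizeD_le _ _)) // geq_max leq_max sb /=.
by rewrite leq_max sc orbT.
Qed.

Lemma germ_polyM z b c : germ_poly z b -> germ_poly z c ->
  germ_poly z (fun y => b y * c y).
Proof.
move=> [hb [m sb]] [hc [n sc]]; split=> [k|].
  under eq_fun do rewrite mcoeffM.
  by apply: holomorphic_sum => i _; exact: holomorphicM.
exists (m + n).+1; move: sb sc; apply: filterS2 => y sb sc.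
have := msizeM_le (b y) (c y); lia.
Qed.

Lemma mpoly_ext n (F : numDomainType) (p q : {mpoly F[n]}) :
  (forall x, p.@[x] = q.@[x]) -> p = q.
Proof.
move=> e; apply/eqP; rewrite -subr_eq0; apply/eqP/mpoly_eq0_meval => x.
by rewrite mevalB e subrr.
Qed.

Lemma local_formM i (u v : biring C) z :
  local_form i (u * v) z = local_form i u z * local_form i v z.
Proof. by apply: mpoly_ext => x; rewrite mevalM !local_formE evM. Qed.

Lemma local_formD i (u v : biring C) z :
  local_form i (u + v) z = local_form i u z + local_form i v z.
Proof. by apply: mpoly_ext => x; rewrite mevalD !local_formE evD. Qed.

Lemma germ_poly_local_form z i (w : biring C) : germ_poly z (local_form i w).
Proof.
elim/bipoly_ind: w => [c|j|j|p q IHp IHq|p q IHp IHq].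
- have -> : local_form i (bC c) = fun=> c%:MP.
    by apply: funext => y; apply: mpoly_ext => x; rewrite local_formE evC mevalC.
  exact: germ_poly_cst.
- have -> : local_form i (bX C j) = fun y => (affine_point i y j)%:MP.
    by apply: funext => y; apply: mpoly_ext => x; rewrite local_formE /ev bievalX mevalC.
  apply: germ_polyC; exact: holomorphic_affine_point.
- have -> : local_form i (bY C j) = fun=> if unlift i j is Some j' then 'X_j' else 0.
    apply: funext => y; apply: mpoly_ext => x; rewrite local_formE /ev bievalY /embed.
    by case: unliftP => [j' _|_]; rewrite ?mevalXU ?meval0.
  exact: germ_poly_cst.
- have -> : local_form i (p + q) = fun y => local_form i p y + local_form i q y.
    by apply: funext => y; exact: local_formD.
  exact: germ_polyD.
- have -> : local_form i (p * q) = fun y => local_form i p y * local_form i q y.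
    by apply: funext => y; exact: local_formM.
  exact: germ_polyM.
Qed.

Lemma germ_squarefree_factor z i (u v : biring C) :
  germ_squarefree z (local_form i (u * v)) -> germ_squarefree z (local_form i v).
Proof.
move=> sf b c hb hc e; apply: (sf b (fun y => c y * local_form i u y)) => //.
  by apply: germ_polyM => //; exact: germ_poly_local_form.
by move: e; apply: filterS => y e; rewrite local_formM e mulrC -mulrA.
Qed.

End Holomorphic.

(** Each prime [A j] divides [q] or [c], and [J] decides which. Once all are cancelled, the
    remaining factors have product 1 and so are constants. *)
Lemma factor_linear_split (n : nat) (F : fieldType) (I : eqType) (J : pred I)
    (A : I -> {mpoly F[n]}) (s : seq I) (q c : {mpoly F[n]}) :
  (forall j, j \in s -> prime_elt (A j)) ->
  (forall j, j \in s -> J j -> ~ divides (A j) c) ->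
  (forall j, j \in s -> ~~ J j -> ~ divides (A j) q) ->
  q * c = \prod_(j <- s) A j ->
  exists b : F, q = b *: \prod_(j <- s | J j) A j.
Proof.
elim: s q c => [|j s IHs] q c pA Jc Jq.
  rewrite !big_nil => qc.
  have : q * c != 0 by rewrite qc oner_neq0.
  rewrite mulf_eq0 negb_or => /andP[q0 c0].
  have := msizeM q0 c0; rewrite qc msize1.
  rewrite -!msize_poly_eq0 -!lt0n in q0 c0.
  move=> e; have /msize1_polyC -> : (msize q <= 1)%N.
    by move: e q0 c0; case: (msize q) => [|[|a]] //; case: (msize c) => // b; rewrite !addnS.
  by exists q@_0; rewrite -alg_mpolyC.
rewrite big_cons => qc.
have pj : prime_elt (A j) by apply: pA; rewrite mem_head.
have [A0 _ pp] := pj.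
have sub k : k \in s -> k \in j :: s by rewrite inE orbC => ->.
have qcj : divides (A j) (q * c) by rewrite qc; exact: divides_mulr.
case: (boolP (J j)) => Jj.
  have [[q' eq]|/(Jc _ (mem_head _ _) Jj) //] := pp _ _ qcj.
  have [||||b eb] := IHs q' c.
  - by move=> k ks; apply: pA; exact: sub.
  - by move=> k ks; apply: Jc; exact: sub.
  - by move=> k ks Jk h; apply: (Jq k (sub _ ks) Jk); rewrite eq; exact: dividesMr.
  - by apply: (mulfI A0); rewrite mulrA [A j * q']mulrC -eq.
  by exists b; rewrite big_cons Jj eq eb -scalerAl mulrC.
have [/(Jq _ (mem_head _ _) Jj) //|[c' ec]] := pp _ _ qcj.
have [||||b eb] := IHs q c'.
- by move=> k ks; apply: pA; exact: sub.
- by move=> k ks Jk h; apply: (Jc k (sub _ ks) Jk); rewrite ec; exact: dividesMr.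
- by move=> k ks; apply: Jq; exact: sub.
- by apply: (mulfI A0); rewrite mulrCA [A j * c']mulrC -ec.
by exists b; rewrite big_cons (negPf Jj).
Qed.

Section GermFactor.
Variable C : numClosedFieldType.

(** Spans the kernel of [linear_form b] when [b] is nonzero, and depends linearly on [b]. *)
Definition rho (b : 'I_2 -> C) : 'I_2 -> C := fun m => if m == 0 then - b 1 else b 0.

Lemma linear_form_rho b : (linear_form b).@[rho b] = 0.
Proof.
rewrite linear_formE !big_ord_recl big_ord0 /rho /= addr0.
have -> : lift ord0 ord0 = 1 :> 'I_2 by apply: val_inj.
by rewrite [ord0]/(0 : 'I_2) /=; ring.
Qed.

Lemma rho_eq0 b : (forall m, rho b m = 0) -> forall m, b m = 0.
Proof.
move=> h m; have := h 0; have := h 1; rewrite /rho /= => b0 /eqP.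
rewrite oppr_eq0 => /eqP b1.
by case: m => -[|[|//]] ?; [rewrite -[RHS]b0|rewrite -[RHS]b1]; congr b; apply: val_inj.
Qed.

Lemma prime_linear_form2 b : (exists m, b m != 0) -> prime_elt (linear_form b : {mpoly C[2]}).
Proof.
move=> [m bm]; apply: (@prime_linear_form _ _ b (fun m' => (m' == m)%:R / b m)).
rewrite (bigD1 m) //= eqxx mulr1n big1 ?addr0; first by field.
by move=> m' /negPf ->; rewrite mul0r mulr0.
Qed.

Lemma ev_embed0 e k (w : biring C) i x (u : 'I_2 -> C) : bihomogeneous e k w ->
  (0 < k)%N -> (forall m, u m = 0) -> ev w x (embed i u) = 0.
Proof.
move=> hw k0 u0; rewrite (ev_ext w (x' := x) (y' := fun j => 0 * embed i u j)) //.
  by rewrite (bihom_evr _ _ _ hw) expr0n eqn0Ngt k0 mul0r.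
by move=> j; rewrite mul0r /embed; case: unliftP.
Qed.

Lemma holomorphic_embed z i (u : 'I_2 -> 'rV[C]_2 -> C) j :
  (forall m, holomorphic_at z (u m)) -> holomorphic_at z (fun y => embed i (u^~ y) j).
Proof.
by move=> hu; rewrite /embed; case: unliftP => // _; exact: holomorphic_cst.
Qed.

(** Each local 1-form goes to [q] or to [c] according to which of them vanishes on its kernel.
    Coprimality at [x] makes this choice unambiguous, and nonvanishing is an open condition, so the
    same choice is valid near [z]. *)
Lemma web_germ_factor (e1 k1 e2 k2 e k : nat) (q c : biring C) (x : 'I_3 -> C) :
  bihomogeneous e1 k1 q -> bihomogeneous e2 k2 c -> bihomogeneous e k (c * q) ->
  shear_invariant (c * q) -> (0 < k1)%N -> (0 < k2)%N ->
  (exists y, ev (c * q) x y != 0) ->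
  (forall y, ev q x y = 0 -> ev c x y = 0 -> collinear x y) ->
  web_germ k (c * q) x -> web_germ k1 q x.
Proof.
move=> hq hc hcq scq k1_gt0 k2_gt0 [y0 xy0] cop [i xi [sf [a [ha fact]]]]; exists i => //.
split; first exact: germ_squarefree_factor sf.
set z := affine_coord i x in ha fact *.
have evz (w : biring C) e' k' u : bihomogeneous e' k' w ->
    ev w x u = x i ^+ e' * ev w (affine_point i z) u.
  move=> hw; rewrite -(bihom_evl _ _ _ hw); apply: ev_ext => // j.
  by rewrite affine_pointE.
pose av y (j : 'I_k) := fun m => a j m y.
have factE y j : \sum_(m < 2) a j m y *: 'X_m = linear_form (av y j) by [].
have lz0 : local_form i (c * q) z != 0.
  apply: contraNneq xy0 => l0.
  by rewrite (ev_chart y0 hcq scq xi) -/z l0 meval0 mulr0.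
(* The chart direction has entry 0 at [i], where [x] does not vanish; being collinear with [x] it is
   zero, so factor [j] and with it the whole form vanish at [z]. *)
have nz j : ~ ((local_form i q z).@[rho (av z j)] = 0 /\
               (local_form i c z).@[rho (av z j)] = 0).
  rewrite !local_formE => -[q0 c0].
  have [b hb] : collinear x (embed i (rho (av z j))).
    by apply: cop; rewrite ?(evz _ _ _ _ hq) ?(evz _ _ _ _ hc) ?q0 ?c0 mulr0.
  have b0 : b = 0.
    have := hb i; rewrite /embed unlift_none => /esym/eqP.
    by rewrite mulf_eq0 (negPf xi) orbF => /eqP.
  have /rho_eq0 r0 m : rho (av z j) m = 0.
    by have := hb (lift i m); rewrite /embed liftK b0 mul0r.
  move/eqP: lz0; apply; rewrite (nbhs_singleton fact) (bigD1 j) //=.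
  rewrite big1 ?mul0r // => m _; have := r0 m; rewrite /av => ->.
  by rewrite scale0r.
have hol (w : biring C) j :
    holomorphic_at z (fun y => (local_form i w y).@[rho (av y j)]).
  under eq_fun do rewrite local_formE.
  apply: (@holomorphic_ev _ _ _ (fun l y => affine_point i y l)
    (fun l y => embed i (rho (av y j)) l)) => l.
    exact: holomorphic_affine_point.
  apply: (@holomorphic_embed z i (fun m y => rho (av y j) m)) => m.
  by rewrite /rho; case: (m == 0); [apply: holomorphicN|]; exact: ha.
pose J := [set j | (local_form i q z).@[rho (av z j)] == 0].
have good : \forall y \near z, forall j : 'I_k,
    if j \in J then (local_form i c y).@[rho (av y j)] != 0
    else (local_form i q y).@[rho (av y j)] != 0.
  apply: near_forall_ord => j; case Jj: (j \in J); rewrite inE in Jj.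
    apply: (holomorphic_near_neq0 (hol c j)).
    by apply/negP => /eqP c0; exact: (nz j (conj (eqP Jj) c0)).
  by apply: (holomorphic_near_neq0 (hol q j)); rewrite Jj.
pose A y j : {mpoly C[2]} := linear_form (av y j).
have splitA y : local_form i (c * q) y = \prod_(j < k) A y j ->
    (forall j : 'I_k,
      if j \in J then (local_form i c y).@[rho (av y j)] != 0
      else (local_form i q y).@[rho (av y j)] != 0) ->
    (forall j, prime_elt (A y j)) /\
    exists b : C, local_form i q y = b *: \prod_(j in J) A y j.
  move=> fy gy.
  have pA j : prime_elt (A y j).
    apply: prime_linear_form2; apply: contrapT => na.
    have r0 m : rho (av y j) m = 0.
      have a0 m' : av y j m' = 0.
        by apply/eqP/negPn/negP => am; apply: na; exists m'.
      by rewrite /rho !a0 oppr0; case: ifP.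
    have := gy j; rewrite !local_formE.
    by rewrite (ev_embed0 i _ hc k2_gt0 r0) (ev_embed0 i _ hq k1_gt0 r0) eqxx; case: ifP.
  split=> //.
  have dv j (p : {mpoly C[2]}) : divides (A y j) p -> p.@[rho (av y j)] = 0.
    by move=> [h ->]; rewrite mevalM linear_form_rho mulr0.
  apply: (@factor_linear_split 2 C _ (fun j => j \in J) (A y) _ _ (local_form i c y)).
  - by move=> j _; exact: pA.
  - by move=> j _ Jj /dv c0; have := gy j; rewrite Jj c0 eqxx.
  - by move=> j _ /negPf Jj /dv q0; have := gy j; rewrite Jj q0 eqxx.
  - by rewrite mulrC -local_formM fy.
have [pz [bz ez]] := splitA z (nbhs_singleton fact) (nbhs_singleton good).
have [u0 Du0] : exists u0, (\prod_(j in J) A z j).@[u0] != 0.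
  by apply: mpoly_nonroot; apply/prodf_neq0 => j _; case: (pz j).
(* The unknown proportionality factor is holomorphic: it is the quotient of two values at the fixed
   vector [u0], with denominator [D] nonzero at [z]. *)
pose D y := \prod_(j in J) \sum_m av y j m * u0 m.
have DE y : (\prod_(j in J) A y j).@[u0] = D y.
  by rewrite rmorph_prod; apply: eq_bigr => j _ /=; rewrite linear_formE.
have holD : holomorphic_at z D.
  apply: holomorphic_prod => j _; apply: holomorphic_sum => m _.
  by apply: holomorphicM; [exact: ha | exact: holomorphic_cst].
rewrite DE in Du0.
pose kappa y := (local_form i q y).@[u0] / D y.
have hol_kappa : holomorphic_at z kappa.
  apply: holomorphicM; last exact: holomorphicV.
  under eq_fun do rewrite local_formE.
  apply: (@holomorphic_ev _ _ _ (fun l y => affine_point i y l)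
    (fun l y => embed i u0 l)) => l; first exact: holomorphic_affine_point.
  exact: holomorphic_cst.
have fact_q : \forall y \near z, local_form i q y = kappa y *: \prod_(j in J) A y j.
  have Dy := holomorphic_near_neq0 holD Du0.
  move: fact good Dy; apply: filterS3 => y fy gy Dy.
  have [_ [b eb]] := splitA y fy gy.
  by rewrite /kappa eb mevalZ DE mulfK.
(* Compare the degrees in the differentials by scaling a vector [u]. *)
have cardJ : k1 = #|J|.
  have lq0 : local_form i q z != 0.
    by apply: contraNneq lz0 => l0; rewrite local_formM l0 mulr0.
  have [u lu] := mpoly_nonroot lq0.
  apply: (expf_inj lu) => t; rewrite [in LHS]local_formE -(bihom_evr _ _ _ hq).
  rewrite (ev_ext q (x' := affine_point i z) (y' := embed i (fun m => t * u m))) //; last first.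
    by move=> j; rewrite /embed; case: unliftP => // _; rewrite mulr0.
  rewrite -local_formE ez !mevalZ !rmorph_prod mulrCA; congr (_ * _).
  rewrite -prodr_const -big_split /=; apply: eq_bigr => j _.
  rewrite !linear_formE mulr_sumr; apply: eq_bigr => m _; ring.
clear hq; subst k1.
pose i0 := Ordinal k1_gt0.
(* The scalar [kappa] is absorbed into the first 1-form, which exists since [k1 > 0]. *)
exists (fun i' m y => (if i' == i0 then kappa y else 1) * a (enum_val i') m y).
split=> [i' m|].
  apply: holomorphicM; last exact: ha.
  by case: (i' == i0) => //; exact: holomorphic_cst.
move: fact_q; apply: filterS => y ->.
rewrite [in LHS]big_enum_val /=.
under [in RHS]eq_bigr => i' _.
  under eq_bigr do rewrite -scalerA.
  rewrite -scaler_sumr.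
over.
rewrite scaler_prod; congr (_ *: _).
by rewrite -big_mkcond big_pred1_eq.
Qed.

End GermFactor.

(** * Irreducible webs as prime elements *)

Section WebPrime.
Variable C : numClosedFieldType.

Lemma bihom0_const e (u : biring C) : bihomogeneous e 0 u ->
  exists g : {mpoly C[3]}, u = (g : xring C)%:MP /\ g \is e.-homog.
Proof.
move=> [hu hg]; exists (u : {mpoly (xring C)[3]})@_0; split; last exact: hg.
apply/mpolyP => m; rewrite mcoeffC; have [<-|m0] := eqVneq 0%MM m; first by rewrite mulr1.
rewrite mulr0; apply: (dhomog_nemf_coeff hu).
by rewrite /= mdeg_eq0 eq_sym.
Qed.

Lemma prime_elt_unit (R : idomainType) (a p : R) :
  divides a 1 -> prime_elt p -> prime_elt (a * p).
Proof.
move=> [b ab] [p0 pu pp]; have a0 : a != 0.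
  by apply: contraTneq isT => a0; move/eqP: ab; rewrite a0 mulr0 oner_eq0.
have ap x : divides p x -> divides (a * p) x.
  by move=> [y ->]; exists (y * b); rewrite -mulrA [b * _]mulrA -ab mul1r.
split.
- by rewrite mulf_neq0.
- by move=> h; apply: pu; apply: divides_trans h; exact: divides_mull.
- move=> x y h; have [] := pp x y _; first by apply: divides_trans h; exact: divides_mull.
  + by move/ap; left.
  + by move/ap; right.
Qed.

Variables (k d : nat) (W : web C k d).

(** A factor without differentials is the equation of a curve contained in the singular set, which
    codimension two excludes unless it is constant. *)
Lemma web_factor_const (u v : biring C) e : (W : biring C) = u * v ->
  bihomogeneous e 0 u -> exists a : C, u = bC a.
Proof.
move=> Wuv hu; have [g [ug hg]] := bihom0_const hu.
have [e0|e0] := posnP e.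
  move: hg; rewrite e0 => hg; exists g@_0; rewrite ug /bC; congr (_%:MP).
  apply/mpolyP => m; rewrite mcoeffC; have [<-|m0] := eqVneq 0%MM m; first by rewrite mulr1.
  rewrite mulr0; apply: (dhomog_nemf_coeff hg).
  by rewrite /= mdeg_eq0 eq_sym.
have [x [x0 gx []]] := web_sing W e0 hg.
apply: mpoly_eq0_meval => y; rewrite -evE Wuv evM.
have -> : ev u x y = g.@[x] by rewrite evE ug /at_point map_mpolyC mevalC.
by rewrite gx mul0r.
Qed.

(** Take a prime factor [q] with cofactor [c]; both inherit bihomogeneity and shear invariance. If
    [c] has positive degree in the differentials, both are webs, against irreducibility; otherwise
    [c] is a constant and [W] is prime along with [q]. *)
Lemma web_prime : (0 < k)%N -> web_irreducible W -> prime_elt (W : biring C).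
Proof.
move=> k0 irr; have hW := web_bihom W; have sW := web_shear W; have W0 := web_neq0 W.
have Wu : ~ divides (W : biring C) 1.
  move=> [c ec].
  have e0 : ev W (fun=> 0) (fun=> 0 * 0) = 0.
    rewrite (@bihom_evr _ _ _ _ _ (fun=> 0) 0 hW).
    by rewrite expr0n eqn0Ngt k0 mul0r.
  have : 1 = ev c (fun=> 0) (fun=> 0 * 0) * ev W (fun=> 0) (fun=> 0 * 0).
    by rewrite -evM -ec /ev bieval1.
  by rewrite e0 [RHS]mulr0 => /eqP; rewrite oner_eq0.
have fac : factorial_ring (biring C).
  apply: factorial_mpoly; apply: factorial_mpoly; exact: factorial_field.
have [q pq [c Wcq]] := prime_elt_divisor fac W0 Wu.
have [q0 qu _] := pq.
have W0' := W0; rewrite Wcq in W0'.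
have hW' := hW; rewrite Wcq in hW'.
have sW' := sW; rewrite Wcq in sW'.
have [e2 [k2 [e1 [k1 [hc hq ee ek]]]]] := bihom_factors W0' hW'.
have sc := shear_factor W0' sW'.
have sq : shear_invariant q.
  by apply: (@shear_factor _ q c); rewrite mulrC.
have c0 : c != 0 by apply: contraNneq W0' => ->; rewrite mul0r.
have unitC a : bC a != 0 -> divides (bC a) 1.
  move=> a0; exists (bC a^-1); rewrite -rmorphM mulVf ?rmorph1 //.
  by apply: contraNneq a0 => ->; rewrite rmorph0.
have [k10|k1_gt0] := posnP k1.
  rewrite k10 in hq; have [a qa] : exists a, q = bC a.
    by apply: (@web_factor_const q c e1) => //; rewrite mulrC.
  by case: qu; rewrite qa; apply: unitC; rewrite -qa.
have [k20|k2_gt0] := posnP k2.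
  rewrite k20 in hc; have [a ca] := web_factor_const Wcq hc.
  rewrite Wcq ca; apply: prime_elt_unit => //; apply: unitC; by rewrite -ca.
have [g [_ [g0 _ gP]]] := generic_homog_nonroot (web_generic_germ W).
(* Otherwise [q ^+ 2] divides [W], and by square-freeness the local form of [q] is a unit germ; but
   it vanishes at the zero vector. *)
have nqc : ~ divides q c.
  move=> [c' ec]; have [x [x0 gx]] := nonzero_nonroot g0.
  have [i xi [sf _]] := gP x x0 gx.
  have [|||b _ qb] := sf (local_form i q) (local_form i c').
  - exact: germ_poly_local_form.
  - exact: germ_poly_local_form.
  - apply: near_all => y; rewrite Wcq ec !local_formM; ring.
  have := congr1 (meval (fun=> 0)) (nbhs_singleton qb).
  rewrite mevalM local_formE (ev_embed0 i _ hq k1_gt0) // mul0r meval1 => /eqP.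
  by rewrite eq_sym oner_eq0.
have inv x y s t : ev q x y = 0 -> ev c x y = 0 ->
    ev q x (fun i => s * y i + t * x i) = 0 /\
    ev c x (fun i => s * y i + t * x i) = 0.
  move=> qxy cxy.
  by rewrite sq sc (bihom_evr _ _ _ hq) (bihom_evr _ _ _ hc) qxy cxy !mulr0.
have [r [r0 rP]] := coprime_generic pq nqc inv.
have [x1 [y1 xy1]] := bipoly_nonroot W0.
have [m Wm] : exists m, ((W : biring C) : {mpoly (xring C)[3]})@_m != 0.
  apply: contrapT => h; move/eqP: W0; apply; apply/mpolyP => m.
  by rewrite mcoeff0; apply/eqP/negPn/negP => Wm; apply: h; exists m.
set h := (_ : {mpoly (xring C)[3]})@_m in Wm.
have Wx x : (h : {mpoly C[3]}).@[x] != 0 -> exists y, ev W x y != 0.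
  move=> hx; apply: contrapT => n; move/eqP: hx; apply.
  have : at_point W x = 0.
    apply: mpoly_eq0_meval => z; rewrite -evE.
    by apply/eqP/negPn/negP => Wz; apply: n; exists z.
  move/(congr1 (fun p => p@_m)); rewrite mcoeff0 => <-.
  by rewrite /at_point mcoeff_map_mpoly.
(* The three conditions on a point: [g] makes the germ of [W] that of a web, [r] separates the zeros
   of [q] and [c], and [h] keeps the point off the singular set. *)
have rgh0 : g * r * (h : {mpoly C[3]}) != 0 by rewrite !mulf_neq0.
have germ_scale k' (w : biring C) x s : s != 0 ->
    web_germ k' w (fun i => s * x i) -> web_germ k' w x.
  move=> s0 [i xi H]; exists i; first by apply: contraNneq xi => ->; rewrite mulr0.
  suff <- : affine_coord i (fun i => s * x i) = affine_coord i x by [].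
  apply/rowP => j; rewrite !mxE; have xi0 : x i != 0.
    by apply: contraNneq xi => ->; rewrite mulr0.
  by field; rewrite s0 xi0.
have gq : generic (web_germ k1 q).
  apply: (nonroot_generic rgh0) => [x s s0|x x0]; first exact: germ_scale.
  rewrite !mevalM !mulf_eq0 !negb_or => /andP[/andP[gx rx] hx].
  apply: (web_germ_factor hq hc hW' sW' k1_gt0 k2_gt0 (k := k)).
  - by have [y xy] := Wx x hx; exists y; rewrite -Wcq.
  - by move=> y; exact: rP.
  - by have := gP x x0 gx; rewrite Wcq.
have gc : generic (web_germ k2 c).
  apply: (nonroot_generic rgh0) => [x s s0|x x0]; first exact: germ_scale.
  rewrite !mevalM !mulf_eq0 !negb_or => /andP[/andP[gx rx] hx].
  have Wqc := Wcq; rewrite mulrC in Wqc.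
  have hWqc := hW; rewrite Wqc in hWqc; have sWqc := sW; rewrite Wqc in sWqc.
  apply: (web_germ_factor hc hq hWqc sWqc k2_gt0 k1_gt0 (k := k)).
  - by have [y xy] := Wx x hx; exists y; rewrite -Wqc.
  - by move=> y c1 q1; exact: rP.
  - by have := gP x x0 gx; rewrite Wqc.
have twisted e' k' (w : biring C) : w != 0 -> bihomogeneous e' k' w ->
    shear_invariant w -> twisted_symform k' (e' - k') w.
  move=> w0 hw sw; split; last exact/radial_contraction_eq0.
  by rewrite subnK //; exact: (bihom_ge w0 hw sw).
have singf (u v : biring C) : (W : biring C) = u * v -> sing_codim2 v.
  move=> Wuv e g' e0 hg; have [x [x0 gx sx]] := web_sing W e0 hg.
  exists x; split=> // vx; apply: sx; apply: mpoly_eq0_meval => y.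
  by rewrite -evE Wuv evM [ev v x y]evE vx meval0 mulr0.
have Wqc : (W : biring C) = q * c by rewrite mulrC.
case: irr; exists k2, (e2 - k2)%N, k1, (e1 - k1)%N.
exists (Web (twisted _ _ _ c0 hc sc) (singf _ _ Wqc) gc).
exists (Web (twisted _ _ _ q0 hq sq) (singf _ _ Wcq) gq).
split=> //; exists 1; first exact: oner_neq0.
have : (W : biring C) = bC 1 * (c * q) by rewrite rmorph1 mul1r.
exact.
Qed.

End WebPrime.

Lemma generic_decomposable_degree (C : numClosedFieldType) (k d : nat) (W : web C k d) :
  (0 < k)%N -> web_irreducible W -> generic (polar_decomposable W) -> d = 0%N.
Proof.
move=> k0 irr gen; apply/eqP; rewrite -leqn0 leqNgt; apply/negP => d0.
have hw := web_bihom W; have sw := web_shear W.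
have pw := web_prime k0 irr.
have [g [m [g0 hg hP]]] := generic_homog_nonroot gen.
have kn : (0 < k < d + k)%N by rewrite k0 -[k in (k < _)%N]add0n ltn_add2r.
have [x [v [i [j [l [[gx xv0 d1 vx0] [m0 li lj ijl]]]]]]] :=
  transversal_point hw sw pw kn g0.
move/eqP: gx; apply.
apply: (split_center_vanish pw hw sw k0 (leq_addl d k) m0 li lj ijl xv0 d1 vx0 hg).
move=> y y0 gy; have [_ [s0 [e1 [e2 [g1 [g2 [e10 e20 h1 h2 es]]]]]]] := hP y y0 gy.
exists e1, e2, g1, g2; split=> //.
  have hs := polar_section_homog W y.
  by apply: (dhomog_uniq s0 _ hs); rewrite es; exact: dhomogM.
by split=> // X; rewrite -polar_sectionE es mevalM.
Qed.

Theorem theorem3p1 (R : realType) (k d : nat) (W : web R[i] k d) :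
  (2 <= k)%N -> web_irreducible W ->
  (generic (fun p : 'I_3 -> R[i] => polar_decomposable W p) <-> d = 0%N).
Proof.
move=> k2 irr; split; first exact: generic_decomposable_degree (ltnW k2) irr.
by move=> d0; move: W irr; rewrite d0 => W _; exact: degree_zero_generic.
Qed.
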